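(* Given any $p>1$, there exist operators $L=\operatorname{div}A\nabla$, elliptic with real, bounded, measurable (not necessarily symmetric) $2\times2$ coefficient matrix $A=A(x)$ independent of the $t$-variable, in the domain $\Omega=\{(x,t)\in\mathbf{R}^2:\phi(x)<t\}$ above the graph of a Lipschitz function $\phi$, for which $(N)_p$ and $(R)_p$ do not hold.
   Context: Setting: $\Omega=\{(x,t)\in\mathbf{R}^2:\phi(x)<t\}$ with $\phi$ Lipschitz; $A=(a_{ij})$ has real-valued bounded measurable entries with $\max_{i,j}\|a_{ij}\|_{L^\infty(\Omega)}=\Lambda<\infty$ and $\lambda|\xi|^2\le\xi\cdot A\xi$ for some $\lambda>0$ and all $\xi\in\mathbf{R}^2$; $A$ need not be symmetric. $\tau=(1,\phi')/(1+(\phi')^2)^{1/2}$ is the unit tangent to $\partial\Omega$, $\partial_\tau=\tau\cdot\nabla$, $d\sigma$ is surface measure on $\partial\Omega$, $\delta(X)=\operatorname{dist}(X,\partial\Omega)$, and $B_r(X)$ is the ball of radius $r$ centred at $X$. For a fixed $a>0$ and $Q\in\partial\Omega$, $\Gamma(Q)=\{X\in\Omega:|X-Q|\le(1+a)\delta(X)\}$ and $$\widetilde N(w)(Q)=\sup_{X\in\Gamma(Q)}\Big(\frac{1}{|B_{\delta(X)/2}(X)|}\int_{B_{\delta(X)/2}(X)}|w|^2\Big)^{1/2}.$$ $\widetilde W^{1,2}(\Omega)$ is the space of $f$ with $\int_\Omega|f(X)|^2\frac{dX}{1+|X|^2}+\int_\Omega|\nabla f|^2\,dX<\infty$; $\operatorname{Tr}$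 is the trace on $\partial\Omega$; $\widetilde W^{1,2}_0(\Omega)=\{f\in\widetilde W^{1,2}(\Omega):\operatorname{Tr}(f)=0\}$. $\dot W^{1,2}(\Omega)$ is the homogeneous Sobolev space of $u$ with norm $\|\nabla u\|_{L^2(\Omega)}<\infty$. $H^1(\partial\Omega)$ is the set of $f\colon\partial\Omega\to\mathbf{R}$ such that $x\mapsto f(x,\phi(x))(1+\phi'(x)^2)^{1/2}$ belongs to the classical Hardy space $H^1(\mathbf{R})$. The solution of the Dirichlet problem with data $f_0\in W^{1,2}(\partial\Omega)\cap L^{7/6}(\partial\Omega)\cap L^{17/6}(\partial\Omega)$ is the unique $u\in\widetilde W^{1,2}(\Omega)$ with $\operatorname{Tr}(u)=f_0$ and $\int_\Omega A\nabla u\cdot\nabla\varphi=0$ for all $\varphi\in\widetilde W^{1,2}_0(\Omega)$. The solution of the Neumann problem with data $g_0\in H^1(\partial\Omega)$ is the unique $u\in\dot W^{1,2}(\Omega)$ with $\int_\Omega A\nabla u\cdot\nabla\varphi=\int_{\partial\Omega}g_0\operatorname{Tr}(\varphi)\,d\sigma$ for all $\varphi\in\dot W^{1,2}(\Omega)$. $(R)_p$ (the regularity problem for $p$) holds if $\|\widetilde N(\nabla u)\|_{L^p(\partial\Omega)}\le C(p)\|\partial_\tau f_0\|_{L^p(\partial\Omega)}$ for every Dirichlet solution $u$ with data $f_0\in W^{1,p}(\partial\Omega)\cap W^{1,2}(\partial\Omega)\cap L^{7/6}(\partial\Omega)\cap L^{17/6}(\partial\Omega)$. $(N)_p$ (the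 Neumann problem for $p$) holds if $\|\widetilde N(\nabla u)\|_{L^p(\partial\Omega)}\le C(p)\|g_0\|_{L^p(\partial\Omega)}$ for every Neumann solution $u$ with data $g_0\in L^p(\partial\Omega)\cap H^1(\partial\Omega)$. In each case the constant $C(p)>0$ must depend only on $\lambda$, $\Lambda$, $\Omega$ and $p$. *)

(* Defs.v *)
From HB Require Import structures.
From mathcomp Require Import all_boot all_order all_algebra.
From mathcomp Require Import all_classical all_reals all_analysis.

Set Implicit Arguments.
Unset Strict Implicit.
Unset Printing Implicit Defensive.

Import Order.TTheory GRing.Theory Num.Theory.
Import numFieldNormedType.Exports.

Local Open Scope classical_set_scope.
Local Open Scope ring_scope.

Section Defs.
Context {R : realType}.

Local Notation leb := (@lebesgue_measure R).
Local Notation leb2 := (@lebesgue_measure R \x @lebesgue_measure R)%E.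

(* The norm that the library puts on [R * R] is the sup norm, hence [enorm]. *)
Definition enorm (X : R * R) : R := Num.sqrt (X.1 ^+ 2 + X.2 ^+ 2).

Definition eball (X : R * R) (r : R) : set (R * R) :=
  [set Y | enorm (Y - X) < r].

Definition vec (v : R * R) : 'cV[R]_2 :=
  \col_i (if i == 0 then v.1 else v.2).

Definition bform (M : 'M[R]_2) (v w : R * R) : R :=
  ((vec v)^T *m M *m vec w) 0 0.

Definition above (phi : R -> R) : set (R * R) := [set X | phi X.1 < X.2].

(* For phi continuous this is the topological boundary of [above phi]. *)
Definition bd (phi : R -> R) : set (R * R) := [set X | X.2 = phi X.1].

Definition dist_bd (phi : R -> R) (X : R * R) : R :=
  inf [set enorm (X - Q) | Q in bd phi].

(* Functions on the boundary are functions on the plane of which only the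
   values on the graph matter; [pull phi f] is such a function in the graph
   coordinate x, in which surface measure is [arc phi x dx]. *)
Definition pull (T : Type) (phi : R -> R) (f : R * R -> T) (x : R) : T :=
  f (x, phi x).

Definition arc (phi : R -> R) (x : R) : R :=
  Num.sqrt (1 + (derive1 phi x) ^+ 2).

Definition bd_int (phi : R -> R) (w : R * R -> \bar R) : \bar R :=
  (\int[leb]_x (pull phi w x * (arc phi x)%:E))%E.

Definition bd_norm (phi : R -> R) (p : R) (w : R * R -> \bar R) : \bar R :=
  (bd_int phi (fun Q => `|w Q| `^ p) `^ p^-1)%E.

Definition bd_Lp (phi : R -> R) (p : R) (f : R * R -> R) : Prop :=
  measurable_fun setT (pull phi f) /\ (bd_norm phi p (EFin \o f) < +oo)%E.

Definition test1 (psi : R -> R) : Prop :=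
  (forall n x, derivable (derive1n n psi) x 1) /\
  exists K, compact K /\ forall x, ~ K x -> psi x = 0.

Definition dir (i : bool) : R * R := if i then (0, 1) else (1, 0).

Definition pd (i : bool) (f : R * R -> R) : R * R -> R := 'D_(dir i) f.

Definition grad (f : R * R -> R) (X : R * R) : R * R :=
  (pd false f X, pd true f X).

Definition smooth2 (f : R * R -> R) : Prop :=
  forall s : seq bool, continuous (foldr pd f s) /\
    forall i X, derivable (foldr pd f s) X (dir i).

Definition test2 (Om : set (R * R)) (psi : R * R -> R) : Prop :=
  smooth2 psi /\
  exists K, [/\ compact K, K `<=` Om & forall X, ~ K X -> psi X = 0].

Definition loc_int2 (Om : set (R * R)) (f : R * R -> R) : Prop :=
  forall K, compact K -> K `<=` Om -> leb2.-integrable K (EFin \o f).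

Definition weak_deriv (f g : R -> R) : Prop :=
  [/\ locally_integrable setT f, locally_integrable setT g &
    forall psi, test1 psi ->
      (\int[leb]_x (f x * derive1 psi x)%:E = - \int[leb]_x (g x * psi x)%:E)%E].

Definition weak_grad (Om : set (R * R)) (u : R * R -> R) (G : R * R -> R * R)
    : Prop :=
  [/\ loc_int2 Om u, loc_int2 Om (fun X => (G X).1),
      loc_int2 Om (fun X => (G X).2) &
    forall psi, test2 Om psi ->
      (\int[leb2]_(X in Om) (u X * pd false psi X)%:E =
         - \int[leb2]_(X in Om) ((G X).1 * psi X)%:E)%E /\
      (\int[leb2]_(X in Om) (u X * pd true psi X)%:E =
         - \int[leb2]_(X in Om) ((G X).2 * psi X)%:E)%E].

(* A Sobolev function u is accompanied by its weak gradient G, which is unique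
   up to a null set. *)
Definition Wdot (phi : R -> R) (u : R * R -> R) (G : R * R -> R * R) : Prop :=
  weak_grad (above phi) u G /\
  (\int[leb2]_(X in above phi) ((enorm (G X)) ^+ 2)%:E < +oo)%E.

Definition Wtilde (phi : R -> R) (u : R * R -> R) (G : R * R -> R * R)
    : Prop :=
  [/\ weak_grad (above phi) u G,
      (\int[leb2]_(X in above phi)
          ((u X) ^+ 2 / (1 + (enorm X) ^+ 2))%:E < +oo)%E &
      (\int[leb2]_(X in above phi) ((enorm (G X)) ^+ 2)%:E < +oo)%E].

(* The trace extends restriction to the boundary by continuity, from smooth
   functions with compact support in the plane to functions that are W^{1,2}
   near every bounded piece of the closed domain.  This covers the functions in
   [Wtilde] and in [Wdot]. *)
Definition trace (phi : R -> R) (u : R * R -> R) (G : R * R -> R * R)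
    (f : R * R -> R) : Prop :=
  measurable_fun setT (pull phi f) /\
  exists F : nat -> R * R -> R, (forall n, test2 setT (F n)) /\
    forall r : R, 0 < r ->
      ((fun n => \int[leb2]_(X in above phi `&` eball (0, 0)%R r)
          ((F n X - u X) ^+ 2 + (enorm (grad (F n) X - G X)) ^+ 2)%:E)%E
        @ \oo --> 0%E) /\
      ((fun n => bd_int phi
          (fun Q => ((F n Q - f Q) ^+ 2 * \1_(eball (0, 0)%R r) Q)%:E))
        @ \oo --> 0%E).

Definition Wtilde0 (phi : R -> R) (u : R * R -> R) (G : R * R -> R * R)
    : Prop :=
  Wtilde phi u G /\ trace phi u G (fun=> 0).

(* df is the weak tangential derivative of f: the chain rule gives
   (pull phi f)' = (1, phi') . grad f = arc phi * pull phi (tau . grad f). *)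
Definition tan_deriv (phi : R -> R) (f df : R * R -> R) : Prop :=
  weak_deriv (pull phi f) (fun x => pull phi df x * arc phi x).

Definition bd_W1 (phi : R -> R) (p : R) (f : R * R -> R) : Prop :=
  bd_Lp phi p f /\ exists df, tan_deriv phi f df /\ bd_Lp phi p df.

Definition atom (b : R -> R) : Prop :=
  measurable_fun setT b /\
  exists c d, [/\ c < d, (forall x, x \notin `[c, d] -> b x = 0),
    (forall x, `|b x| <= (d - c)^-1) & (\int[leb]_x (b x)%:E = 0)%E].

Definition H1 (f : R -> R) : Prop :=
  measurable_fun setT f /\
  exists (c : nat -> R) (b : nat -> R -> R),
    [/\ (forall j, atom (b j)), cvgn (series (fun j => `|c j|)) &
      (fun n => \int[leb]_x
          (`| f x - \sum_(0 <= j < n) c j * b j x |)%:E)%E @ \oo --> 0%E].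

Definition bd_H1 (phi : R -> R) (g : R * R -> R) : Prop :=
  H1 (fun x => pull phi g x * arc phi x).

Definition elliptic (Om : set (R * R)) (A : R * R -> 'M[R]_2) : Prop :=
  [/\ (forall i j, measurable_fun Om (fun X => A X i j)),
      (exists Lam : R, {ae leb2, forall X, Om X ->
         forall i j, `|A X i j| <= Lam}) &
      (exists2 lam : R, 0 < lam & {ae leb2, forall X, Om X ->
         forall xi, lam * (enorm xi) ^+ 2 <= bform (A X) xi xi})].

(* \int_Omega A grad u . grad v, for G = grad u and H = grad v *)
Definition energy (phi : R -> R) (A : R * R -> 'M[R]_2)
    (G H : R * R -> R * R) : \bar R :=
  (\int[leb2]_(X in above phi) (bform (A X) (H X) (G X))%:E)%E.

Definition dirichlet_solution (phi : R -> R) (A : R * R -> 'M[R]_2)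
    (f : R * R -> R) (u : R * R -> R) (G : R * R -> R * R) : Prop :=
  [/\ Wtilde phi u G, trace phi u G f &
    forall v H, Wtilde0 phi v H -> energy phi A G H = 0%E].

(* For g in H^1 and h in BMO (such as the trace of a function in [Wdot]) the
   product g h need not be integrable, and the integral of g h stands for the
   duality pairing of H^1 and BMO.  This is the limit of the integrals of g
   against the truncations of h, and it is the Lebesgue integral of g h
   whenever g h is integrable. *)
Definition truncate (n : nat) (t : R) : R :=
  Num.max (- n%:R) (Num.min n%:R t).

Definition bd_pairing (phi : R -> R) (g h : R * R -> R) (l : \bar R) : Prop :=
  (fun n => bd_int phi (fun Q => (g Q * truncate n (h Q))%:E)) @ \oo --> l.

Definition neumann_solution (phi : R -> R) (A : R * R -> 'M[R]_2)
    (g : R * R -> R) (u : R * R -> R) (G : R * R -> R * R) : Prop :=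
  Wdot phi u G /\
  forall v H h, Wdot phi v H -> trace phi v H h ->
    bd_pairing phi g h (energy phi A G H).

Definition cone (a : R) (phi : R -> R) (Q : R * R) : set (R * R) :=
  [set X | above phi X /\ enorm (X - Q) <= (1 + a) * dist_bd phi X].

Definition average2 (phi : R -> R) (w : R * R -> R * R) (X : R * R)
    : \bar R :=
  let B := eball X (dist_bd phi X / 2) in
  (((fine (leb2 B))^-1%:E * \int[leb2]_(Y in B) ((enorm (w Y)) ^+ 2)%:E)
    `^ 2^-1)%E.

(* The added 0 only makes the supremum over an empty cone 0, not -oo. *)
Definition Ntilde (a : R) (phi : R -> R) (w : R * R -> R * R) (Q : R * R)
    : \bar R :=
  ereal_sup (0%E |` [set average2 phi w X | X in cone a phi Q]).

(* A, phi and p are fixed, so the constant may depend on them, but not on the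
   data. *)
Definition regularity_p (a : R) (phi : R -> R) (A : R * R -> 'M[R]_2) (p : R)
    : Prop :=
  exists2 C : R, 0 < C &
    forall f df u G,
      bd_W1 phi p f -> bd_W1 phi 2 f ->
      bd_Lp phi (7 / 6) f -> bd_Lp phi (17 / 6) f ->
      tan_deriv phi f df ->
      dirichlet_solution phi A f u G ->
      (bd_norm phi p (Ntilde a phi G) <= C%:E * bd_norm phi p (EFin \o df))%E.

Definition neumann_p (a : R) (phi : R -> R) (A : R * R -> 'M[R]_2) (p : R)
    : Prop :=
  exists2 C : R, 0 < C &
    forall g u G,
      bd_Lp phi p g -> bd_H1 phi g ->
      neumann_solution phi A g u G ->
      (bd_norm phi p (Ntilde a phi G) <= C%:E * bd_norm phi p (EFin \o g))%E.

End Defs.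

(* Main.v *)
Require Import Defs.
From mathcomp Require Import all_boot all_order all_algebra.
From mathcomp Require Import all_classical all_reals all_analysis.
From mathcomp Require Import measurable_realfun ring lra.
Import Order.TTheory GRing.Theory Num.Theory.
Import numFieldNormedType.Exports.
Local Open Scope classical_set_scope.
Local Open Scope ring_scope.
Set Implicit Arguments.
Unset Strict Implicit.
Unset Printing Implicit Defensive.

(** The domain is the half plane t > 0. With alpha = 1 - 1/p and
    k = cot(alpha pi/2), and with s = 3 for x > 0 and s = 1 for x < 0, put
    A = s [[1, 2k], [-2k, 1]]. On either side of the axis x = 0 the solutions of
    div A grad u = 0 are harmonic; what is special to A is the transmission
    condition on the axis. Let C - i S be a holomorphic function of w = t - i x
    that is real on the axis, so that S vanishes there. For any constants a and q
    the function P = a C + b(x) S, where b = q/s - 2ka, is continuous, and A grad P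
    is the rotated gradient of Q = q C + c(x) S, where c = 2kq - (1 + 4k^2) a s,
    which is continuous as well. So P is a solution, and its energy against a test
    function v is the integral of Q_x v over the boundary (coefmx_potgrad,
    pot_energy).

    For a = 1, q = 3k one has b = - k sg x, and for a = k/(1 + 4k^2), q = 1 one has
    c = - k sg x. Hence the same function, data = C_x - k sg(x) S_x on t = 0, is the
    tangential derivative of the Dirichlet data P in the first case and the
    Neumann data in the second (pot_dirichlet, pot_neumann). If C - i S = w^alpha
    then this function vanishes off the origin, by the choice of k, while the
    gradient of P is of size |w|^(alpha - 1) and hence not in L^p near the origin.
    To have admissible solutions take C - i S = (w + e)^alpha (w + 1)^-9, where the
    shift by e gives smoothness up to the boundary and the other factor decay. The
    p-th power of the main part of the data is then at most a multiple of the
    Poisson kernel e/(x^2 + e^2), so that the norm of the data in L^p is bounded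
    uniformly in e (kappa_cancels, poisson_power, data_norm_bounded). The maximal
    function of grad P at (x, 0) is at least a multiple of x^(-1/p) for e <= x <= d,
    where d does not depend on e, and the p-th power of its norm grows like
    log(1/e) (prof1_ge, Ntilde_norm_unbounded). No constant can thus bound the
    maximal function by the data.

    It remains to see that these functions are the solutions of the two problems.
    Green's identity for the rotated gradient of Q holds for test functions, with a
    kink of Q allowed on the axis because S vanishes there (green_flux). It passes
    to functions of finite energy with a trace by approximation for fields of
    compact support (flux_identity_compact), and then the cutoff is removed
    (flux_identity). The last step needs the trace to be integrable against the
    decaying boundary flux: the weight (1 + x^2)^-2 is, up to a bounded interval,
    at most the boundary flux of a field that can be paired with gradients of
    finite energy, and Green's identity for that field and for the absolute value
    of v bounds the weighted integral of the trace (trace_integrable). The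
    Dirichlet solution has its boundary values as trace because smoothing the sign
    of x is harmless where S vanishes (approx_bound, pot_trace). The Neumann data
    belong to the Hardy space since they are odd: their restrictions to dyadic
    annuli have mean zero and are multiples of atoms (data_H1). *)

(** * Partial derivatives in the plane *)

Section PartialDerivatives.
Context {R : realType}.
Implicit Types (f g : R * R -> R) (X : R * R).

Lemma pd_quotient (i : bool) f x t :
  (fun h : R => h^-1 *: (f (h *: @dir R i + (x, t)) - f (x, t))) =
  (fun h : R => h^-1 *: (if i then f (x, h *: 1 + t) - f (x, t)
                         else f (h *: 1 + x, t) - f (x, t))).
Proof.
apply/funext => h; congr (_ *: _).
by case: i; congr (f _ - _); rewrite /dir /=; congr pair => /=;
  rewrite /GRing.scale /= ?mulr0 ?mulr1 ?add0r.
Qed.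

Lemma is_derive_pdx f x t d :
  is_derive (x, t) (dir false) f d <-> is_derive x 1 (fun y => f (y, t)) d.
Proof.
have E := pd_quotient false f x t; rewrite /= in E.
by split=> -[df <-]; split; move: df; rewrite /derivable /derive /= E.
Qed.

Lemma is_derive_pdt f x t d :
  is_derive (x, t) (dir true) f d <-> is_derive t 1 (fun s => f (x, s)) d.
Proof.
have E := pd_quotient true f x t; rewrite /= in E.
by split=> -[df <-]; split; move: df; rewrite /derivable /derive /= E.
Qed.

Lemma is_derive_pd (i : bool) f X d :
  is_derive X (dir i) f d <->
  is_derive (if i then X.2 else X.1) 1
    (fun y => f (if i then (X.1, y) else (y, X.2))) d.
Proof.
by case: X => x t; case: i => /=; [exact: is_derive_pdt|exact: is_derive_pdx].
Qed.

Lemma is_derive_pd_comp (i : bool) (g : R -> R) f X a b :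
  is_derive (f X) 1 g a -> is_derive X (dir i) f b ->
  is_derive X (dir i) (g \o f) (a * b).
Proof.
move=> hg /is_derive_pd hf; apply/is_derive_pd.
apply: (@is_derive1_comp _ g _ _ a b _ hf).
by move: hg; case: X {hf} => x t; case: i.
Qed.

Lemma is_derive_pdM (i : bool) f g X a b :
  is_derive X (dir i) f a -> is_derive X (dir i) g b ->
  is_derive X (dir i) (fun Y => f Y * g Y) (f X * b + g X * a).
Proof. by move=> hf hg; apply: is_deriveM. Qed.

End PartialDerivatives.

(** * The flat function *)

Section FlatFunction.
Context {R : realType}.

(** The function exp(-1/y), extended by 0, times powers of 1/y: the derivatives of
    any of these are combinations of others. *)
Definition flat (k : nat) (y : R) : R :=
  if 0 < y then y^-1 ^+ k * expR (- y^-1) else 0.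

Lemma exprn_le_fact_expR n (s : R) : 0 <= s -> s ^+ n <= n`!%:R * expR s.
Proof.
move=> s0; case: n => [|n]; first by rewrite expr0 fact0 mul1r -expR0 ler_expR.
rewrite mulrC -ler_pdivrMr ?ltr0n ?fact_gt0//.
by apply: le_trans (expR_ge1Dxn n s0); rewrite lerDr.
Qed.

Lemma flat_ge0 k y : 0 <= flat k y.
Proof.
rewrite /flat; case: ifP => // y0.
by rewrite mulr_ge0 ?expR_ge0// exprn_ge0// invr_ge0 ltW.
Qed.

Lemma flat_le k n y : flat k y <= (k + n)`!%:R * `|y| ^+ n.
Proof.
rewrite /flat; case: ifPn => y0; last by rewrite mulr_ge0 ?exprn_ge0.
have yi : 0 <= y^-1 by rewrite invr_ge0 ltW.
have := exprn_le_fact_expR (k + n) yi.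
rewrite (gtr0_norm y0) exprD => h.
rewrite expRN ler_pdivrMr ?expR_gt0// mulrAC.
by rewrite -ler_pdivrMr ?exprn_gt0// -exprVn.
Qed.

(** A quadratic bound at a zero forces the derivative to vanish there; this is
    how the flat function is differentiated at 0. *)
Lemma is_derive_quadratic (f : R -> R) c :
  f 0 = 0 -> (forall h, `|f h| <= c * h ^+ 2) -> is_derive (0 : R) 1 f 0.
Proof.
move=> f0 fc.
have H : h^-1 *: (f (h *: 1 + 0) - f 0) @[h --> (0 : R)^'] --> (0 : R).
  apply: norm_cvg0.
  apply: (@squeeze_cvgr _ _ _ _ (fun=> 0) (fun h => c * `|h|)).
  - near=> h; rewrite normr_ge0 /= f0 subr0 addr0 /GRing.scale /= mulr1 normrM.
    have h0 : 0 < `|h| by rewrite normr_gt0; near: h; exact: nbhs_dnbhs_neq.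
    rewrite normfV ler_pdivrMl//; apply: le_trans (fc h) _.
    by rewrite [leRHS]mulrCA -normrM -expr2 ger0_norm// sqr_ge0.
  - exact: cvg_cst.
  - have : c * `|h| @[h --> (0:R)] --> c * `|0 : R|.
      by apply: cvgM; [exact: cvg_cst|apply: cvg_norm; exact: cvg_id].
    by rewrite normr0 mulr0; apply: cvg_trans; apply: cvg_app; exact: cvg_within.
split; first by apply/cvg_ex; exists 0.
exact: cvg_lim H.
Unshelve. all: by end_near. Qed.

Lemma is_derive_flat k (y : R) :
  is_derive y 1 (flat k) (- k%:R * flat k.+1 y + flat k.+2 y).
Proof.
have [y0|y0|->] := ltrgt0P y.
- pose g (z : R) := z^-1 ^+ k * expR (- z^-1).
  apply: (@near_eq_is_derive _ _ _ g).
    by near=> z; rewrite /flat ifT//; near: z; exact: lt_nbhsr.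
  have yn : y != 0 by rewrite gt_eqF.
  have hV : is_derive y 1 (fun z : R => z^-1) (- y ^- 2).
    by apply: is_derive_eq (is_deriveV _ (is_derive_id _ _)) _ => //; 
       rewrite /GRing.scale /= mulr1.
  have hE : is_derive y 1 (fun z => expR (- z^-1)) (expR (- y^-1) * y ^- 2).
    have -> : (fun z : R => expR (- z^-1)) = expR \o (fun z => - z^-1) by [].
    apply: is_derive1_comp.
    by apply: is_derive_eq (is_deriveN hV) _; rewrite opprK.
  have hX : is_derive y 1 (fun z : R => z^-1 ^+ k)
      ((k%:R * y^-1 ^+ k.-1) *: - y ^- 2).
    have -> : (fun z : R => z^-1 ^+ k) = (GRing.inv : R -> R) ^+ k.
      by rewrite exprfctE.
    exact: is_deriveX.
  apply: is_derive_eq (is_deriveM hX hE) _.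
  rewrite /flat y0 /GRing.scale /= -exprVn.
  case: k {g hX} => [|k] /=; rewrite ?expr0 ?exprS; ring.
- apply: (@near_eq_is_derive _ _ _ (fun=> 0)).
    by near=> z; rewrite /flat ifF//; apply/negbTE; rewrite -leNgt ltW//;
       near: z; exact: lt_nbhsl.
  apply: is_derive_eq (is_derive_cst _ _ _) _.
  by rewrite /flat !ltNge ltW//= mulr0 addr0.
- have -> : - k%:R * flat k.+1 0 + flat k.+2 0 = 0 :> R.
    by rewrite /flat ltxx mulr0 addr0.
  apply: (@is_derive_quadratic _ (k + 2)`!%:R); first by rewrite /flat ltxx.
  move=> h; rewrite ger0_norm ?flat_ge0// (le_trans (flat_le k 2 h))//.
  by rewrite real_normK// num_real.
Unshelve. all: by end_near. Qed.

End FlatFunction.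

(** * A class of smooth functions *)

Section SmoothFunctions.
Context {R : realType}.

(** A class of explicit functions that is closed under both partial
    derivatives, so that its members are smooth. *)
Inductive tame : (R * R -> R) -> Prop :=
| tame_cst c : tame (fun=> c)
| tame_coord (i : bool) : tame (fun X => if i then X.2 else X.1)
| tameD f g : tame f -> tame g -> tame (fun X => f X + g X)
| tameM f g : tame f -> tame g -> tame (fun X => f X * g X)
| tame_expR f : tame f -> tame (fun X => expR (f X))
| tame_ln f : tame f -> (forall X, 0 < f X) -> tame (fun X => ln (f X))
| tameV f : tame f -> (forall X, f X != 0) -> tame (fun X => (f X)^-1)
| tame_cos f : tame f -> tame (fun X => cos (f X))
| tame_sin f : tame f -> tame (fun X => sin (f X))
| tame_atan f : tame f -> tame (fun X => atan (f X))
| tame_flat k f : tame f -> tame (fun X => flat k (f X)).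

Lemma tameN f : tame f -> tame (fun X => - f X).
Proof.
move=> tf; have := tameM (tame_cst (-1)) tf.
by under eq_fun do rewrite mulN1r.
Qed.

Lemma tameX f n : tame f -> tame (fun X => f X ^+ n).
Proof.
move=> tf; elim: n => [|n IH]; first by under eq_fun do rewrite expr0; exact: tame_cst.
by under eq_fun do rewrite exprS; exact: tameM.
Qed.

Lemma tame_pd f : tame f -> forall i, exists2 g, tame g &
  forall X, is_derive X (dir i) f (g X).
Proof.
elim => {f} [c|j|f g tf IHf tg IHg|f g tf IHf tg IHg|f tf IH|f tf IH fp|
  f tf IH fn|f tf IH|f tf IH|f tf IH|k f tf IH] i.
- exists (fun=> 0); first exact: tame_cst.
  by move=> X; exact: is_derive_cst.
- exists (fun=> (i == j)%:R); first exact: tame_cst.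
  move=> X; apply/is_derive_pd; case: i j => -[] /=;
    solve [exact: is_derive_id | exact: is_derive_cst].
- have [f' tf' hf] := IHf i; have [g' tg' hg] := IHg i.
  exists (fun X => f' X + g' X); first exact: tameD.
  by move=> X; exact: is_deriveD.
- have [f' tf' hf] := IHf i; have [g' tg' hg] := IHg i.
  exists (fun X => f X * g' X + g X * f' X).
    by apply: tameD; exact: tameM.
  by move=> X; exact: is_derive_pdM.
- have [f' tf' hf] := IH i; exists (fun X => expR (f X) * f' X).
    by apply: tameM => //; exact: tame_expR.
  by move=> X; apply: is_derive_pd_comp => //; exact: is_derive_expR.
- have [f' tf' hf] := IH i; exists (fun X => (f X)^-1 * f' X).
    by apply: tameM => //; apply: tameV => // X; rewrite gt_eqF.
  by move=> X; apply: is_derive_pd_comp => //; exact: is_derive1_ln.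
- have [f' tf' hf] := IH i; exists (fun X => - (f X ^+ 2)^-1 * f' X).
    apply: tameM => //; apply: tameN; apply: tameV; first exact: tameX.
    by move=> X; rewrite expf_neq0.
  move=> X; apply: (is_derive_pd_comp (g := fun y : R => y^-1)) => //.
  by apply: is_derive_eq (is_deriveV _ (is_derive_id _ _)) _ => //;
    rewrite /GRing.scale /= mulr1.
- have [f' tf' hf] := IH i; exists (fun X => - sin (f X) * f' X).
    by apply: tameM => //; apply: tameN; exact: tame_sin.
  by move=> X; apply: is_derive_pd_comp => //; exact: is_derive_cos.
- have [f' tf' hf] := IH i; exists (fun X => cos (f X) * f' X).
    by apply: tameM => //; exact: tame_cos.
  by move=> X; apply: is_derive_pd_comp => //; exact: is_derive_sin.
- have [f' tf' hf] := IH i; exists (fun X => (1 + f X ^+ 2)^-1 * f' X).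
    apply: tameM => //; apply: tameV.
      by apply: tameD; [exact: tame_cst|exact: tameX].
    by move=> X; rewrite gt_eqF// ltr_pwDl// sqr_ge0.
  by move=> X; apply: is_derive_pd_comp => //; exact: is_derive1_atan.
- have [f' tf' hf] := IH i.
  exists (fun X => (- k%:R * flat k.+1 (f X) + flat k.+2 (f X)) * f' X).
    apply: tameM => //; apply: tameD; last exact: tame_flat.
    by apply: tameM; [exact: tame_cst|exact: tame_flat].
  by move=> X; apply: is_derive_pd_comp => //; exact: is_derive_flat.
Qed.

Lemma is_derive1_continuous (f : R -> R) (x d : R) :
  is_derive x 1 f d -> {for x, continuous f}.
Proof. by move=> [df _]; apply/differentiable_continuous/derivable1_diffP. Qed.

Lemma continuous_comp_at (f : R * R -> R) (g : R -> R) X :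
  {for X, continuous f} -> {for f X, continuous g} ->
  {for X, continuous (fun Y => g (f Y))}.
Proof. exact: continuous_comp. Qed.

Lemma tame_continuous f : tame f -> continuous f.
Proof.
elim => {f} [c|j|f g tf IHf tg IHg|f g tf IHf tg IHg|f tf IH|f tf IH fp|
  f tf IH fn|f tf IH|f tf IH|f tf IH|k f tf IH] X.
- exact: cvg_cst.
- by case: j; [exact: cvg_snd|exact: cvg_fst].
- by apply: cvgD; [exact: IHf|exact: IHg].
- by apply: cvgM; [exact: IHf|exact: IHg].
- exact: continuous_comp_at (IH X) (is_derive1_continuous (is_derive_expR _)).
- exact: continuous_comp_at (IH X) (is_derive1_continuous (is_derive1_ln _)).
- by apply: cvgV => //; exact: IH.
- exact: continuous_comp_at (IH X) (is_derive1_continuous (is_derive_cos _)).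
- exact: continuous_comp_at (IH X) (is_derive1_continuous (is_derive_sin _)).
- exact: continuous_comp_at (IH X) (is_derive1_continuous (is_derive1_atan _)).
- exact: continuous_comp_at (IH X) (is_derive1_continuous (is_derive_flat _ _)).
Qed.

Lemma tame_smooth2 f : tame f -> smooth2 f.
Proof.
move=> tf s; have ts : tame (foldr pd f s).
  elim: s => [//|i s IH] /=; have [g tg hg] := tame_pd IH i.
  suff -> : pd i (foldr pd f s) = g by [].
  by apply/funext => X; rewrite /pd derive_val.
split; first exact: tame_continuous.
by move=> i X; have [g _ hg] := tame_pd ts i; exact: ex_derive.
Qed.

End SmoothFunctions.

(** * Borel sets of the plane *)

Section PlaneMeasurability.
Context {R : realType}.

Lemma plane_open_measurable (U : set (R * R)) : open U -> measurable U.
Proof.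
move=> oU.
pose B (q : rat * rat) (r : rat) : set (R * R) :=
  ball (ratr q.1 : R) (ratr r : R) `*` ball (ratr q.2 : R) (ratr r : R).
pose F q1 q2 r := if pselect (B (q1, q2) r `<=` U) then B (q1, q2) r else set0.
have -> : U = \bigcup_q1 \bigcup_q2 \bigcup_r F q1 q2 r.
  apply/seteqP; split => [X UX|X [q1 _ [q2 _ [r _]]]]; last first.
    by rewrite /F; case: pselect => // h /h.
  have [e /= e0 eU] : nbhs_ball X U by apply/nbhs_ballP; exact: open_nbhs_nbhs.
  have [r] := @rat_in_itvoo R 0 (e / 2) ltac:(lra).
  rewrite in_itv /= => /andP[r0 re].
  have [q1] := @rat_in_itvoo R (X.1 - ratr r) (X.1 + ratr r) ltac:(lra).
  rewrite in_itv /= => /andP[q1l q1r].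
  have [q2] := @rat_in_itvoo R (X.2 - ratr r) (X.2 + ratr r) ltac:(lra).
  rewrite in_itv /= => /andP[q2l q2r].
  exists q1 => //; exists q2 => //; exists r => //; rewrite /F.
  case: pselect => /= [?|]; first by split; rewrite /ball /= ltr_norml; lra.
  case=> Y [/= Y1 Y2]; apply: eU; move: Y1 Y2.
  by rewrite /ball /= !ltr_norml => /andP[? ?] /andP[? ?]; split; 
     rewrite /ball /= ltr_norml; lra.
apply: bigcupT_measurable_rat => q1; apply: bigcupT_measurable_rat => q2.
apply: bigcupT_measurable_rat => r; rewrite /F; case: pselect => /= ? //.
by apply: measurableX; exact: measurable_ball.
Qed.

Lemma plane_continuous_measurable (f : R * R -> R) :
  continuous f -> measurable_fun setT f.
Proof.
move=> /continuousP cf; apply: (measurability _ (RGenOpens.measurableE R)).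
move=> _ [_ [a [b ->] <-]]; rewrite setTI; apply: plane_open_measurable.
exact/cf/interval_open.
Qed.

End PlaneMeasurability.

(** * Holomorphic functions as pairs of real functions *)

Section HolomorphicPairs.
Context {R : realType}.
Implicit Types (a b x y t : R) (u v : R * R).

Definition cmul (u v : R * R) : R * R :=
  (u.1 * v.1 - u.2 * v.2, u.1 * v.2 + u.2 * v.1).
Definition cadd (u v : R * R) : R * R := (u.1 + v.1, u.2 + v.2).
Definition cscale (c : R) (u : R * R) : R * R := (c * u.1, c * u.2).

(** The Cauchy-Riemann equations: the pair U = (C, S) stands for C - i S as a
    function of t - i x, and U' for its complex derivative. *)
Definition holo (U U' : R -> R -> R * R) : Prop := forall x t : R, 0 <= t ->
  [/\ is_derive x 1 (fun y => (U y t).1) (- (U' x t).2),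
      is_derive x 1 (fun y => (U y t).2) (U' x t).1,
      is_derive t 1 (fun s => (U x s).1) (U' x t).1 &
      is_derive t 1 (fun s => (U x s).2) (U' x t).2].

(** The power a of the modulus of t - i x. *)
Definition cabs (a x t : R) : R := expR (a / 2 * ln (x ^+ 2 + t ^+ 2)).
Definition carg (x t : R) : R := atan (x / t).
Definition cpow (a x t : R) : R * R :=
  (cabs a x t * cos (a * carg x t), cabs a x t * sin (a * carg x t)).

Lemma sqD_gt0 (x t : R) : 0 < t -> 0 < x ^+ 2 + t ^+ 2.
Proof. by move=> t0; rewrite ltr_wpDl ?sqr_ge0 ?exprn_gt0. Qed.

Lemma cabs_gt0 a x t : 0 < cabs a x t.
Proof. exact: expR_gt0. Qed.

Lemma cabsD a b x t : cabs (a + b) x t = cabs a x t * cabs b x t.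
Proof. by rewrite /cabs -expRD -mulrDl -mulrDl. Qed.

Lemma cabs0 x t : cabs 0 x t = 1.
Proof. by rewrite /cabs !mul0r expR0. Qed.

Lemma cabs2 x t : 0 < t -> cabs 2 x t = x ^+ 2 + t ^+ 2.
Proof.
move=> t0; rewrite /cabs divff ?mul1r ?lnK ?pnatr_eq0//.
by rewrite posrE ltr_wpDl ?sqr_ge0 ?exprn_gt0.
Qed.

Lemma cabsN a x t : cabs (- a) x t = (cabs a x t)^-1.
Proof. by rewrite /cabs !mulNr expRN. Qed.

Lemma cabs1 x t : 0 < t -> cabs 1 x t = Num.sqrt (x ^+ 2 + t ^+ 2).
Proof.
move=> t0; rewrite -(@cabs2 x t) // (_ : 2 = 1 + 1 :> R)// cabsD -expr2.
by rewrite sqrtr_sqr gtr0_norm ?cabs_gt0.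
Qed.

Lemma cos_carg x t : 0 < t -> cos (carg x t) = t / cabs 1 x t.
Proof.
move=> t0; rewrite /carg cos_atan cabs1//.
have -> : 1 + (x / t) ^+ 2 = (x ^+ 2 + t ^+ 2) / t ^+ 2 by field; rewrite gt_eqF.
rewrite sqrtrM ?sqrtrV ?sqrtr_sqr ?gtr0_norm ?invfM ?invrK 1?mulrC//.
- exact: exprn_ge0 (ltW _).
- by rewrite addr_ge0 ?sqr_ge0.
Qed.

Lemma sin_carg x t : 0 < t -> sin (carg x t) = x / cabs 1 x t.
Proof.
move=> t0; have c0 : cos (carg x t) != 0.
  by rewrite cos_carg// mulf_neq0 ?gt_eqF ?invr_gt0 ?cabs_gt0.
have := atanK (x / t); rewrite -/(carg x t) /tan => /(canRL (mulfVK c0)) ->.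
by rewrite cos_carg//; field; rewrite ?gt_eqF ?cabs_gt0.
Qed.

Lemma cpow_sub1 a x t : 0 < t ->
  cpow (a - 1) x t = (cabs a x t / (x ^+ 2 + t ^+ 2) *
                        (t * cos (a * carg x t) + x * sin (a * carg x t)),
                      cabs a x t / (x ^+ 2 + t ^+ 2) *
                        (t * sin (a * carg x t) - x * cos (a * carg x t))).
Proof.
move=> t0; rewrite /cpow mulrBl mul1r cosB sinB cos_carg// sin_carg//.
rewrite -(@cabs2 x t) // (_ : 2 = 1 + 1 :> R)// !cabsD cabsN.
by congr pair; field; rewrite gt_eqF ?cabs_gt0.
Qed.

Lemma is_derive_carg_x x t : 0 < t ->
  is_derive x 1 (carg^~ t) (t / (x ^+ 2 + t ^+ 2)).
Proof.
move=> t0.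
have h : is_derive x 1 (fun y => y / t) t^-1.
  have -> : (fun y : R => y / t) = t^-1 \*: id by apply/funext => y; rewrite /GRing.scale/= mulrC.
  by apply: is_derive_eq (is_deriveZ _ _) _; rewrite /GRing.scale/= mulr1.
apply: is_derive_eq (is_derive1_comp (is_derive1_atan _) h) _.
by field; rewrite !gt_eqF ?sqD_gt0.
Qed.

Lemma is_derive_carg_t x t : 0 < t ->
  is_derive t 1 (carg x) (- x / (x ^+ 2 + t ^+ 2)).
Proof.
move=> t0; have tn : t != 0 by rewrite gt_eqF.
have h : is_derive t 1 (fun s => x / s) (- x / t ^+ 2).
  have -> : (fun s => x / s) = x \*: (fun s : R => s^-1) by [].
  apply: is_derive_eq (is_deriveZ _ (is_deriveV tn (is_derive_id _ _))) _.
  by rewrite /GRing.scale/= mulr1 mulrN mulNr.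
apply: is_derive_eq (is_derive1_comp (is_derive1_atan _) h) _.
by field; rewrite !gt_eqF ?sqD_gt0.
Qed.

Lemma is_derive_sqD (y b : R) : is_derive y 1 (fun z => z ^+ 2 + b) (2 * y).
Proof.
have h : is_derive y 1 (fun z : R => z ^+ 2) (2 * y).
  have -> : (fun z : R => z ^+ 2) = (@id R) ^+ 2 by rewrite exprfctE.
  apply: is_derive_eq (is_deriveX 2 (is_derive_id _ _)) _.
  by rewrite /GRing.scale /= expr1 mulr1.
apply: is_derive_eq (is_deriveD h (is_derive_cst _ _ _)) _.
by rewrite addr0.
Qed.

Lemma cabsC a x t : cabs a x t = cabs a t x.
Proof. by rewrite /cabs addrC. Qed.

Lemma is_derive_cabs_x a x t : 0 < x ^+ 2 + t ^+ 2 ->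
  is_derive x 1 (fun y => cabs a y t) (a * x / (x ^+ 2 + t ^+ 2) * cabs a x t).
Proof.
move=> p.
have h := @is_derive1_comp _ (@ln R) (fun z => z ^+ 2 + t ^+ 2) x _ _
  (is_derive1_ln p) (is_derive_sqD x (t ^+ 2)).
have h2 := is_deriveZ (a / 2) h.
apply: is_derive_eq (is_derive1_comp (is_derive_expR _) h2) _.
by rewrite /GRing.scale /= /cabs; field; rewrite gt_eqF.
Qed.

Lemma is_derive_cabs_t a x t : 0 < x ^+ 2 + t ^+ 2 ->
  is_derive t 1 (cabs a x) (a * t / (x ^+ 2 + t ^+ 2) * cabs a x t).
Proof.
rewrite addrC cabsC => /(is_derive_cabs_x a).
by under eq_fun do rewrite cabsC.
Qed.

Lemma is_derive_mul_cos (r th : R -> R) a x (dr dth : R) :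
  is_derive x 1 r dr -> is_derive x 1 th dth ->
  is_derive x 1 (fun y => r y * cos (a * th y))
    (dr * cos (a * th x) - r x * sin (a * th x) * (a * dth)).
Proof.
move=> hr hth; have h := is_derive1_comp (is_derive_cos _) (is_deriveZ a hth).
apply: is_derive_eq (is_deriveM hr h) _.
by rewrite /GRing.scale /=; ring.
Qed.

Lemma is_derive_mul_sin (r th : R -> R) a x (dr dth : R) :
  is_derive x 1 r dr -> is_derive x 1 th dth ->
  is_derive x 1 (fun y => r y * sin (a * th y))
    (dr * sin (a * th x) + r x * cos (a * th x) * (a * dth)).
Proof.
move=> hr hth; have h := is_derive1_comp (is_derive_sin _) (is_deriveZ a hth).
apply: is_derive_eq (is_deriveM hr h) _.
by rewrite /GRing.scale /=; ring.
Qed.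

Lemma is_derive_translate (f : R -> R) s t (d : R) :
  is_derive (t + s) 1 f d -> is_derive t 1 (fun y => f (y + s)) d.
Proof.
move=> h; have h' := is_deriveD (is_derive_id t 1) (is_derive_cst s t 1).
by apply: is_derive_eq (@is_derive1_comp _ f (fun y => y + s) t _ _ h h') _;
  rewrite addr0 mulr1.
Qed.

(** The pair of functions stands for the power (t + s - i x)^a, and its
    derivative in the complex variable t - i x. *)
Lemma holo_cpow a s : 0 < s ->
  holo (fun x t => cpow a x (t + s))
       (fun x t => cscale a (cpow (a - 1) x (t + s))).
Proof.
move=> s0 x t t0; have ts : 0 < t + s by rewrite ltr_wpDl.
have p := sqD_gt0 x ts; have pn : x ^+ 2 + (t + s) ^+ 2 != 0 by rewrite gt_eqF.
rewrite (cpow_sub1 a x ts) /cscale /=.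
have hx := is_derive_cabs_x a p; have ht := is_derive_cabs_t a p.
have kx := is_derive_carg_x x ts; have kt := is_derive_carg_t x ts.
split; [| |
  apply: (@is_derive_translate (fun y => cabs a x y * cos (a * carg x y)))|
  apply: (@is_derive_translate (fun y => cabs a x y * sin (a * carg x y)))].
- by apply: is_derive_eq (is_derive_mul_cos a hx kx) _; field.
- by apply: is_derive_eq (is_derive_mul_sin a hx kx) _; field.
- by apply: is_derive_eq (is_derive_mul_cos a ht kt) _; field.
- by apply: is_derive_eq (is_derive_mul_sin a ht kt) _; field.
Qed.

Lemma holoM U U' V V' : holo U U' -> holo V V' ->
  holo (fun x t => cmul (U x t) (V x t))
    (fun x t => cadd (cmul (U' x t) (V x t)) (cmul (U x t) (V' x t))).
Proof.
move=> hU hV x t t0; have [u1 u2 u3 u4] := hU x t t0.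
have [v1 v2 v3 v4] := hV x t t0.
rewrite /cmul /cadd /=; split.
- apply: is_derive_eq (is_deriveB (is_deriveM u1 v1) (is_deriveM u2 v2)) _.
  by rewrite /GRing.scale /=; ring.
- apply: is_derive_eq (is_deriveD (is_deriveM u1 v2) (is_deriveM u2 v1)) _.
  by rewrite /GRing.scale /=; ring.
- apply: is_derive_eq (is_deriveB (is_deriveM u3 v3) (is_deriveM u4 v4)) _.
  by rewrite /GRing.scale /=; ring.
- apply: is_derive_eq (is_deriveD (is_deriveM u3 v4) (is_deriveM u4 v3)) _.
  by rewrite /GRing.scale /=; ring.
Qed.

Lemma holoD U U' V V' : holo U U' -> holo V V' ->
  holo (fun x t => cadd (U x t) (V x t)) (fun x t => cadd (U' x t) (V' x t)).
Proof.
move=> hU hV x t t0; have [u1 u2 u3 u4] := hU x t t0.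
have [v1 v2 v3 v4] := hV x t t0.
rewrite /cadd /=; split; try exact: is_deriveD.
by apply: is_derive_eq (is_deriveD u1 v1) _; rewrite opprD.
Qed.

Lemma holoZ c U U' : holo U U' ->
  holo (fun x t => cscale c (U x t)) (fun x t => cscale c (U' x t)).
Proof.
move=> hU x t t0; have [u1 u2 u3 u4] := hU x t t0.
rewrite /cscale /=; split; try exact: (is_deriveZ c).
by apply: is_derive_eq (is_deriveZ c u1) _; rewrite /GRing.scale /= mulrN.
Qed.

End HolomorphicPairs.

(** * Decay and reflection symmetry *)

Section Decay.
Context {R : realType}.
Implicit Types (a b x y t : R) (u v : R * R) (U V : R -> R -> R * R).

Definition decay x t : R := ((1 + x ^+ 2) * (1 + t ^+ 2))^-1.

Definition csq u : R := u.1 ^+ 2 + u.2 ^+ 2.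

Lemma csq_cmul u v : csq (cmul u v) = csq u * csq v.
Proof. by rewrite /csq /cmul /=; ring. Qed.

Lemma csq_cpow a x t : csq (cpow a x t) = cabs a x t ^+ 2.
Proof. by rewrite /csq /cpow /= !exprMn -mulrDr cos2Dsin2 mulr1. Qed.

Lemma csq_le u c : 0 <= c -> csq u <= c ^+ 2 -> `|u.1| <= c /\ `|u.2| <= c.
Proof.
move=> c0 h; have sq (z : R) : z ^+ 2 <= c ^+ 2 -> `|z| <= c.
  by move=> /ler_wsqrtr; rewrite !sqrtr_sqr (ger0_norm c0).
by split; apply: sq; apply: le_trans h; rewrite /csq ?lerDl ?lerDr sqr_ge0.
Qed.

Lemma decay_gt0 x t : 0 < decay x t.
Proof. by rewrite invr_gt0 mulr_gt0// ltr_pwDl ?sqr_ge0. Qed.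

Lemma cabs_mono a x t y s : 0 <= a -> 0 < t -> x ^+ 2 + t ^+ 2 <= y ^+ 2 + s ^+ 2 ->
  cabs a x t <= cabs a y s.
Proof.
move=> a0 t0 h; rewrite ler_expR ler_wpM2l ?divr_ge0//.
have p := sqD_gt0 x t0.
by rewrite ler_ln ?posrE// (lt_le_trans p).
Qed.

Lemma cabs_antimono a x t y s : a <= 0 -> 0 < t ->
  x ^+ 2 + t ^+ 2 <= y ^+ 2 + s ^+ 2 -> cabs a y s <= cabs a x t.
Proof.
move=> a0 t0 h; rewrite -[a]opprK cabsN [leRHS]cabsN lef_pV2 ?posrE ?cabs_gt0//.
by apply: cabs_mono => //; rewrite oppr_ge0.
Qed.

Lemma cabs_exp_mono a b x t : a <= b -> 1 <= t -> cabs a x t <= cabs b x t.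
Proof.
move=> ab t1; rewrite ler_expR ler_wpM2r ?ler_wpM2r// ln_ge0//.
by rewrite ler_wpDl ?sqr_ge0// expr_ge1// (le_trans _ t1).
Qed.

(** The square of the decay has degree - 8 in (x, t) jointly. *)
Lemma cabs_decay x t : 0 <= t -> cabs (- 8) x (t + 1) <= decay x t ^+ 2.
Proof.
move=> t0; have t1 : 0 < t + 1 by lra.
rewrite cabsN (_ : 8 = 2 + 2 + (2 + 2))//; last by ring.
rewrite (cabsD (2 + 2)) (cabsD 2) (@cabs2 _ x _ t1) exprVn lef_pV2 ?posrE; last 2 first.
- by rewrite !mulr_gt0 ?sqD_gt0.
- by rewrite exprn_gt0// mulr_gt0// ltr_pwDl ?sqr_ge0.
rewrite -expr2 ler_sqr ?nnegrE; last 2 first.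
- by rewrite mulr_ge0// addr_ge0 ?sqr_ge0.
- by rewrite mulr_ge0// addr_ge0 ?sqr_ge0.
by apply: ler_pM; rewrite ?addr_ge0 ?sqr_ge0//; nra.
Qed.

(** The square of the decay leaves one factor to be paired with a function of
    finite energy and one to make the result integrable. *)
Definition decays U := exists K, forall x t, 0 <= t ->
  `|(U x t).1| <= K * decay x t ^+ 2 /\ `|(U x t).2| <= K * decay x t ^+ 2.

Lemma decaysD U V : decays U -> decays V ->
  decays (fun x t => cadd (U x t) (V x t)).
Proof.
move=> [K hK] [L hL]; exists (K + L) => x t t0; have [? ?] := hK x t t0.
have [? ?] := hL x t t0.
by rewrite mulrDl; split; apply: le_trans (ler_normD _ _) _; exact: lerD.
Qed.

Lemma decaysZ c U : decays U -> decays (fun x t => cscale c (U x t)).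
Proof.
move=> [K hK]; exists (`|c| * K) => x t t0; have [? ?] := hK x t t0.
by rewrite -mulrA /cscale /= !normrM; split; exact: ler_wpM2l.
Qed.

(** The second component is odd in x and hence vanishes on the axis x = 0, which
    is what allows a kink there. *)
Definition reflects U := forall x t,
  (U (- x) t).1 = (U x t).1 /\ (U (- x) t).2 = - (U x t).2.

Lemma reflects_cpow a s : reflects (fun x t => cpow a x (t + s)).
Proof.
move=> x t; rewrite /cpow /= /cabs sqrrN /carg mulNr atanN mulrN cosN sinN.
by rewrite mulrN.
Qed.

Lemma reflectsM U V : reflects U -> reflects V ->
  reflects (fun x t => cmul (U x t) (V x t)).
Proof.
move=> hU hV x t; rewrite /cmul /=.
by have [-> ->] := hU x t; have [-> ->] := hV x t; split; ring.
Qed.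

Lemma reflectsD U V : reflects U -> reflects V ->
  reflects (fun x t => cadd (U x t) (V x t)).
Proof.
move=> hU hV x t; rewrite /cadd /=.
by have [-> ->] := hU x t; have [-> ->] := hV x t; split; ring.
Qed.

Lemma reflectsZ c U : reflects U -> reflects (fun x t => cscale c (U x t)).
Proof.
by move=> hU x t; rewrite /cscale /=; have [-> ->] := hU x t; split; ring.
Qed.

Definition plane_measurable U :=
  measurable_fun setT (fun X : R * R => (U X.1 X.2).1) /\
  measurable_fun setT (fun X : R * R => (U X.1 X.2).2).

Lemma measurable_invr : measurable_fun setT (fun x : R => x^-1).
Proof.
have -> : (fun x : R => x^-1) = (fun x => x * (x ^+ 2) `^ (-1)).
  apply/funext => x; rewrite powR_inv1 ?sqr_ge0//.
  by have [->|x0] := eqVneq x 0; [rewrite invr0 mul0r|field].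
apply: measurable_funM => //.
by apply: measurableT_comp (measurable_powR _) _; exact: measurable_funX.
Qed.

Lemma measurable_atan : measurable_fun setT (@atan R).
Proof. by apply: continuous_measurable_fun => x; exact: continuous_atan. Qed.

Lemma measurable_cos : measurable_fun setT (@cos R).
Proof. by apply: continuous_measurable_fun => x; exact: continuous_cos. Qed.

Lemma measurable_sin : measurable_fun setT (@sin R).
Proof. by apply: continuous_measurable_fun => x; exact: continuous_sin. Qed.

Lemma plane_measurable_comp (g : R -> R) (f : R * R -> R) :
  measurable_fun setT g -> measurable_fun setT f ->
  measurable_fun setT (fun X => g (f X)).
Proof. by move=> mg mf; exact: (measurableT_comp mg mf). Qed.

Lemma plane_measurable_cpow a s : plane_measurable (fun x t => cpow a x (t + s)).
Proof.
have m1 : measurable_fun setT (fun X : R * R => X.2 + s).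
  by apply: measurable_funD => //; exact: measurable_snd.
have mabs : measurable_fun setT (fun X : R * R => cabs a X.1 (X.2 + s)).
  apply: (plane_measurable_comp (@measurable_expR R)); apply: measurable_funM => //.
  apply: (plane_measurable_comp (@measurable_ln R)); apply: measurable_funD;
    by apply: measurable_funX; [exact: measurable_fst|] || apply: measurable_funX.
have marg : measurable_fun setT (fun X : R * R => a * carg X.1 (X.2 + s)).
  apply: measurable_funM => //; apply: (plane_measurable_comp measurable_atan).
  apply: measurable_funM; first exact: measurable_fst.
  exact: (plane_measurable_comp measurable_invr).
split; apply: measurable_funM => //.
- exact: (plane_measurable_comp measurable_cos).
- exact: (plane_measurable_comp measurable_sin).
Qed.

Lemma plane_measurableM U V : plane_measurable U -> plane_measurable V ->
  plane_measurable (fun x t => cmul (U x t) (V x t)).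
Proof.
move=> [u1 u2] [v1 v2]; split; rewrite /cmul /=.
- by apply: measurable_funB; exact: measurable_funM.
- by apply: measurable_funD; exact: measurable_funM.
Qed.

Lemma plane_measurableD U V : plane_measurable U -> plane_measurable V ->
  plane_measurable (fun x t => cadd (U x t) (V x t)).
Proof. by move=> [u1 u2] [v1 v2]; split; exact: measurable_funD. Qed.

Lemma plane_measurableZ c U : plane_measurable U ->
  plane_measurable (fun x t => cscale c (U x t)).
Proof. by move=> [u1 u2]; split; exact: measurable_funM. Qed.

End Decay.

(** * The mollified power *)

Section Profiles.
Context {R : realType}.
Implicit Types (x y t : R) (H : R -> R -> R * R).

(** A holomorphic function with its first two derivatives, as far as the
    construction of solutions needs them. *)
Record profile H0 H1 H2 : Prop := Profile {
  profile_holo01 : holo H0 H1;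
  profile_holo12 : holo H1 H2;
  profile_holo23 : exists H3, holo H2 H3;
  profile_decays0 : decays H0;
  profile_decays1 : decays H1;
  profile_decays2 : decays H2;
  profile_reflects0 : reflects H0;
  profile_reflects1 : reflects H1;
  profile_measurable0 : plane_measurable H0;
  profile_measurable1 : plane_measurable H1;
  profile_measurable2 : plane_measurable H2 }.

Section Family.
Variables (al e : R).
Hypotheses (al0 : 0 < al) (al1 : al < 1) (e0 : 0 < e) (e1 : e <= 1).

(** With j = k = 0 this is the mollified power (w + e)^al (w + 1)^-9 at
    w = t - i x; derivatives are combinations of these terms. *)
Definition term (j k x t : R) : R * R :=
  cmul (cpow (al - j) x (t + e)) (cpow (- 9 - k) x (t + 1)).

Definition term' (j k x t : R) : R * R :=
  cadd (cscale (al - j) (term (j + 1) k x t))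
       (cscale (- 9 - k) (term j (k + 1) x t)).

Lemma holo_term (j k : R) : holo (term j k) (term' j k).
Proof.
have := holoM (holo_cpow (al - j) e0) (holo_cpow (- 9 - k) ltr01).
congr holo; apply/funext => x; apply/funext => t.
rewrite /term' /term /cadd /cscale /cmul /= !opprD !addrA.
by congr pair; ring.
Qed.

Lemma decays_term (j k : R) : (j = 0 \/ 1 <= j) -> 0 <= k -> decays (term j k).
Proof.
move=> hj k0; have [a0 a1 e0' e1'] := And4 al0 al1 e0 e1.
suff [K K0 hK] : exists2 K, 0 <= K & forall x t, 0 <= t ->
    cabs (al - j) x (t + e) <= K * cabs 1 x (t + 1).
  exists K => x t t0; apply: csq_le; first by rewrite mulr_ge0// exprn_ge0// ltW// decay_gt0.
  rewrite /term csq_cmul !csq_cpow -exprMn ler_pXn2r ?nnegrE//; last 2 first.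
  - by rewrite mulr_ge0// ltW// cabs_gt0.
  - by rewrite mulr_ge0// exprn_ge0// ltW// decay_gt0.
  apply: le_trans (ler_wpM2r (ltW (cabs_gt0 _ _ _)) (hK x t t0)) _.
  rewrite -mulrA ler_wpM2l// -cabsD; apply: le_trans (cabs_decay x t0).
  by apply: cabs_exp_mono; lra.
have le1 x t : 0 <= t -> 1 <= cabs 1 x (t + 1).
  by move=> t0; have := @cabs_exp_mono R 0 1 x (t + 1); rewrite cabs0; apply; lra.
case: hj => [->|j1].
  exists 1 => // x t t0; rewrite mul1r subr0.
  apply: le_trans (cabs_exp_mono x (ltW al1) _); last by lra.
  apply: cabs_mono; [exact: ltW|exact: ltr_wpDl|].
  by rewrite lerD2l ler_sqr ?nnegrE; lra.
exists (cabs (al - j) 0 e) => [|x t t0]; first exact/ltW/cabs_gt0.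
apply: (@le_trans _ _ (cabs (al - j) 0 e)).
  by apply: cabs_antimono => //; [lra|rewrite expr0n /= add0r; nra].
by rewrite ler_peMr ?le1// ltW// cabs_gt0.
Qed.

Lemma reflects_term (j k : R) : reflects (term j k).
Proof. by apply: reflectsM; exact: reflects_cpow. Qed.

Lemma plane_measurable_term (j k : R) : plane_measurable (term j k).
Proof. by apply: plane_measurableM; exact: plane_measurable_cpow. Qed.

Definition prof0 := term 0 0.

Definition prof1 x t : R * R :=
  cadd (cscale al (term 1 0 x t)) (cscale (- 9) (term 0 1 x t)).

Definition prof2 x t : R * R :=
  cadd (cscale al (term' 1 0 x t)) (cscale (- 9) (term' 0 1 x t)).

Lemma prof_is_profile : profile prof0 prof1 prof2.
Proof.
have d10 : decays (term 1 0) by apply: decays_term; [right|].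
have d01 : decays (term 0 1) by apply: decays_term; [left|].
have d' j k : (j = 0 \/ 1 <= j) -> 0 <= k -> decays (term' j k).
  move=> hj k0; apply: decaysD; apply: decaysZ; apply: decays_term => //.
  - by right; case: hj => [->|]; lra.
  - by lra.
split.
- suff -> : prof1 = term' 0 0 by exact: holo_term.
  by apply/funext => x; apply/funext => t; rewrite /prof1 /term' !subr0 !add0r.
- by apply: holoD; apply: holoZ; exact: holo_term.
- eexists; apply: holoD; apply: holoZ;
    by apply: holoD; apply: holoZ; exact: holo_term.
- by apply: decays_term; [left|].
- by apply: decaysD; exact: decaysZ.
- by apply: decaysD; apply: decaysZ; apply: d'; [right| |left|].
- exact: reflects_term.
- by apply: reflectsD; apply: reflectsZ; exact: reflects_term.
- exact: plane_measurable_term.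
- by apply: plane_measurableD; apply: plane_measurableZ; exact: plane_measurable_term.
- apply: plane_measurableD; apply: plane_measurableZ; apply: plane_measurableD;
    by apply: plane_measurableZ; exact: plane_measurable_term.
Qed.

End Family.
End Profiles.

(** * Integrals of derivatives on the line *)

Section LineIntegrals.
Context {R : realType}.
Notation mu := (@lebesgue_measure R).
Implicit Types (W w f : R -> R) (M x t : R).
Local Open Scope ereal_scope.

Lemma integral_derive W w (a b : R) : (a < b)%R ->
  (forall x, (a <= x <= b)%R -> is_derive x 1%R W (w x)) ->
  (forall x, (a <= x <= b)%R -> {for x, continuous w}) ->
  \int[mu]_(x in `[a, b]) (w x)%:E = (W b - W a)%:E.
Proof.
move=> ab dW cw.
have cW x : (a <= x <= b)%R -> {for x, continuous W}.
  by move=> /dW; exact: is_derive1_continuous.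
rewrite (@continuous_FTC2 _ w W)//.
- apply/continuous_within_itvP => //; split.
  + by move=> x; rewrite in_itv/= => /andP[? ?]; apply: cw; rewrite !ltW.
  + by apply: cvg_at_right_filter; apply: cw; rewrite lexx ltW.
  + by apply: cvg_at_left_filter; apply: cw; rewrite lexx ltW.
- split.
  + by move=> x; rewrite in_itv/= => /andP[? ?]; have := dW x; rewrite !ltW// => -[].
  + by apply: cvg_at_right_filter; apply: cW; rewrite lexx ltW.
  + by apply: cvg_at_left_filter; apply: cW; rewrite lexx ltW.
- move=> x; rewrite in_itv/= => /andP[? ?].
  by rewrite derive1E; have := dW x; rewrite !ltW// => -[].
Qed.

Lemma is_derive_unique W x (d d' : R) :
  is_derive x 1%R W d -> is_derive x 1%R W d' -> d = d'.
Proof. by move=> [_ <-] [_ <-]. Qed.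

Lemma integral_superset f (A B : set R) : measurable A -> measurable B ->
  A `<=` B -> (forall x, B x -> ~ A x -> f x = 0%R) ->
  \int[mu]_(x in B) (f x)%:E = \int[mu]_(x in A) (f x)%:E.
Proof.
move=> mA mB AB f0; rewrite integral_mkcond [RHS]integral_mkcond.
apply: eq_integral => x _; rewrite !patchE.
case: ifPn => [/set_mem Bx|/negP nBx]; case: ifPn => [/set_mem Ax|/negP nAx] //.
- by rewrite f0// => Ax; apply: nAx; exact: mem_set.
- by exfalso; apply: nBx; apply: mem_set; exact: AB.
Qed.

Lemma integral_derive_right W w M :
  (forall t, (0 <= t)%R -> is_derive t 1%R W (w t)) ->
  (forall t, (0 <= t)%R -> {for t, continuous w}) ->
  (forall t, (M <= t)%R -> W t = 0%R) ->
  \int[mu]_(t in `]0%R, +oo[) (w t)%:E = (- W 0)%:E.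
Proof.
move=> dW cw W0; pose N : R := (`|M| + 1)%R.
have N0 : (0 < N)%R by rewrite /N; have := normr_ge0 M; lra.
have MN : (M < N)%R by rewrite /N; have := ler_norm M; lra.
have w0 t : (N <= t)%R -> w t = 0%R.
  move=> Nt; apply: (@is_derive_unique W t).
    by apply: dW; rewrite (le_trans _ Nt)// ltW.
  apply: (@near_eq_is_derive _ _ _ (fun=> 0%R)).
  near=> s; rewrite W0// ltW//; near: s; apply: lt_nbhsr.
  exact: lt_le_trans Nt.
rewrite (@integral_superset w `]0%R, N]%classic)//=.
- rewrite integral_itv_obnd_cbnd.
    have -> : \int[mu]_(x in `[0%R, N]) (w x)%:E = (W N - W 0)%:E.
      by apply: integral_derive => // x /andP[x0 _]; [exact: dW|exact: cw].
    by rewrite (W0 N) ?sub0r// ltW.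
  apply/measurable_EFinP.
  have /subspace_continuous_measurable_fun : {within `]0%R, N], continuous w}.
    apply: continuous_in_subspaceT => x; rewrite inE /= in_itv/= => /andP[? _].
    by apply: cw; exact: ltW.
  by apply; exact: measurable_itv.
- by move=> x /=; rewrite !in_itv/= andbT => /andP[].
- move=> x /=; rewrite !in_itv/= andbT => -> /= xN; apply: w0.
  by rewrite leNgt; apply/negP => /ltW; exact: xN.
Unshelve. all: by end_near. Qed.

Lemma integral_derive_left W w M :
  (forall t, (t <= 0)%R -> is_derive t 1%R W (w t)) ->
  (forall t, (t <= 0)%R -> {for t, continuous w}) ->
  (forall t, (t <= M)%R -> W t = 0%R) ->
  \int[mu]_(t in `]-oo, 0%R[) (w t)%:E = (W 0)%:E.
Proof.
move=> dW cw W0; pose N : R := (- (`|M| + 1))%R.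
have N0 : (N < 0)%R by rewrite /N; have := normr_ge0 M; lra.
have MN : (N < M)%R by rewrite /N; have := ler_norm (- M); rewrite normrN; lra.
have w0 t : (t <= N)%R -> w t = 0%R.
  move=> Nt; apply: (@is_derive_unique W t).
    by apply: dW; rewrite (le_trans Nt)// ltW.
  apply: (@near_eq_is_derive _ _ _ (fun=> 0%R)).
  near=> s; rewrite W0// ltW//; near: s; apply: lt_nbhsl.
  exact: le_lt_trans MN.
rewrite (@integral_superset w `[N, 0%R[%classic)//=.
- rewrite integral_itv_bndo_bndc.
    have -> : \int[mu]_(x in `[N, 0%R]) (w x)%:E = (W 0 - W N)%:E.
      by apply: integral_derive => // x /andP[_ x0]; [exact: dW|exact: cw].
    by rewrite (W0 N) ?subr0// ltW.
  apply/measurable_EFinP.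
  have /subspace_continuous_measurable_fun : {within `[N, 0%R[, continuous w}.
    apply: continuous_in_subspaceT => x; rewrite inE /= in_itv/= => /andP[_ ?].
    by apply: cw; exact: ltW.
  by apply; exact: measurable_itv.
- by move=> x /=; rewrite !in_itv/= => /andP[].
- move=> x /=; rewrite !in_itv/= => -> /= xN; apply: w0.
  by rewrite leNgt; apply/negP => /ltW h; apply: xN; rewrite h.
Unshelve. all: by end_near. Qed.

Lemma integral_line_split f : measurable_fun setT f ->
  \int[mu]_x (f x)%:E = \int[mu]_(x in `]-oo, 0%R[) (f x)%:E +
                        \int[mu]_(x in `]0%R, +oo[) (f x)%:E.
Proof.
move=> mf; have mf' : measurable_fun setT (EFin \o f) by exact/measurable_EFinP.
have E : [set: R] `\ 0%R = `]-oo, 0%R[%classic `|` `]0%R, +oo[%classic.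
  apply/seteqP; split => x /=; rewrite !in_itv/= andbT.
    by case=> _ /eqP; rewrite neq_lt => /orP.
  by move=> H; split => // x0; move: H; rewrite x0 ltxx => -[].
rewrite -(@integral_setD1 _ _ 0%R setT)//=; last 2 first.
- by rewrite E; exact: measurableU.
- exact: measurable_funTS.
rewrite E integral_setU//; first exact: measurable_funTS.
apply/disj_setPS => x /=; rewrite !in_itv/= andbT => -[? ?].
by have : (x < x)%R by [exact: (@lt_trans _ _ 0%R)]; rewrite ltxx.
Qed.

(** A compactly supported function with a kink at 0 integrates its derivative
    to 0, provided the two branches agree at 0. *)
Lemma integral_derive_kink f Wm wm Wp wp M : measurable_fun setT f ->
  (forall x, (x < 0)%R -> f x = wm x) -> (forall x, (0 < x)%R -> f x = wp x) ->
  (forall x, is_derive x 1%R Wm (wm x)) -> (forall x, is_derive x 1%R Wp (wp x)) ->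
  (forall x, {for x, continuous wm}) -> (forall x, {for x, continuous wp}) ->
  (forall x, (M <= `|x|)%R -> Wm x = 0%R) ->
  (forall x, (M <= `|x|)%R -> Wp x = 0%R) ->
  Wm 0%R = Wp 0%R ->
  \int[mu]_x (f x)%:E = 0.
Proof.
move=> mf fm fp dm dp cm cp Wm0 Wp0 W0; rewrite integral_line_split//.
under eq_integral => x /set_mem /= xi.
  rewrite fm; last by move: xi; rewrite in_itv.
  over.
under [X in _ + X]eq_integral => x /set_mem /= xi.
  rewrite fp; last by move: xi; rewrite in_itv/= andbT.
  over.
have -> : \int[mu]_(t in `]-oo, 0%R[) (wm t)%:E = (Wm 0)%:E.
  apply: (@integral_derive_left Wm _ (- `|M|)%R) => // t tM; apply: Wm0; rewrite (le_trans (ler_norm M))//.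
  by rewrite lerNr in tM; rewrite (le_trans tM)// -normrN ler_norm.
have -> : \int[mu]_(t in `]0%R, +oo[) (wp t)%:E = (- Wp 0)%:E.
  by apply: (@integral_derive_right Wp _ (`|M|)%R) => // t tM; apply: Wp0; rewrite (le_trans (ler_norm M))// (le_trans tM)// ler_norm.
by rewrite W0 -EFinD subrr.
Qed.

End LineIntegrals.

(** * Integration over the half plane *)

Section UpperHalfPlane.
Context {R : realType}.
Notation mu := (@lebesgue_measure R).
Notation mu2 := (@lebesgue_measure R \x @lebesgue_measure R)%E.
Implicit Types (f g : R * R -> R) (x t : R).
Local Open Scope ereal_scope.

Definition upper : set (R * R) := above (fun=> 0%R).

Lemma upperE x t : upper (x, t) = (0 < t)%R :> Prop.
Proof. by []. Qed.

Lemma measurable_section_t f x :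
  measurable_fun setT f -> measurable_fun setT (fun t => f (x, t)).
Proof. by move=> mf; apply: (measurableT_comp mf); exact: pair1_measurable. Qed.

Lemma measurable_section_x f t :
  measurable_fun setT f -> measurable_fun setT (fun x => f (x, t)).
Proof. by move=> mf; apply: (measurableT_comp mf); exact: pair2_measurable. Qed.

Lemma measurable_upper : measurable upper.
Proof.
have -> : upper = setT `*` `]0%R, +oo[%classic.
  by apply/seteqP; split => -[x t]; rewrite /upper /above /= in_itv/= andbT// => -[].
exact: measurableX.
Qed.

Lemma measurable_oneDsqrV : measurable_fun setT (fun x : R => (1 + x ^+ 2)^-1)%R.
Proof.
by apply: continuous_measurable_fun => x; exact: continuous_oneDsqrV.
Qed.

Lemma integral_oneDsqrV : \int[mu]_x ((1 + x ^+ 2)^-1)%:E = pi%:E.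
Proof.
rewrite (@ge0_symfun_integralT _ (fun x => (1 + x ^+ 2)^-1)%R)//.
- have -> : [set x : R | (0 <= x)%R] = `[0%R, +oo[%classic.
    by apply/seteqP; split => x /=; rewrite in_itv/= andbT.
  have := @integral0y_oneDsqr R; rewrite /oneDsqr => ->.
  by rewrite -EFinM mulrC divfK.
- by move=> x; rewrite invr_ge0 addr_ge0 ?sqr_ge0.
- exact: continuous_oneDsqrV.
- by move=> x /=; rewrite sqrrN.
Qed.

Lemma integrable_oneDsqrV : mu.-integrable setT (fun x => ((1 + x ^+ 2)^-1)%:E).
Proof.
apply/integrableP; split; first by apply/measurable_EFinP; exact: measurable_oneDsqrV.
under eq_integral => x _ do
  rewrite gee0_abs ?lee_fin ?invr_ge0 ?addr_ge0 ?sqr_ge0//.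
by rewrite integral_oneDsqrV ltry.
Qed.

Lemma measurable_decay : measurable_fun setT (fun X : R * R => decay X.1 X.2).
Proof.
apply: plane_measurable_comp measurable_invr _.
apply: measurable_funM; apply: measurable_funD => //;
  by apply: measurable_funX; [exact: measurable_fst|] || apply: measurable_funX.
Qed.

Lemma decayE x t : (decay x t = (1 + x ^+ 2)^-1 * (1 + t ^+ 2)^-1)%R.
Proof. exact: invfM. Qed.

Lemma integrable_decay : mu2.-integrable setT (fun X => (decay X.1 X.2)%:E).
Proof.
have hz (y : R) : 0 <= ((1 + y ^+ 2)^-1)%:E.
  by rewrite lee_fin invr_ge0 addr_ge0 ?sqr_ge0.
apply/(@integrable12ltyP _ _ _ _ _ mu mu); first by apply/measurable_EFinP; exact: measurable_decay.
apply: (@le_lt_trans _ _ (\int[mu]_x (((1 + x ^+ 2)^-1)%:E * pi%:E))).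
  apply: ge0_le_integral => //=.
  - by move=> x _; exact: integral_ge0.
  - apply: (@measurable_fun_fubini_tonelli_F _ _ _ _ R mu
      (fun X : R * R => (`|decay X.1 X.2|%R)%:E)) => //.
    by apply/measurable_EFinP; apply: measurableT_comp => //; exact: measurable_decay.
  - by apply: emeasurable_funM => //; apply/measurable_EFinP; exact: measurable_oneDsqrV.
  - move=> x _; rewrite -integral_oneDsqrV.
    rewrite -ge0_integralZl//; [|by apply/measurable_EFinP; exact: measurable_oneDsqrV].
    apply: ge0_le_integral => //=.
    + apply/measurable_EFinP; apply: measurableT_comp => //.
      exact: measurable_section_t measurable_decay.
    + apply: emeasurable_funM => //; apply/measurable_EFinP; exact: measurable_oneDsqrV.
    + by move=> t _; rewrite lee_fin gtr0_norm ?decay_gt0// decayE.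
rewrite ge0_integralZr//; [|by apply/measurable_EFinP; exact: measurable_oneDsqrV
  |by rewrite lee_fin pi_ge0].
by rewrite integral_oneDsqrV -EFinM ltry.
Qed.

Lemma upper_integrable_le f K : measurable_fun upper f ->
  (forall X, upper X -> `|f X| <= K * decay X.1 X.2)%R ->
  mu2.-integrable upper (EFin \o f).
Proof.
move=> mf fK; apply: (@le_integrable _ _ R mu2 upper measurable_upper (EFin \o f)
  (fun X : R * R => K%:E * (decay X.1 X.2)%:E)).
- exact/measurable_EFinP.
- by move=> X /fK h; rewrite -EFinM lee_fin (le_trans h)// ler_norm.
- apply: integrableZl; first exact: measurable_upper.
  by apply: integrableS integrable_decay => //; exact: measurable_upper.
Qed.

(** Fubini on the half plane, with the t-integral inside. *)
Lemma upper_integral_xt f (g : R -> \bar R) :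
  mu2.-integrable upper (EFin \o f) ->
  (forall x, \int[mu]_(t in `]0%R, +oo[) (f (x, t))%:E = g x) ->
  \int[mu2]_(X in upper) (f X)%:E = \int[mu]_x g x.
Proof.
move=> fi0 fg.
have fi : mu2.-integrable setT ((EFin \o f) \_ upper).
  exact/(@integrable_mkcond _ _ R mu2 upper (EFin \o f) measurable_upper).
rewrite integral_mkcond -(integral12_prod_meas1 fi); apply: eq_integral => x _.
rewrite -fg integral_mkcond; apply: eq_integral => t _.
by rewrite /= !patchE; congr (if _ then _ else _); apply/idP/idP;
  rewrite !inE /= in_itv/= andbT.
Qed.

Lemma upper_integral_tx0 f : mu2.-integrable upper (EFin \o f) ->
  (forall t, (0 < t)%R -> \int[mu]_x (f (x, t))%:E = 0) ->
  \int[mu2]_(X in upper) (f X)%:E = 0.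
Proof.
move=> fi0 f0.
have fi : mu2.-integrable setT ((EFin \o f) \_ upper).
  exact/(@integrable_mkcond _ _ R mu2 upper (EFin \o f) measurable_upper).
rewrite integral_mkcond -(integral21_prod_meas1 fi); apply: integral0_eq => t _.
have [t0|t0] := ltP 0%R t.
  rewrite -(f0 t t0); apply: eq_integral => x _.
  by rewrite patchE mem_set.
apply: integral0_eq => x _; rewrite patchE memNset//.
by apply/negP; rewrite -leNgt.
Qed.

End UpperHalfPlane.

(** * Green's identities with a kink on the axis *)

Section Green.
Context {R : realType}.
Notation mu := (@lebesgue_measure R).
Notation mu2 := (@lebesgue_measure R \x @lebesgue_measure R)%E.
Implicit Types (u ux ut uxt v vx vt vxt z : R -> R -> R) (F g : R * R -> R) (b : R -> R) (x t : R).

(** What the identities use of a test function: C^1 regularity, with bounds and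
    the size of the support. *)
Record ctest F (M B : R) : Prop := CTest {
  ctest_dx : forall x t, is_derive x 1 (fun y => F (y, t)) (pd false F (x, t));
  ctest_dt : forall x t, is_derive t 1 (fun s => F (x, s)) (pd true F (x, t));
  ctest_continuous : continuous F;
  ctest_continuous_pd : forall i, continuous (pd i F);
  ctest_support : forall x t, M <= `|x| \/ M <= `|t| -> F (x, t) = 0;
  ctest_bound : forall X, `|F X| <= B;
  ctest_bound_pd : forall i X, `|pd i F X| <= B }.

Lemma compact_plane_box (K : set (R * R)) : compact K ->
  exists2 M : R, 0 < M & forall x t, K (x, t) -> `|x| < M /\ `|t| < M.
Proof.
move=> cK; have [M [Mr hM]] := compact_bounded cK.
exists (`|M| + 1) => [|x t Kxt]; first by rewrite ltr_pwDr.
have := hM (`|M| + 1 / 2); rewrite (le_lt_trans (ler_norm M)) ?ltrDl//.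
move=> /(_ isT) /(_ _ Kxt); rewrite /= prod_normE /= ge_max => /andP[hx ht].
by split; [apply: le_lt_trans hx _|apply: le_lt_trans ht _]; lra.
Qed.

Lemma continuous_compact_support_bounded (T : topologicalType) (f : T -> R) (K : set T) :
  continuous f -> compact K -> (forall X, ~ K X -> f X = 0) ->
  exists B, forall X, `|f X| <= B.
Proof.
move=> cF cK F0.
have cFK : compact (f @` K).
  by apply: continuous_compact => //; exact: continuous_subspaceT.
have [M [Mr hM]] := compact_bounded cFK.
exists (`|M| + 1) => X; have [KX|nKX] := pselect (K X).
  by apply: (hM (`|M| + 1)); [rewrite (le_lt_trans (ler_norm M))// ltrDl|exists X].
by rewrite F0// normr0 addr_ge0.
Qed.

Lemma test2_ctest (Om : set (R * R)) F : test2 Om F ->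
  exists M B, 0 < M /\ ctest F M B.
Proof.
move=> [sF [K [cK _ F0]]].
have [M M0 hM] := compact_plane_box cK.
have dF i X : is_derive X (dir i) F (pd i F X).
  by have [_ /(_ i X)] := sF [::]; exact: derivableP.
have cF : continuous F by have [] := sF [::].
have cpF i : continuous (pd i F) by have [] := sF [:: i].
have pF0 i X : ~ K X -> pd i F X = 0.
  move=> nKX; have oK : open (~` K).
    by apply: closed_openC; apply: compact_closed => //; exact: norm_hausdorff.
  have h : is_derive X (dir i) F 0.
    apply: (@near_eq_is_derive _ _ _ (fun=> 0)).
    have : nbhs X (~` K) by exact: open_nbhs_nbhs.
    by apply: filterS => Y nKY; rewrite F0.
  by have [_ <-] := dF i X; have [_ ->] := h.
have [B0 hB0] := continuous_compact_support_bounded cF cK F0.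
have [B1 hB1] := continuous_compact_support_bounded (cpF false) cK (pF0 false).
have [B2 hB2] := continuous_compact_support_bounded (cpF true) cK (pF0 true).
exists M, (`|B0| + `|B1| + `|B2|); split; first by [].
split.
- by move=> x t; apply/is_derive_pdx; exact: dF.
- by move=> x t; apply/is_derive_pdt; exact: dF.
- exact: cF.
- exact: cpF.
- move=> x t h; apply: F0 => /hM[xM tM]; case: h; rewrite leNgt ?xM ?tM//.
- move=> X; rewrite (le_trans (hB0 X))// (le_trans (ler_norm _))//.
  by rewrite -addrA lerDl addr_ge0.
- case=> X.
    by rewrite (le_trans (hB2 X))// (le_trans (ler_norm _))// lerDr addr_ge0.
  rewrite (le_trans (hB1 X))// (le_trans (ler_norm _))//.
  by rewrite -[leLHS]add0r -[leLHS]addr0 !lerD.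
Qed.

(** The domination that makes a function integrable both over the half plane and
    over its boundary line. *)
Definition dominated z :=
  measurable_fun setT (fun X : R * R => z X.1 X.2) /\
  exists K, forall x t, 0 <= t -> `|z x t| <= K * decay x t.

Lemma dominated_integrableM z g B : dominated z -> measurable_fun setT g ->
  (forall X, `|g X| <= B) ->
  mu2.-integrable upper (fun X => (z X.1 X.2 * g X)%:E).
Proof.
move=> [mz [K hK]] mg gB; apply: (@upper_integrable_le _ _ (`|K| * `|B|)).
  by apply: measurable_funTS; exact: measurable_funM.
move=> [x t] t0 /=; rewrite normrM mulrAC ler_pM//.
- rewrite (le_trans (hK x t (ltW t0)))// ler_wpM2r ?ler_norm//.
  exact/ltW/decay_gt0.
- by rewrite (le_trans (gB _))// ler_norm.
Qed.

(** Coefficients that are constant on either side of the axis; the value at 0 is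
    free. *)
Record kinkcoef b (bm bp : R) : Prop := KinkCoef {
  kinkcoef_measurable : measurable_fun setT b;
  kinkcoef_lt : forall x, x < 0 -> b x = bm;
  kinkcoef_gt : forall x, 0 < x -> b x = bp }.

Lemma kinkcoef_bound b bm bp : kinkcoef b bm bp ->
  forall x, `|b x| <= `|bm| + `|bp| + `|b 0|.
Proof.
move=> [_ hm hp] x; have [x0|x0|->] := ltgtP x 0.
- by rewrite hm// -addrA lerDl addr_ge0.
- by rewrite hp// -[leLHS]add0r -[leLHS]addr0 !lerD.
- by rewrite lerDr addr_ge0.
Qed.

(** If v vanishes on the axis then this function is continuous across it, in spite
    of the jump of b. *)
Definition kink b u v x t := u x t + b x * v x t.

Lemma dominated_kink b bm bp u v : kinkcoef b bm bp -> dominated u -> dominated v ->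
  dominated (kink b u v).
Proof.
move=> hb [mu_ [K hK]] [mv [L hL]]; split.
  apply: measurable_funD => //; apply: measurable_funM => //.
  exact: (measurableT_comp (kinkcoef_measurable hb) measurable_fst).
exists (K + (`|bm| + `|bp| + `|b 0|) * L) => x t t0; rewrite mulrDl.
apply: le_trans (ler_normD _ _) _; apply: lerD; first exact: hK.
by rewrite normrM -mulrA ler_pM// ?(kinkcoef_bound hb)// hL.
Qed.

Record C1x u ux : Prop := C1X {
  C1x_derive : forall x t, 0 <= t -> is_derive x 1 (u ^~ t) (ux x t);
  C1x_continuous : forall x t, 0 <= t -> {for x, continuous (ux ^~ t)};
  C1x_ptame : dominated u;
  C1x_ptame' : dominated ux }.

Record C1t u ut : Prop := C1T {
  C1t_derive : forall x t, 0 <= t -> is_derive t 1 (u x) (ut x t);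
  C1t_continuous : forall x t, 0 <= t -> {for t, continuous (ut x)};
  C1t_ptame : dominated u;
  C1t_ptame' : dominated ut }.

Lemma continuous_section_x (F : R * R -> R) x t :
  continuous F -> {for x, continuous (fun y => F (y, t))}.
Proof.
move=> cF; apply: (@continuous_comp _ _ _ (fun y => (y, t)) F); last exact: cF.
by apply: (@cvg_pair _ _ _ _ (nbhs x) (nbhs t)); [exact: cvg_id|exact: cvg_cst].
Qed.

Lemma continuous_section_t (F : R * R -> R) x t :
  continuous F -> {for t, continuous (fun s => F (x, s))}.
Proof.
move=> cF; apply: (@continuous_comp _ _ _ (fun s => (x, s)) F); last exact: cF.
by apply: (@cvg_pair _ _ _ _ (nbhs x) (nbhs t)); [exact: cvg_cst|exact: cvg_id].
Qed.

Lemma integral_split d (T : measurableType d) (nu : {measure set T -> \bar R})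
    (D : set T) (f g : T -> R) (c : \bar R) : measurable D ->
  nu.-integrable D (EFin \o f) -> nu.-integrable D (EFin \o g) ->
  (\int[nu]_(x in D) (f x + g x)%:E = c)%E ->
  (\int[nu]_(x in D) (f x)%:E = c - \int[nu]_(x in D) (g x)%:E)%E.
Proof.
move=> mD fi gi <-; under [X in _ = (X - _)%E]eq_integral do rewrite EFinD.
by rewrite integralD// addeK// integrable_fin_num.
Qed.

Section WithTest.
Variables (F : R * R -> R) (M B : R).
Hypothesis tF : ctest F M B.

Let mF : measurable_fun setT F.
Proof. exact: plane_continuous_measurable (ctest_continuous tF). Qed.

Let mpF i : measurable_fun setT (pd i F).
Proof. exact: plane_continuous_measurable (@ctest_continuous_pd _ _ _ tF i). Qed.

Lemma ctest_integrableM z : dominated z ->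
  mu2.-integrable upper (fun X => (z X.1 X.2 * F X)%:E).
Proof. by move=> hz; exact: dominated_integrableM hz mF (ctest_bound tF). Qed.

Lemma ctest_integrableM_pd i z : dominated z ->
  mu2.-integrable upper (fun X => (z X.1 X.2 * pd i F X)%:E).
Proof. by move=> hz; exact: dominated_integrableM hz (mpF i) (ctest_bound_pd tF i). Qed.

(** The jump of b contributes no boundary term on the axis, since v vanishes
    there. *)
Lemma green_x b bm bp u ux v vx : kinkcoef b bm bp ->
  C1x u ux -> C1x v vx -> (forall t, 0 < t -> v 0 t = 0) ->
  (\int[mu2]_(X in upper) (kink b u v X.1 X.2 * pd false F X)%:E =
   - \int[mu2]_(X in upper) (kink b ux vx X.1 X.2 * F X)%:E)%E.
Proof.
move=> hb hu hv v0.
have i1 : mu2.-integrable upper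
    (fun X => (kink b u v X.1 X.2 * pd false F X)%:E).
  apply: ctest_integrableM_pd.
  by apply: dominated_kink hb _ _; [exact: C1x_ptame hu|exact: C1x_ptame hv].
have i2 : mu2.-integrable upper (fun X => (kink b ux vx X.1 X.2 * F X)%:E).
  apply: ctest_integrableM.
  by apply: dominated_kink hb _ _; [exact: C1x_ptame' hu|exact: C1x_ptame' hv].
rewrite -(@add0e _ (- _)%E); apply: integral_split => //; first exact: measurable_upper.
apply: (@upper_integral_tx0 _ (fun X => kink b u v X.1 X.2 * pd false F X +
  kink b ux vx X.1 X.2 * F X)) => [|t t0].
  by rewrite (_ : EFin \o _ = fun X => (kink b u v X.1 X.2 * pd false F X)%:E +
    (kink b ux vx X.1 X.2 * F X)%:E)%E//; apply: integrableD => //;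
    exact: measurable_upper.
have t0' := ltW t0.
have dW (c : R) x : is_derive x 1 (fun y => (u y t + c * v y t) * F (y, t))
    ((u x t + c * v x t) * pd false F (x, t) + (ux x t + c * vx x t) * F (x, t)).
  have h1 : is_derive x 1 (fun y => u y t + c * v y t) (ux x t + c * vx x t).
    exact: is_deriveD (C1x_derive hu x t0') (is_deriveZ c (C1x_derive hv x t0')).
  apply: is_derive_eq (is_deriveM h1 (ctest_dx tF x t)) _.
  by rewrite /GRing.scale /=; ring.
have cW (c x : R) : {for x, continuous (fun x => (u x t + c * v x t) *
     pd false F (x, t) + (ux x t + c * vx x t) * F (x, t))}.
  have cu := is_derive1_continuous (C1x_derive hu x t0').
  have cv := is_derive1_continuous (C1x_derive hv x t0').
  have cux := @C1x_continuous _ _ hu x t t0'; have cvx := @C1x_continuous _ _ hv x t t0'.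
  apply: cvgD; apply: cvgM.
  - by apply: cvgD => //; apply: cvgM => //; exact: cvg_cst.
  - exact: continuous_section_x (@ctest_continuous_pd _ _ _ tF false).
  - by apply: cvgD => //; apply: cvgM => //; exact: cvg_cst.
  - exact: continuous_section_x (ctest_continuous tF).
apply: (@integral_derive_kink _ _ (fun y => (u y t + bm * v y t) * F (y, t)) _
  (fun y => (u y t + bp * v y t) * F (y, t)) _ M _ _ _ (dW bm) (dW bp)).
- have m1 := measurable_section_x (f := fun X => kink b u v X.1 X.2 * pd false F X +
    kink b ux vx X.1 X.2 * F X) t; apply: m1.
  have [k1 _] := dominated_kink hb (C1x_ptame hu) (C1x_ptame hv).
  have [k2 _] := dominated_kink hb (C1x_ptame' hu) (C1x_ptame' hv).
  by apply: measurable_funD; exact: measurable_funM.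
- by move=> x x0; rewrite /kink /= (kinkcoef_lt hb).
- by move=> x x0; rewrite /kink /= (kinkcoef_gt hb).
- exact: cW.
- exact: cW.
- by move=> x xM; rewrite (ctest_support tF) ?mulr0//; left.
- by move=> x xM; rewrite (ctest_support tF) ?mulr0//; left.
- by rewrite v0// !mulr0.
Qed.

Lemma dominated_line_integrable z : dominated z ->
  mu.-integrable setT (fun x => (z x 0 * F (x, 0))%:E).
Proof.
move=> [mz [K hK]].
apply: (@le_integrable _ _ R mu setT measurableT _
  (fun x => (`|K| * `|B|)%:E * ((1 + x ^+ 2)^-1)%:E)%E).
- apply/measurable_EFinP; apply: (@measurable_section_x _
    (fun X => z X.1 X.2 * F X)); exact: measurable_funM.
- move=> x _; rewrite -EFinM lee_fin [leRHS]ger0_norm; last first.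
    by rewrite !mulr_ge0// invr_ge0 addr_ge0 ?sqr_ge0.
  rewrite normrM mulrAC ler_pM//; last first.
    by rewrite (le_trans (ctest_bound tF _))// ler_norm.
  have d0 := decay_gt0 x 0.
  rewrite (le_trans (hK x 0 _))// (le_trans (ler_wpM2r (ltW d0) (ler_norm K)))//.
  by rewrite ler_wpM2l// decayE expr0n addr0 invr1 mulr1.
- by apply: integrableZl => //; exact: integrable_oneDsqrV.
Qed.

Lemma green_t b bm bp u ut v vt : kinkcoef b bm bp ->
  C1t u ut -> C1t v vt ->
  (\int[mu2]_(X in upper) (kink b u v X.1 X.2 * pd true F X)%:E =
   \int[mu]_x (- (kink b u v x 0 * F (x, 0)))%:E
   - \int[mu2]_(X in upper) (kink b ut vt X.1 X.2 * F X)%:E)%E.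
Proof.
move=> hb hu hv.
have i1 : mu2.-integrable upper
    (fun X => (kink b u v X.1 X.2 * pd true F X)%:E).
  apply: ctest_integrableM_pd.
  by apply: dominated_kink hb _ _; [exact: C1t_ptame hu|exact: C1t_ptame hv].
have i2 : mu2.-integrable upper (fun X => (kink b ut vt X.1 X.2 * F X)%:E).
  apply: ctest_integrableM.
  by apply: dominated_kink hb _ _; [exact: C1t_ptame' hu|exact: C1t_ptame' hv].
apply: integral_split => //; first exact: measurable_upper.
apply: (@upper_integral_xt _ (fun X => kink b u v X.1 X.2 * pd true F X +
  kink b ut vt X.1 X.2 * F X)) => [|x].
  by rewrite (_ : EFin \o _ = fun X => (kink b u v X.1 X.2 * pd true F X)%:E +
    (kink b ut vt X.1 X.2 * F X)%:E)%E//; apply: integrableD => //;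
    exact: measurable_upper.
apply: (@integral_derive_right _ (fun t => kink b u v x t * F (x, t)) _ M).
- move=> t t0.
  have h1 : is_derive t 1 (kink b u v x) (kink b ut vt x t).
    exact: is_deriveD (C1t_derive hu x t0) (is_deriveZ (b x) (C1t_derive hv x t0)).
  apply: is_derive_eq (is_deriveM h1 (ctest_dt tF x t)) _.
  by rewrite /GRing.scale /= /kink; ring.
- move=> t t0.
  have cu := is_derive1_continuous (C1t_derive hu x t0).
  have cv := is_derive1_continuous (C1t_derive hv x t0).
  have cut := @C1t_continuous _ _ hu x t t0; have cvt := @C1t_continuous _ _ hv x t t0.
  have ck (y z : R -> R -> R) : {for t, continuous (y x)} ->
      {for t, continuous (z x)} -> {for t, continuous (kink b y z x)}.
    by move=> ? ?; apply: cvgD => //; apply: cvgM => //; exact: cvg_cst.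
  apply: cvgD; apply: cvgM.
  - exact: ck cu cv.
  - exact: continuous_section_t (@ctest_continuous_pd _ _ _ tF true).
  - exact: ck cut cvt.
  - exact: continuous_section_t (ctest_continuous tF).
- move=> t tM; rewrite (ctest_support tF) ?mulr0//; right.
  by rewrite (le_trans tM)// ler_norm.
Qed.

(** After integrating by parts in both variables the two integrals of the mixed
    second derivative against F cancel, and the boundary term is left. *)
Lemma green_flux b bm bp ux ut uxt vx vt vxt : kinkcoef b bm bp ->
  C1x ut uxt -> C1t ux uxt -> C1x vt vxt -> C1t vx vxt ->
  (forall t, 0 < t -> vt 0 t = 0) ->
  (\int[mu2]_(X in upper) (kink b ut vt X.1 X.2 * pd false F X -
      kink b ux vx X.1 X.2 * pd true F X)%:E =
   \int[mu]_x (kink b ux vx x 0 * F (x, 0))%:E)%E.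
Proof.
move=> hb utx uxt' vtx vxt' v0.
have p1 : dominated (kink b ut vt).
  by apply: dominated_kink hb _ _; [exact: C1x_ptame utx|exact: C1x_ptame vtx].
have p2 : dominated (kink b ux vx).
  by apply: dominated_kink hb _ _; [exact: C1t_ptame uxt'|exact: C1t_ptame vxt'].
have p3 : dominated (kink b uxt vxt).
  by apply: dominated_kink hb _ _; [exact: C1t_ptame' uxt'|exact: C1t_ptame' vxt'].
under eq_integral do rewrite EFinB.
rewrite integralB; [|exact: measurable_upper|exact: ctest_integrableM_pd|
  exact: ctest_integrableM_pd].
rewrite (green_x hb utx vtx v0) (green_t hb uxt' vxt').
have : (\int[mu2]_(X in upper) (kink b uxt vxt X.1 X.2 * F X)%:E)%E \is a fin_num.
  by apply: integrable_fin_num; [exact: measurable_upper|exact: ctest_integrableM].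
have fl : (\int[mu]_x (kink b ux vx x 0 * F (x, 0))%:E)%E \is a fin_num.
  by apply: integrable_fin_num => //; exact: dominated_line_integrable.
have -> : (\int[mu]_x (- (kink b ux vx x 0 * F (x, 0)))%:E =
    - \int[mu]_x (kink b ux vx x 0 * F (x, 0))%:E)%E.
  under eq_integral do rewrite -mulN1r EFinM.
  by rewrite integralZl ?mulN1e//; exact: dominated_line_integrable.
move: fl; case: (\int[mu]_x _)%E => // r _; case: (\int[mu2]_(X in _) _)%E => // s _.
by rewrite -!EFinN -!EFinD; congr EFin; ring.
Qed.

End WithTest.
End Green.

(** * Cutoff functions *)

Section Cutoff.
Context {R : realType}.
Implicit Types (u ux ut uxt v z : R -> R -> R) (p r : R -> R) (x t : R).

Record cutoff p (p' : R -> R) (L : R) : Prop := Cutoff {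
  cutoff_derive : forall x, is_derive x 1 p (p' x);
  cutoff_continuous : continuous p';
  cutoff_bound : forall x, `|p x| <= L;
  cutoff_bound' : forall x, `|p' x| <= L }.

(** A multiple of exp(-1/(1 - (x/N)^2)), normalized to be 1 at 0. *)
Definition chi (N x : R) : R := expR 1 * flat 0 (1 - (x / N) ^+ 2).
Definition chi' (N x : R) : R :=
  expR 1 * flat 2 (1 - (x / N) ^+ 2) * (- 2 * x / N ^+ 2).

Lemma is_derive_chi_arg N x :
  is_derive x 1 (fun y => 1 - (y / N) ^+ 2) (- 2 * x / N ^+ 2).
Proof.
have -> : (fun y => 1 - (y / N) ^+ 2) = (fun y => - N^-1 ^+ 2 * (y ^+ 2 + 0) + 1).
  by apply/funext => y; rewrite exprMn addr0; ring.
have h := is_deriveD (is_deriveZ (- N^-1 ^+ 2) (is_derive_sqD x 0))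
  (is_derive_cst (1 : R) x 1).
by apply: is_derive_eq h _; rewrite /GRing.scale /= -exprVn; ring.
Qed.

Lemma is_derive_chi N x : is_derive x 1 (chi N) (chi' N x).
Proof.
have h1 := is_derive_chi_arg N x.
have h2 := @is_derive1_comp _ (flat 0) (fun y => 1 - (y / N) ^+ 2) x _ _
  (is_derive_flat 0 _) h1.
apply: is_derive_eq (is_deriveZ (expR 1) h2) _.
by rewrite /GRing.scale /= /chi' mulr0n oppr0 mul0r add0r mulrA.
Qed.

Lemma flat_continuous k : continuous (@flat R k).
Proof. by move=> x; exact: is_derive1_continuous (is_derive_flat _ _). Qed.

Lemma chi'_continuous N : continuous (chi' N).
Proof.
move=> x; have c2 := is_derive1_continuous (@is_derive1_comp _ (flat 2)
  (fun y => 1 - (y / N) ^+ 2) x _ _ (is_derive_flat 2 _) (is_derive_chi_arg N x)).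
apply: cvgM; first by apply: cvgM; [exact: cvg_cst|exact: c2].
by apply: cvgM; [apply: cvgM; [exact: cvg_cst|exact: cvg_id]|exact: cvg_cst].
Qed.

Lemma chi_eq0 N x : 0 < N -> N <= `|x| -> chi N x = 0.
Proof.
move=> N0 Nx; rewrite /chi /flat ltNge.
have -> : 1 - (x / N) ^+ 2 <= 0; last by rewrite mulr0.
rewrite subr_le0 -[(x / N) ^+ 2]real_normK ?num_real// expr_ge1// normrM.
by rewrite normfV (gtr0_norm N0) ler_pdivlMr// mul1r.
Qed.

Lemma chi_le N x : 0 <= chi N x <= expR 1.
Proof.
rewrite /chi mulr_ge0 ?expR_ge0 ?flat_ge0//= ler_piMr ?expR_ge0//.
by have := flat_le 0 0 (1 - (x / N) ^+ 2); rewrite expr0 fact0 mulr1.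
Qed.

Lemma chi'_le N x : 0 < N -> `|chi' N x| <= 4 * expR 1 / N.
Proof.
move=> N0; have [xN|xN] := ltP `|x| N; last first.
  have := chi_eq0 N0 xN; rewrite /chi' /chi /flat => /eqP.
  rewrite mulf_eq0 gt_eqF ?expR_gt0//=; case: ifP => [h|_ _].
    by rewrite mulf_eq0 expr0 oner_eq0 gt_eqF ?expR_gt0.
  by rewrite mulr0 mul0r normr0 divr_ge0// ?mulr_ge0// ?expR_ge0// ltW.
rewrite /chi' normrM (ger0_norm (mulr_ge0 (expR_ge0 _) (flat_ge0 _ _))).
have f2 : flat 2 (1 - (x / N) ^+ 2) <= 2.
  by have := flat_le 2 0 (1 - (x / N) ^+ 2); rewrite expr0 mulr1.
have -> : 4 * expR 1 / N = expR 1 * 2 * (2 / N) by ring.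
apply: ler_pM; rewrite ?mulr_ge0 ?flat_ge0 ?expR_ge0// ?ler_wpM2l ?expR_ge0//.
rewrite !normrM normrN normfV (gtr0_norm (exprn_gt0 2 N0)) (@gtr0_norm _ 2)//.
by rewrite ler_pdivrMr ?exprn_gt0// expr2 mulrA divfK ?gt_eqF// ler_wpM2l// ltW.
Qed.

Lemma cutoff_chi N : 1 <= N -> cutoff (chi N) (chi' N) (4 * expR 1).
Proof.
move=> N1; have N0 : 0 < N by exact: lt_le_trans N1.
have e0 := expR_ge0 (1 : R).
split; [exact: is_derive_chi|exact: chi'_continuous| |] => x.
  by have /andP[h0 h1] := chi_le N x; rewrite ger0_norm// (le_trans h1)//; lra.
by rewrite (le_trans (chi'_le x N0))// ler_pdivrMr// ler_peMr// mulr_ge0.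
Qed.

Lemma cvg_inv_natS : (n.+1%:R : R)^-1 @[n --> \oo] --> (0 : R).
Proof. exact: cvg_harmonic. Qed.

Lemma chi_cvg x : chi n.+1%:R x @[n --> \oo] --> (1 : R).
Proof.
have h : 1 - (x * n.+1%:R^-1) ^+ 2 @[n --> \oo] --> (1 - (x * 0) ^+ 2 : R).
  apply: cvgB; first exact: cvg_cst.
  by apply: (@cvgM _ _ _ _ (fun n => x * n.+1%:R^-1) (fun n => x * n.+1%:R^-1));
    apply: cvgM; [exact: cvg_cst|exact: cvg_inv_natS|exact: cvg_cst|exact: cvg_inv_natS].
have h2 : flat 0 (1 - (x * n.+1%:R^-1) ^+ 2) @[n --> \oo] --> flat 0 (1 - (x * 0) ^+ 2 : R).
  by apply: continuous_cvg => //; exact: flat_continuous.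
have E : expR 1 * flat 0 (1 - (x * 0) ^+ 2 : R) = 1.
  by rewrite mulr0 expr0n subr0 /flat ltr01 expr0 mul1r invr1 -expRD subrr expR0.
by rewrite -[X in _ --> X]E; apply: cvgM; [exact: cvg_cst|exact: h2].
Qed.

Lemma chi'_cvg x : chi' n.+1%:R x @[n --> \oo] --> (0 : R).
Proof.
apply: norm_cvg0.
apply: (@squeeze_cvgr _ _ _ _ (fun=> 0) (fun n => 4 * expR 1 * n.+1%:R^-1)).
- by near=> n; rewrite normr_ge0 chi'_le.
- exact: cvg_cst.
- rewrite -[X in _ --> X](mulr0 (4 * expR 1 : R)).
  by apply: cvgM; [exact: cvg_cst|exact: cvg_inv_natS].
Unshelve. all: by end_near. Qed.

Lemma cutoff_measurable p p' L : cutoff p p' L ->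
  measurable_fun setT p /\ measurable_fun setT p'.
Proof.
move=> hp; split; apply: continuous_measurable_fun.
- by move=> x; exact: is_derive1_continuous (cutoff_derive hp x).
- exact: cutoff_continuous hp.
Qed.

Lemma dominatedD u v : dominated u -> dominated v -> dominated (fun x t => u x t + v x t).
Proof.
move=> [mu_ [K hK]] [mv [L hL]]; split; first exact: measurable_funD.
by exists (K + L) => x t t0; rewrite mulrDl (le_trans (ler_normD _ _))// lerD ?hK ?hL.
Qed.

Lemma dominatedZ c u : dominated u -> dominated (fun x t => c * u x t).
Proof.
move=> [mu_ [K hK]]; split; first exact: measurable_funM.
by exists (`|c| * K) => x t t0; rewrite normrM -mulrA ler_wpM2l ?hK.
Qed.

Lemma dominated_cut p r (L : R) u : measurable_fun setT p -> measurable_fun setT r ->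
  (forall x, `|p x| <= L) -> (forall x, `|r x| <= L) -> dominated u ->
  dominated (fun x t => p x * r t * u x t).
Proof.
move=> mp mr pL rL [mu_ [K hK]]; split.
  apply: measurable_funM => //; apply: measurable_funM.
  - exact: (plane_measurable_comp mp measurable_fst).
  - exact: (plane_measurable_comp mr measurable_snd).
exists (L * L * K) => x t t0; rewrite !normrM -[leRHS]mulrA.
by apply: ler_pM; rewrite ?mulr_ge0//; [exact: ler_pM|exact: hK].
Qed.

Lemma C1xD u ux v vx : C1x u ux -> C1x v vx ->
  C1x (fun x t => u x t + v x t) (fun x t => ux x t + vx x t).
Proof.
move=> hu hv; split.
- by move=> x t t0; apply: is_deriveD; [exact: C1x_derive hu _ _ _|exact: C1x_derive hv _ _ _].
- move=> x t t0; apply: cvgD; [exact: (@C1x_continuous _ _ _ hu)|exact: (@C1x_continuous _ _ _ hv)].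
- by apply: dominatedD; [exact: C1x_ptame hu|exact: C1x_ptame hv].
- by apply: dominatedD; [exact: C1x_ptame' hu|exact: C1x_ptame' hv].
Qed.

Lemma C1tD u ut v vt : C1t u ut -> C1t v vt ->
  C1t (fun x t => u x t + v x t) (fun x t => ut x t + vt x t).
Proof.
move=> hu hv; split.
- by move=> x t t0; apply: is_deriveD; [exact: C1t_derive hu _ _ _|exact: C1t_derive hv _ _ _].
- move=> x t t0; apply: cvgD; [exact: (@C1t_continuous _ _ _ hu)|exact: (@C1t_continuous _ _ _ hv)].
- by apply: dominatedD; [exact: C1t_ptame hu|exact: C1t_ptame hv].
- by apply: dominatedD; [exact: C1t_ptame' hu|exact: C1t_ptame' hv].
Qed.

Lemma C1xZ c u ux : C1x u ux -> C1x (fun x t => c * u x t) (fun x t => c * ux x t).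
Proof.
move=> hu; split.
- by move=> x t t0; apply: is_deriveZ; exact: C1x_derive hu _ _ _.
- move=> x t t0; apply: cvgM; [exact: cvg_cst|exact: (@C1x_continuous _ _ _ hu)].
- by apply: dominatedZ; exact: C1x_ptame hu.
- by apply: dominatedZ; exact: C1x_ptame' hu.
Qed.

Lemma C1tZ c u ut : C1t u ut -> C1t (fun x t => c * u x t) (fun x t => c * ut x t).
Proof.
move=> hu; split.
- by move=> x t t0; apply: is_deriveZ; exact: C1t_derive hu _ _ _.
- move=> x t t0; apply: cvgM; [exact: cvg_cst|exact: (@C1t_continuous _ _ _ hu)].
- by apply: dominatedZ; exact: C1t_ptame hu.
- by apply: dominatedZ; exact: C1t_ptame' hu.
Qed.

Lemma C1x_cut p p' r (L : R) u ux : cutoff p p' L -> measurable_fun setT r ->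
  (forall t, `|r t| <= L) -> C1x u ux ->
  C1x (fun x t => p x * r t * u x t)
      (fun x t => p' x * r t * u x t + p x * r t * ux x t).
Proof.
move=> hp mr rL hu; have [mp mp'] := cutoff_measurable hp; split.
- move=> x t t0.
  have h1 : is_derive x 1 (fun y => p y * r t) (p' x * r t).
    have := is_deriveZ (r t) (cutoff_derive hp x).
    by rewrite /GRing.scale /= mulrC; under eq_fun do rewrite mulrC.
  apply: is_derive_eq (is_deriveM h1 (C1x_derive hu x t0)) _.
  by rewrite /GRing.scale /=; ring.
- move=> x t t0; apply: cvgD; apply: cvgM.
  + by apply: cvgM; [exact: cutoff_continuous hp _|exact: cvg_cst].
  + exact: is_derive1_continuous (C1x_derive hu x t0).
  + by apply: cvgM; [exact: is_derive1_continuous (cutoff_derive hp x)|exact: cvg_cst].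
  + exact: (@C1x_continuous _ _ _ hu).
- exact: dominated_cut mp mr (cutoff_bound hp) rL (C1x_ptame hu).
- apply: dominatedD.
  + exact: dominated_cut mp' mr (cutoff_bound' hp) rL (C1x_ptame hu).
  + exact: dominated_cut mp mr (cutoff_bound hp) rL (C1x_ptame' hu).
Qed.

Lemma C1t_cut p r r' (L : R) u ut : cutoff r r' L -> measurable_fun setT p ->
  (forall t, `|p t| <= L) -> C1t u ut ->
  C1t (fun x t => p x * r t * u x t)
      (fun x t => p x * r' t * u x t + p x * r t * ut x t).
Proof.
move=> hr mp pL hu; have [mr mr'] := cutoff_measurable hr; split.
- move=> x t t0.
  have h1 : is_derive t 1 (fun s => p x * r s) (p x * r' t).
    exact: (is_deriveZ (p x) (cutoff_derive hr t)).
  apply: is_derive_eq (is_deriveM h1 (C1t_derive hu x t0)) _.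
  by rewrite /GRing.scale /=; ring.
- move=> x t t0; apply: cvgD; apply: cvgM.
  + by apply: cvgM; [exact: cvg_cst|exact: cutoff_continuous hr _].
  + exact: is_derive1_continuous (C1t_derive hu x t0).
  + by apply: cvgM; [exact: cvg_cst|exact: is_derive1_continuous (cutoff_derive hr t)].
  + exact: (@C1t_continuous _ _ _ hu).
- exact: dominated_cut mp mr pL (cutoff_bound hr) (C1t_ptame hu).
- apply: dominatedD.
  + exact: dominated_cut mp mr' pL (cutoff_bound' hr) (C1t_ptame hu).
  + exact: dominated_cut mp mr pL (cutoff_bound hr) (C1t_ptame' hu).
Qed.

End Cutoff.

(** * Limits of integrals *)

Section LimitsOfIntegrals.
Context {R : realType}.
Local Open Scope ereal_scope.

Lemma cvg_e0 (f : nat -> \bar R) :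
  (forall e : R, (0 < e)%R -> \forall n \near \oo, 0 <= f n <= e%:E) ->
  f @ \oo --> 0.
Proof.
move=> h; apply/fine_cvgP; split.
  near=> n; have /andP[f0 f1] : 0 <= f n <= 1%:E by near: n; exact: h.
  by rewrite ge0_fin_numE// (le_lt_trans f1)// ltry.
apply/cvgr0Pnorm_le => e e0; near=> n.
have /andP[f0 f1] : 0 <= f n <= e%:E by near: n; exact: h.
have fn : f n \is a fin_num by rewrite ge0_fin_numE// (le_lt_trans f1)// ltry.
by rewrite /= ger0_norm ?fine_ge0// -lee_fin fineK.
Unshelve. all: by end_near. Qed.

Lemma cvg_e0_le (f : nat -> \bar R) (e : R) : f @ \oo --> 0 -> (0 < e)%R ->
  \forall n \near \oo, f n <= e%:E.
Proof.
move=> /fine_cvgP[ffin /cvgr0Pnorm_le /(_ e) + e0] => /(_ e0) h.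
near=> n; have fn : f n \is a fin_num by near: n.
rewrite -(fineK fn) lee_fin (le_trans (ler_norm _))//.
by near: n.
Unshelve. all: by end_near. Qed.

Context d (T : measurableType d) (nu : {measure set T -> \bar R}).
Variables (D : set T) (mD : measurable D).

(** The Cauchy-Schwarz inequality in the form in which limits use it. *)
Lemma cvg_integral_mul (z : T -> R) (w : nat -> T -> R) :
  measurable_fun D z -> (forall n, measurable_fun D (w n)) ->
  \int[nu]_(x in D) (z x ^+ 2)%:E < +oo ->
  (fun n => \int[nu]_(x in D) (w n x ^+ 2)%:E) @ \oo --> 0 ->
  (fun n => \int[nu]_(x in D) (`|z x * w n x|)%:E) @ \oo --> 0.
Proof.
move=> mz mw zfin w0; apply: cvg_e0 => e e0.
pose I := fine (\int[nu]_(x in D) (z x ^+ 2)%:E).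
have z0 : 0 <= \int[nu]_(x in D) (z x ^+ 2)%:E.
  by apply: integral_ge0 => x _; rewrite lee_fin sqr_ge0.
have IE : I%:E = \int[nu]_(x in D) (z x ^+ 2)%:E.
  by rewrite /I fineK// ge0_fin_numE.
have I0 : (0 <= I)%R by rewrite -lee_fin IE.
pose dl : R := (e / 2 / (I + 1))%R.
have dl0 : (0 < dl)%R by rewrite /dl !divr_gt0// ltr_wpDl.
near=> n; apply/andP; split; first by apply: integral_ge0 => x _; rewrite lee_fin.
have mz2 : measurable_fun D (fun x => (z x ^+ 2)%:E).
  by apply/measurable_EFinP; exact: measurable_funX.
have mw2 : measurable_fun D (fun x => (w n x ^+ 2)%:E).
  by apply/measurable_EFinP; exact: measurable_funX.
apply: (@le_trans _ _ (\int[nu]_(x in D)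
    (dl%:E * (z x ^+ 2)%:E + (dl^-1)%:E * (w n x ^+ 2)%:E))).
  apply: ge0_le_integral => //.
  - apply/measurable_EFinP; apply: measurableT_comp => //.
    exact: measurable_funM.
  - by apply: emeasurable_funD; apply: emeasurable_funM.
  - move=> x _; rewrite -!EFinM -EFinD lee_fin normrM.
    rewrite -(real_normK (num_real (z x))) -(real_normK (num_real (w n x))).
    have -> : (dl * `|z x| ^+ 2 + dl^-1 * `|w n x| ^+ 2 =
      dl^-1 * ((dl * `|z x|) ^+ 2 + `|w n x| ^+ 2))%R by field; rewrite gt_eqF.
    rewrite ler_pdivlMl// mulrA -subr_ge0.
    set a := (dl * `|z x|)%R; set b := `|w n x|%R.
    have : (0 <= (a - b) ^+ 2 + a ^+ 2 + b ^+ 2)%R by rewrite !addr_ge0 ?sqr_ge0.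
    by nra.
rewrite ge0_integralD//; last first.
- by apply: emeasurable_funM.
- by move=> x _; rewrite mule_ge0 ?lee_fin ?sqr_ge0// ltW// invr_gt0.
- by apply: emeasurable_funM.
- by move=> x _; rewrite mule_ge0 ?lee_fin ?sqr_ge0// ltW.
rewrite !ge0_integralZl//; last first.
- by rewrite lee_fin ltW.
- by move=> x _; rewrite lee_fin sqr_ge0.
- by rewrite lee_fin ltW// invr_gt0.
- by move=> x _; rewrite lee_fin sqr_ge0.
rewrite -IE -EFinM [leRHS](_ : _ = (e / 2)%:E + (e / 2)%:E); last first.
  by rewrite -EFinD -splitr.
apply: leeD.
  rewrite lee_fin (@le_trans _ _ (dl * (I + 1))%R)//.
    by rewrite ler_wpM2l ?lerDl// ltW.
  by rewrite /dl divfK// gt_eqF// ltr_wpDl.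
have : \int[nu]_(x in D) (w n x ^+ 2)%:E <= (dl * (e / 2))%:E.
  by near: n; apply: cvg_e0_le => //; rewrite mulr_gt0// divr_gt0.
move=> /(lee_wpmul2l (x := (dl^-1)%:E)) h; apply: (le_trans (h _)).
  by rewrite lee_fin ltW// invr_gt0.
by rewrite -EFinM lee_fin mulKf ?gt_eqF.
Unshelve. all: by end_near. Qed.

Lemma cvg_integral_L1 (f_ : nat -> T -> R) (f : T -> R) :
  (forall n, nu.-integrable D (EFin \o f_ n)) -> nu.-integrable D (EFin \o f) ->
  (fun n => \int[nu]_(x in D) (`|f_ n x - f x|)%:E) @ \oo --> 0 ->
  (fun n => \int[nu]_(x in D) (f_ n x)%:E) @ \oo --> \int[nu]_(x in D) (f x)%:E.
Proof.
move=> fi_ fi h.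
have ffin := integrable_fin_num mD fi.
apply/(sube_cvg0 _ ffin).1.
apply/cvg_abse0P; apply: cvg_e0 => e e0.
have h2 := cvg_e0_le h e0; near=> n; rewrite abse_ge0/=.
apply: (@le_trans _ _ (\int[nu]_(x in D) (`|f_ n x - f x|)%:E)); last by near: n.
have -> : \int[nu]_(x in D) (f_ n x)%:E - \int[nu]_(x in D) (f x)%:E =
    \int[nu]_(x in D) (f_ n x - f x)%:E.
  by under [RHS]eq_integral do rewrite EFinB; rewrite integralB//; exact: fi_.
apply: le_abse_integral => //; apply/measurable_EFinP; apply: measurable_funB.
- by have /measurable_int/measurable_EFinP := fi_ n.
- by have /measurable_int/measurable_EFinP := fi.
Unshelve. all: by end_near. Qed.

End LimitsOfIntegrals.

(** * Approximation of functions with a trace *)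

Section TraceFlux.
Context {R : realType}.
Notation mu := (@lebesgue_measure R).
Notation mu2 := (@lebesgue_measure R \x @lebesgue_measure R)%E.
Implicit Types (z : R -> R -> R) (F v h : R * R -> R) (H : R * R -> R * R) (x t : R).

(** The half plane is a countable union of compact sets. *)
Lemma loc_int2_measurable F : loc_int2 upper F -> measurable_fun upper F.
Proof.
move=> lF.
pose K (n : nat) : set (R * R) :=
  `[- n%:R : R, n%:R]%classic `*` `[n.+1%:R^-1 : R, n%:R]%classic.
have mK n : measurable (K n) by apply: measurableX; exact: measurable_itv.
have E : upper = \bigcup_n K n.
  apply/seteqP; split => [[x t]|[x t] [n _ [_ /=]]]; last first.
    by rewrite in_itv/= => /andP[h _]; rewrite upperE (lt_le_trans _ h)// invr_gt0.
  rewrite upperE => t0; exists (Num.truncn (`|x| + `|t| + t^-1)).+1 => //.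
  set n := Num.truncn _; have hn : `|x| + `|t| + t^-1 < n.+1%:R.
    by rewrite truncnS_gt.
  have t'0 : 0 < t^-1 by rewrite invr_gt0.
  split; rewrite /= in_itv/=.
    by rewrite -ler_norml ltW// (le_lt_trans _ hn)// -addrA lerDl addr_ge0// ltW.
  apply/andP; split.
    rewrite -[leRHS]invrK lef_pV2 ?posrE ?invr_gt0// (@le_trans _ _ n.+1%:R)//.
      by rewrite ltW// (le_lt_trans _ hn)// lerDr addr_ge0.
    by rewrite ler_nat.
  rewrite (le_trans (ler_norm t))// ltW// (le_lt_trans _ hn)//.
  by rewrite addrAC lerDr addr_ge0// ltW.
rewrite E; apply/measurable_fun_bigcup => // n.
have /(lF (K n)) : compact (K n).
  by apply: compact_setX; exact: segment_compact.
have KU : K n `<=` upper by rewrite E; exact: bigcup_sup.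
by move=> /(_ KU) /measurable_int /measurable_EFinP.
Qed.

Lemma measurable_enorm : measurable_fun setT (@enorm R).
Proof.
have ms : measurable_fun setT (@Num.sqrt R).
  by apply: continuous_measurable_fun; exact: sqrt_continuous.
apply: (plane_measurable_comp ms); apply: measurable_funD;
  apply: measurable_funX; [exact: measurable_fst|exact: measurable_snd].
Qed.

Lemma enorm_sq (X : R * R) : enorm X ^+ 2 = X.1 ^+ 2 + X.2 ^+ 2.
Proof. by rewrite sqr_sqrtr// addr_ge0 ?sqr_ge0. Qed.

Lemma enorm_ge0 (X : R * R) : 0 <= enorm X.
Proof. exact: sqrtr_ge0. Qed.

Lemma eballE (X : R * R) (r : R) : 0 < r ->
  eball X r = [set Y : R * R | (Y.1 - X.1) ^+ 2 + (Y.2 - X.2) ^+ 2 < r ^+ 2].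
Proof.
move=> r0; apply/seteqP; split => Y; rewrite /eball /=.
  by rewrite -(enorm_sq (Y - X)) ltr_sqr// nnegrE ?enorm_ge0// ltW.
by rewrite -(enorm_sq (Y - X)) ltr_sqr// nnegrE ?enorm_ge0// ltW.
Qed.

Lemma measurable_eball (X : R * R) (r : R) : 0 < r -> measurable (eball X r).
Proof.
move=> r0; rewrite eballE// -[X in measurable X]setTI.
have mf : measurable_fun setT
    (fun Y : R * R => (Y.1 - X.1) ^+ 2 + (Y.2 - X.2) ^+ 2).
  apply: measurable_funD; apply: measurable_funX; exact: measurable_funB.
have := mf measurableT (`]-oo, r ^+ 2[%classic) (measurable_itv _).
by congr measurable; apply/seteqP; split => Y /=; rewrite ?in_itv/= => -[].
Qed.

Lemma box_eball x t (N : R) : 0 < N -> ~ eball (0, 0) (2 * N) (x, t) ->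
  N <= `|x| \/ N <= `|t|.
Proof.
move=> N0; rewrite eballE ?mulr_gt0//= !subr0 => /negP; rewrite -leNgt => h.
have [xN|xN] := leP N `|x|; [by left|right]; rewrite leNgt; apply/negP => tN.
move: h; rewrite -[x ^+ 2]real_normK ?num_real// -[t ^+ 2]real_normK ?num_real//.
have := normr_ge0 x; have := normr_ge0 t.
move=> t0 x0 h; have hx : `|x| ^+ 2 < N ^+ 2 by rewrite ltr_sqr ?nnegrE// ltW.
have ht : `|t| ^+ 2 < N ^+ 2 by rewrite ltr_sqr ?nnegrE// ltW.
by have := sqr_ge0 N; nra.
Qed.

Lemma arc0 x : Defs.arc (fun=> 0) x = 1.
Proof.
rewrite /Defs.arc (_ : (fun=> 0)^`()%classic x = 0); last exact: derive1_cst.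
by rewrite expr0n addr0 sqrtr1.
Qed.

Lemma bd_intE (w : R * R -> \bar R) : bd_int (fun=> 0) w = (\int[mu]_x w (x, 0%R))%E.
Proof.
apply: eq_integral => x _; by rewrite /pull arc0 mule1.
Qed.

Lemma decay_le1 x t : decay x t <= 1.
Proof.
rewrite decayE -[leRHS]mulr1 ler_pM//;
  by rewrite ?invr_ge0 ?addr_ge0 ?sqr_ge0// invf_le1 ?lerDl ?ltr_pwDl ?sqr_ge0.
Qed.

Lemma dominated_sq z : dominated z -> dominated (fun x t => z x t ^+ 2).
Proof.
move=> [mz [K hK]]; split; first exact: measurable_funX.
exists (K ^+ 2) => x t t0; rewrite normrX.
have d0 := decay_gt0 x t; have d1 := decay_le1 x t.
apply: (@le_trans _ _ ((K * decay x t) ^+ 2)).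
  have := hK x t t0; have := normr_ge0 (z x t); nra.
rewrite exprMn ler_wpM2l ?sqr_ge0//; nra.
Qed.

Lemma dominated_integrable z : dominated z ->
  mu2.-integrable upper (fun X => (z X.1 X.2)%:E).
Proof.
move=> [mz [K hK]]; apply: (@upper_integrable_le _ _ K).
  exact: measurable_funTS.
by move=> [x t] t0; exact/hK/ltW.
Qed.

Lemma dominated_integrable_line z : dominated z -> mu.-integrable setT (fun x => (z x 0)%:E).
Proof.
move=> [mz [K hK]].
apply: (@le_integrable _ _ R mu setT measurableT _
  (fun x => `|K|%:E * ((1 + x ^+ 2)^-1)%:E)%E).
- apply/measurable_EFinP.
  exact: (@measurable_section_x _ (fun X => z X.1 X.2)).
- move=> x _; rewrite -EFinM lee_fin [leRHS]ger0_norm; last first.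
    by rewrite mulr_ge0// invr_ge0 addr_ge0 ?sqr_ge0.
  have d0 := decay_gt0 x 0.
  rewrite (le_trans (hK x 0 _))// (le_trans (ler_wpM2r (ltW d0) (ler_norm K)))//.
  by rewrite ler_wpM2l// decayE expr0n addr0 invr1 mulr1.
- by apply: integrableZl => //; exact: integrable_oneDsqrV.
Qed.

Lemma cvg_e0_squeeze (f g : nat -> \bar R) :
  (forall n, (0 <= f n <= g n)%E) -> g @ \oo --> 0%E -> f @ \oo --> 0%E.
Proof.
move=> fg g0; apply: (@squeeze_cvge _ _ _ _ (fun=> 0%E) _ g) => //.
- by near=> n; exact: fg.
- exact: cvg_cst.
Unshelve. all: by end_near. Qed.

(** What a trace gives: approximants, close in each ball, with the three
    square errors in the plane separated. *)
Lemma trace_approx v H h : weak_grad upper v H -> trace (fun=> 0) v H h ->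
  exists F : nat -> R * R -> R,
  [/\ (forall n, exists M B, 0 < M /\ ctest (F n) M B),
    (forall (r : R) i, 0 < r -> (fun n => \int[mu2]_(X in upper `&` eball (0, 0)%R r)
        ((pd i (F n) X - (if i then (H X).2 else (H X).1)) ^+ 2)%:E)%E @ \oo --> 0%E) &
    (forall r : R, 0 < r -> (fun n => \int[mu]_x
        (((F n (x, 0%R) - h (x, 0%R)) * \1_(eball (0, 0)%R r) (x, 0%R))%R ^+ 2)%:E)%E
       @ \oo --> 0%E)].
Proof.
move=> [lv lH1 lH2 _] [mh [F [tF hF]]]; exists F; split.
- by move=> n; exact: test2_ctest (tF n).
- move=> r i r0; have [+ _] := hF r r0; apply: cvg_e0_squeeze => n.
  have [M [B [M0 cF]]] := test2_ctest (tF n).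
  have mU : measurable (upper `&` eball (0, 0)%R r).
    by apply: measurableI; [exact: measurable_upper|exact: measurable_eball].
  have mS (f : R * R -> R) : measurable_fun upper f -> measurable_fun (upper `&` eball (0, 0)%R r) f.
    by apply: measurable_funS; [exact: measurable_upper|exact: subIsetl].
  have mF : measurable_fun (upper `&` eball (0, 0)%R r) (F n).
    apply: mS; apply: measurable_funTS; apply: plane_continuous_measurable.
    exact: ctest_continuous cF.
  have mpF j : measurable_fun (upper `&` eball (0, 0)%R r) (pd j (F n)).
    apply: mS; apply: measurable_funTS; apply: plane_continuous_measurable.
    exact: (@ctest_continuous_pd _ _ _ _ cF).
  have mv := mS _ (loc_int2_measurable lv).
  have mH1 := mS _ (loc_int2_measurable lH1).
  have mH2 := mS _ (loc_int2_measurable lH2).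
  apply/andP; split; first by apply: integral_ge0 => X _; rewrite lee_fin sqr_ge0.
  have E X : enorm (grad (F n) X - H X) ^+ 2 =
     (pd false (F n) X - (H X).1) ^+ 2 + (pd true (F n) X - (H X).2) ^+ 2.
    by rewrite enorm_sq.
  apply: ge0_le_integral => //.
  + by move=> X _; rewrite lee_fin sqr_ge0.
  + apply/measurable_EFinP; apply: measurable_funX; apply: measurable_funB; first exact: mpF.
    by case: i.
  + apply/measurable_EFinP; under eq_fun do rewrite E.
    apply: measurable_funD; first by apply: measurable_funX; exact: measurable_funB.
    apply: measurable_funD; apply: measurable_funX; apply: measurable_funB;
      [exact: (mpF false)|exact: mH1|exact: (mpF true)|exact: mH2].
  + move=> X _; rewrite E lee_fin; case: i.
      by rewrite addrA lerDr addr_ge0 ?sqr_ge0.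
    by rewrite addrCA lerDl addr_ge0 ?sqr_ge0.
- move=> r r0; suff -> : (fun n => \int[mu]_x (((F n (x, 0%R) - h (x, 0%R)) *
      \1_(eball (0, 0)%R r) (x, 0%R))%R ^+ 2)%:E)%E = (fun n => bd_int (fun=> 0)
      (fun Q => ((F n Q - h Q) ^+ 2 * \1_(eball (0, 0)%R r) Q)%:E)).
    by have [_] := hF r r0.
  apply/funext => n; rewrite bd_intE; apply: eq_integral => x _; congr EFin.
  rewrite exprMn; congr (_ * _); rewrite indicE; case: (_ \in _) => /=;
  by rewrite ?expr1n ?expr0n.
Qed.

End TraceFlux.

(** * The flux identity for fields of compact support *)

Section FluxIdentity.
Context {R : realType}.
Notation mu := (@lebesgue_measure R).
Notation mu2 := (@lebesgue_measure R \x @lebesgue_measure R)%E.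
Implicit Types (z : R -> R -> R) (F v h : R * R -> R) (H : R * R -> R * R) (x t : R).

Lemma integrable_EFinB d (T : measurableType d) (nu : {measure set T -> \bar R})
    (D : set T) (f g : T -> R) : measurable D ->
  nu.-integrable D (EFin \o f) -> nu.-integrable D (EFin \o g) ->
  nu.-integrable D (EFin \o (fun y : T => f y - g y)).
Proof. by move=> mD hf hg; exact: (integrableB mD hf hg). Qed.

Lemma le_sq_sum (a b : R) : `|a * b| <= a ^+ 2 + b ^+ 2.
Proof.
rewrite normrM -(real_normK (num_real a)) -(real_normK (num_real b)).
by have := normr_ge0 a; have := normr_ge0 b; nra.
Qed.

Definition finite_energy H :=
  [/\ measurable_fun upper (fun X => (H X).1),
      measurable_fun upper (fun X => (H X).2) &
      mu2.-integrable upper (fun X => (enorm (H X) ^+ 2)%:E)].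

Lemma Wdot_finite_energy v H : Wdot (fun=> 0) v H -> finite_energy H.
Proof.
move=> [[_ l1 l2 _] fin].
have m1 := loc_int2_measurable l1; have m2 := loc_int2_measurable l2.
split => //; apply/integrableP; split.
  apply/measurable_EFinP; under eq_fun do rewrite enorm_sq.
  by apply: measurable_funD; exact: measurable_funX.
by under eq_integral do rewrite gee0_abs ?lee_fin ?sqr_ge0//.
Qed.

Lemma dominated_mul_integrable z (w : R * R -> R) : dominated z -> measurable_fun upper w ->
  mu2.-integrable upper (fun X => (w X ^+ 2)%:E) ->
  mu2.-integrable upper (fun X => (z X.1 X.2 * w X)%:E).
Proof.
move=> hz mw wi.
apply: (@le_integrable _ _ R mu2 upper measurable_upper _
  (fun X : R * R => (z X.1 X.2 ^+ 2)%:E + (w X ^+ 2)%:E)%E).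
- apply/measurable_EFinP; apply: measurable_funM => //.
  by apply: measurable_funTS; have [] := hz.
- move=> X _; rewrite -EFinD lee_fin [leRHS]ger0_norm ?addr_ge0 ?sqr_ge0//.
  exact: le_sq_sum.
- apply: integrableD => //; first exact: measurable_upper.
  exact: dominated_integrable (dominated_sq hz).
Qed.

Lemma finite_energy_sq H i : finite_energy H ->
  mu2.-integrable upper (fun X => ((if i then (H X).2 else (H X).1) ^+ 2)%:E).
Proof.
move=> [m1 m2 fe]; apply: (@le_integrable _ _ R mu2 upper measurable_upper _ _ _ _ fe).
  by apply/measurable_EFinP; apply: measurable_funX; case: i.
move=> X _; rewrite lee_fin !ger0_norm ?sqr_ge0// enorm_sq.
by case: i; rewrite ?lerDl ?lerDr sqr_ge0.
Qed.

Lemma finite_energy_pairing z1 z2 H : dominated z1 -> dominated z2 -> finite_energy H ->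
  mu2.-integrable upper (fun X => (z1 X.1 X.2 * (H X).1 - z2 X.1 X.2 * (H X).2)%:E).
Proof.
move=> h1 h2 fe; have [m1 m2 _] := fe.
apply: integrable_EFinB; first exact: measurable_upper.
- by apply: dominated_mul_integrable => //; exact: (finite_energy_sq false fe).
- by apply: dominated_mul_integrable => //; exact: (finite_energy_sq true fe).
Qed.

(** Gradients of approximants converge in L^2 on balls, hence in L^1 against a
    field of compact support. *)
Lemma dominated_trace_cvg z (F : nat -> R * R -> R) H i (N : R) :
  0 < N -> dominated z -> (forall x t, N <= `|x| \/ N <= `|t| -> z x t = 0) ->
  (forall n, measurable_fun setT (pd i (F n))) ->
  measurable_fun upper (fun X => if i then (H X).2 else (H X).1) ->
  (fun n => \int[mu2]_(X in upper `&` eball (0, 0)%R (2 * N))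
    ((pd i (F n) X - (if i then (H X).2 else (H X).1)) ^+ 2)%:E)%E @ \oo --> 0%E ->
  (fun n => \int[mu2]_(X in upper)
    (`|z X.1 X.2 * (pd i (F n) X - (if i then (H X).2 else (H X).1))|)%:E)%E
    @ \oo --> 0%E.
Proof.
move=> N0 hz z0 mF mH hF.
have mU : measurable (upper `&` eball (0, 0)%R (2 * N)).
  by apply: measurableI; [exact: measurable_upper|apply: measurable_eball; rewrite mulr_gt0].
have mS (f : R * R -> R) : measurable_fun upper f ->
    measurable_fun (upper `&` eball (0, 0)%R (2 * N)) f.
  by apply: measurable_funS; [exact: measurable_upper|exact: subIsetl].
have [mz _] := hz.
have := @cvg_integral_mul _ _ _ mu2 _ mU (fun X => z X.1 X.2)
  (fun n X => pd i (F n) X - (if i then (H X).2 else (H X).1)).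
move=> /(_ (mS _ (measurable_funTS mz))) h.
suff E n : (\int[mu2]_(X in upper)
    (`|z X.1 X.2 * (pd i (F n) X - (if i then (H X).2 else (H X).1))|)%:E =
   \int[mu2]_(X in upper `&` eball (0, 0)%R (2 * N))
    (`|z X.1 X.2 * (pd i (F n) X - (if i then (H X).2 else (H X).1))|)%:E)%E.
  under eq_fun do rewrite E.
  apply: h => //.
  - move=> n; apply: measurable_funB; last exact: mS.
    exact: (measurable_funTS (mF n)).
  - have hs : mu2.-integrable (upper `&` eball (0, 0)%R (2 * N))
        (fun X => (z X.1 X.2 ^+ 2)%:E).
      apply: (@integrableS _ _ R mu2 upper) => //; first exact: measurable_upper.
      exact: (dominated_integrable (dominated_sq hz)).
    by apply: (@integrable_lty _ _ R mu2) hs.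
rewrite integral_mkcond [RHS]integral_mkcond; apply: eq_integral => -[x t] _.
rewrite !patchE in_setI; case: (_ \in upper) => //=.
case: (boolP (_ \in eball _ _)) => // /negP nb.
rewrite z0 ?mul0r ?normr0//; apply: (box_eball N0) => B; apply: nb.
exact: mem_set.
Qed.

(** Boundary values converge in the same sense; in particular a trace is
    integrable against functions of compact support. *)
Lemma dominated_trace_line z (F : nat -> R * R -> R) h (N : R) : 0 < N -> dominated z ->
  (forall x, N <= `|x| -> z x 0 = 0) ->
  (forall n, exists M B, 0 < M /\ ctest (F n) M B) ->
  measurable_fun setT (fun x => h (x, 0)) ->
  (fun n => \int[mu]_x (((F n (x, 0) - h (x, 0)) *
    \1_(eball (0, 0)%R (2 * N)) (x, 0)) ^+ 2)%:E)%E @ \oo --> 0%E ->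
  (fun n => \int[mu]_x (`|z x 0 * (F n (x, 0) - h (x, 0))|)%:E)%E @ \oo --> 0%E /\
  mu.-integrable setT (fun x => (z x 0 * h (x, 0))%:E).
Proof.
move=> N0 hz z0 cF mh hF; have N2 : 0 < 2 * N by rewrite mulr_gt0.
have mF n : measurable_fun setT (F n).
  have [M [B [_ c]]] := cF n.
  exact: plane_continuous_measurable (ctest_continuous c).
have zl := dominated_integrable_line (dominated_sq hz).
have mzl : measurable_fun setT (fun x => z x 0).
  by have [m _] := hz; exact: measurable_section_x m.
have c3 : (fun n => \int[mu]_x (`|z x 0 * (F n (x, 0) - h (x, 0))|)%:E)%E @ \oo --> 0%E.
  have h3 := @cvg_integral_mul _ _ _ mu setT measurableT (fun x => z x 0)
    (fun n x => (F n (x, 0) - h (x, 0)) * \1_(eball (0, 0)%R (2 * N)) (x, 0)) mzl.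
  have mI : measurable_fun setT (fun x => \1_(eball (0, 0)%R (2 * N)) (x, 0) : R).
    apply: (@measurable_section_x _ (\1_(eball (0, 0)%R (2 * N)))).
    by apply: measurable_indic; exact: measurable_eball.
  have mw n : measurable_fun setT (fun x => (F n (x, 0) - h (x, 0)) *
      \1_(eball (0, 0)%R (2 * N)) (x, 0)).
    apply: measurable_funM => //; apply: measurable_funB => //.
    exact: measurable_section_x.
  have := h3 mw (integrable_lty measurableT zl) hF.
  apply: cvg_e0_squeeze => n; rewrite integral_ge0/= => [|x _]; last by rewrite lee_fin.
  rewrite le_eqVlt; apply/orP; left; apply/eqP; apply: eq_integral => x _.
  rewrite indicE; case: (boolP (_ \in _)) => [_|/negP nb]; first by rewrite mulr1.
  have [xN|xN] := leP N `|x|; first by rewrite z0// !mul0r.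
  have [b|] : N <= `|x| \/ N <= `|0 : R|; last first.
  - by rewrite normr0 leNgt N0.
  - by rewrite leNgt xN in b.
  - by apply: (box_eball N0) => b; apply: nb; exact: mem_set.
split=> //; have [n _ hn] := cvg_e0_le c3 ltr01.
have i1 : mu.-integrable setT (fun x => (z x 0 * (F n (x, 0) - h (x, 0)))%:E).
  apply/integrableP; split.
    apply/measurable_EFinP; apply: measurable_funM => //.
    by apply: measurable_funB => //; exact: measurable_section_x.
  apply: (@le_lt_trans _ _ 1%:E); last exact: ltry.
  exact: (hn n (leqnn n)).
have [M [B [_ c]]] := cF n.
have := integrable_EFinB measurableT (dominated_line_integrable c hz) i1.
by apply: eq_integrable => // x _ /=; congr EFin; ring.
Qed.

(** The flux identity passes from smooth functions to functions with a trace,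
    for a vector field of compact support. *)
Lemma flux_identity_compact zt zx v H h (N : R) : 0 < N ->
  dominated zt -> dominated zx ->
  (forall x t, N <= `|x| \/ N <= `|t| -> zt x t = 0 /\ zx x t = 0) ->
  (forall F M B, ctest F M B ->
    (\int[mu2]_(X in upper) (zt X.1 X.2 * pd false F X - zx X.1 X.2 * pd true F X)%:E =
     \int[mu]_x (zx x 0 * F (x, 0))%:E)%E) ->
  weak_grad upper v H -> finite_energy H -> trace (fun=> 0) v H h ->
  (\int[mu2]_(X in upper) (zt X.1 X.2 * (H X).1 - zx X.1 X.2 * (H X).2)%:E =
   \int[mu]_x (zx x 0 * h (x, 0))%:E)%E.
Proof.
move=> N0 ht hx z0 id wg fe tr.
have mh : measurable_fun setT (fun x => h (x, 0)) by have [+ _] := tr.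
have [F [cF cFp cFb]] := trace_approx wg tr.
have N2 : 0 < 2 * N by rewrite mulr_gt0.
have mF n : measurable_fun setT (F n).
  have [M [B [_ c]]] := cF n.
  exact: plane_continuous_measurable (ctest_continuous c).
have mFp n i : measurable_fun setT (pd i (F n)).
  have [M [B [_ c]]] := cF n.
  exact: plane_continuous_measurable (@ctest_continuous_pd _ _ _ _ c i).
have [m1 m2 _] := fe.
have c1 := @dominated_trace_cvg zt F H false N N0 ht (fun x t e => (z0 x t e).1)
  (fun n => mFp n false) m1 (cFp _ false N2).
have c2 := @dominated_trace_cvg zx F H true N N0 hx (fun x t e => (z0 x t e).2)
  (fun n => mFp n true) m2 (cFp _ true N2).
have L : (fun n => \int[mu2]_(X in upper) (zt X.1 X.2 * pd false (F n) X -
     zx X.1 X.2 * pd true (F n) X)%:E)%E @ \oo -->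
   (\int[mu2]_(X in upper) (zt X.1 X.2 * (H X).1 - zx X.1 X.2 * (H X).2)%:E)%E.
  apply: cvg_integral_L1; first exact: measurable_upper.
  - move=> n; have [M [B [_ c]]] := cF n.
    by apply: integrable_EFinB; [exact: measurable_upper|
      exact: ctest_integrableM_pd c _ _ _|exact: ctest_integrableM_pd c _ _ _].
  - exact: finite_energy_pairing.
  - have cc : (fun n => \int[mu2]_(X in upper) (`|zt X.1 X.2 *
        (pd false (F n) X - (H X).1)|)%:E + \int[mu2]_(X in upper)
        (`|zx X.1 X.2 * (pd true (F n) X - (H X).2)|)%:E)%E @ \oo --> 0%E.
      by rewrite -[X in _ --> X]adde0; apply: cvgeD => //.
    apply: cvg_e0_squeeze cc => n.
    rewrite integral_ge0/= => [|X _]; last by rewrite lee_fin.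
    have mT : measurable_fun upper (fun X => zt X.1 X.2 * (pd false (F n) X - (H X).1)).
      apply: measurable_funM; first by apply: measurable_funTS; have [] := ht.
      by apply: measurable_funB => //; exact: (measurable_funTS (mFp n false)).
    have mX : measurable_fun upper (fun X => zx X.1 X.2 * (pd true (F n) X - (H X).2)).
      apply: measurable_funM; first by apply: measurable_funTS; have [] := hx.
      by apply: measurable_funB => //; exact: (measurable_funTS (mFp n true)).
    rewrite -ge0_integralD//; last 3 first.
    + exact: measurable_upper.
    + by apply/measurable_EFinP; exact: measurableT_comp.
    + by apply/measurable_EFinP; exact: measurableT_comp.
    have E X : zt X.1 X.2 * pd false (F n) X - zx X.1 X.2 * pd true (F n) X -
        (zt X.1 X.2 * (H X).1 - zx X.1 X.2 * (H X).2) =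
        zt X.1 X.2 * (pd false (F n) X - (H X).1) -
        zx X.1 X.2 * (pd true (F n) X - (H X).2) by ring.
    apply: ge0_le_integral => //=.
    + exact: measurable_upper.
    + apply/measurable_EFinP; apply: measurableT_comp => //.
      under eq_fun do rewrite E.
      exact: measurable_funB.
    + by apply: emeasurable_funD; apply/measurable_EFinP; exact: measurableT_comp.
    + by move=> X _; rewrite E -EFinD lee_fin ler_normB.
have [c3 hi] := dominated_trace_line N0 hx (fun x e => (z0 x 0 (or_introl e)).2) cF mh (cFb _ N2).
have RR : (fun n => \int[mu]_x (zx x 0 * F n (x, 0))%:E)%E @ \oo -->
    (\int[mu]_x (zx x 0 * h (x, 0))%:E)%E.
  apply: cvg_integral_L1 => //.
  - by move=> n; have [M [B [_ c]]] := cF n; exact: dominated_line_integrable c _ hx.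
  - apply: cvg_e0_squeeze c3 => n; rewrite integral_ge0/= => [|x _]; last by rewrite lee_fin.
    by under [leLHS]eq_integral do rewrite -mulrBr.
have E : (fun n => \int[mu2]_(X in upper) (zt X.1 X.2 * pd false (F n) X -
     zx X.1 X.2 * pd true (F n) X)%:E)%E = (fun n => \int[mu]_x (zx x 0 * F n (x, 0))%:E)%E.
  by apply/funext => n; have [M [B [_ c]]] := cF n; exact: id c.
rewrite E in L; exact: (cvg_unique _ L RR).
Qed.

End FluxIdentity.

(** * The flux identity for decaying fields *)

Section FluxOfProfile.
Context {R : realType}.
Notation mu := (@lebesgue_measure R).
Notation mu2 := (@lebesgue_measure R \x @lebesgue_measure R)%E.
Implicit Types (u ux ut uxt v vx vt vxt z : R -> R -> R) (b p r : R -> R) (x t : R).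

Record C2 u ux ut uxt : Prop := MkC2 {
  C2_x : C1x u ux; C2_t : C1t u ut; C2_tx : C1x ut uxt; C2_xt : C1t ux uxt }.

Lemma C2Z c u ux ut uxt : C2 u ux ut uxt ->
  C2 (fun x t => c * u x t) (fun x t => c * ux x t)
     (fun x t => c * ut x t) (fun x t => c * uxt x t).
Proof. by move=> [? ? ? ?]; split; [exact: C1xZ|exact: C1tZ|exact: C1xZ|exact: C1tZ]. Qed.

Definition cutx p (p' : R -> R) r u ux x t :=
  p' x * r t * u x t + p x * r t * ux x t.
Definition cutt p r (r' : R -> R) u ut x t :=
  p x * r' t * u x t + p x * r t * ut x t.

(** Cutting off the function, and not its gradient, keeps the field divergence
    free. *)
Lemma C2_cut p (p' : R -> R) r (r' : R -> R) (L : R) u ux ut uxt :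
  cutoff p p' L -> cutoff r r' L -> C2 u ux ut uxt ->
  exists uxt', C1x (cutt p r r' u ut) uxt' /\ C1t (cutx p p' r u ux) uxt'.
Proof.
move=> hp hr [hx ht htx hxt].
have [mp mp'] := cutoff_measurable hp; have [mr mr'] := cutoff_measurable hr.
have h1 := C1xD (C1x_cut hp mr' (cutoff_bound' hr) hx) (C1x_cut hp mr (cutoff_bound hr) htx).
have h2 := C1tD (C1t_cut hr mp' (cutoff_bound' hp) ht) (C1t_cut hr mp (cutoff_bound hp) hxt).
eexists; split; first exact: h1.
move: h2; congr C1t; apply/funext => x; apply/funext => t /=; ring.
Qed.

Lemma kink_cutt b p r (r' : R -> R) u ut v vt :
  kink b (cutt p r r' u ut) (cutt p r r' v vt) = cutt p r r' (kink b u v) (kink b ut vt).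
Proof. by apply/funext => x; apply/funext => t; rewrite /kink /cutt; ring. Qed.

Lemma kink_cutx b p (p' : R -> R) r u ux v vx :
  kink b (cutx p p' r u ux) (cutx p p' r v vx) = cutx p p' r (kink b u v) (kink b ux vx).
Proof. by apply/funext => x; apply/funext => t; rewrite /kink /cutx; ring. Qed.

Lemma cut_le (a b c d e f L K1 K2 D : R) : `|a| <= L -> `|b| <= L -> `|c| <= L ->
  `|d| <= L -> `|e| <= K1 * D -> `|f| <= K2 * D ->
  `|a * b * e + c * d * f| <= L ^+ 2 * (K1 + K2) * D.
Proof.
move=> ha hb hc hd he hf; rewrite (le_trans (ler_normD _ _))//.
have -> : L ^+ 2 * (K1 + K2) * D = L * L * (K1 * D) + L * L * (K2 * D) by ring.
by apply: lerD; rewrite !normrM; apply: ler_pM => //; rewrite ?mulr_ge0//;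
  exact: ler_pM.
Qed.

(** The cut-off fields have the original field as pointwise limit. *)
Lemma chi_pair_cvg x t (e f : R) :
  (fun n => chi' n.+1%:R x * chi n.+1%:R t * e + chi n.+1%:R x * chi n.+1%:R t * f)
    @ \oo --> f.
Proof.
rewrite -[X in _ --> X](_ : 0 * 1 * e + 1 * 1 * f = f); last by ring.
by apply: cvgD; (apply: cvgM; last exact: cvg_cst); apply: cvgM;
  (exact: chi_cvg || exact: chi'_cvg).
Qed.

Lemma chi_pair_cvg' x t (e f : R) :
  (fun n => chi n.+1%:R x * chi' n.+1%:R t * e + chi n.+1%:R x * chi n.+1%:R t * f)
    @ \oo --> f.
Proof.
rewrite -[X in _ --> X](_ : 1 * 0 * e + 1 * 1 * f = f); last by ring.
by apply: cvgD; (apply: cvgM; last exact: cvg_cst); apply: cvgM;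
  (exact: chi_cvg || exact: chi'_cvg).
Qed.

Lemma dominated_decay : dominated (@decay R).
Proof.
split; first exact: measurable_decay.
by exists 1 => x t _; rewrite mul1r gtr0_norm// decay_gt0.
Qed.

(** The cutoffs are removed by dominated convergence, with the squares of the
    decay and of H as dominating functions; on the line, integrability of the
    trace against the square of the decay is assumed. *)
Lemma flux_identity b (bm bp K : R) u ux ut uxt v vx vt vxt (w h : R * R -> R)
    (H : R * R -> R * R) :
  kinkcoef b bm bp -> C2 u ux ut uxt -> C2 v vx vt vxt ->
  (forall t, 0 < t -> v 0 t = 0) -> (forall t, 0 < t -> vt 0 t = 0) ->
  (forall x, `|kink b u v x 0| <= K * decay x 0 ^+ 2) ->
  (forall x, `|kink b ux vx x 0| <= K * decay x 0 ^+ 2) ->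
  weak_grad upper w H -> finite_energy H -> trace (fun=> 0) w H h ->
  mu.-integrable setT (fun x => (decay x 0 ^+ 2 * h (x, 0))%:E) ->
  (\int[mu2]_(X in upper) (kink b ut vt X.1 X.2 * (H X).1 -
      kink b ux vx X.1 X.2 * (H X).2)%:E =
   \int[mu]_x (kink b ux vx x 0 * h (x, 0))%:E)%E.
Proof.
move=> hb hu hv v0 vt0 line linex wg fe tr hi.
have mh : measurable_fun setT (fun x => h (x, 0)) by have [+ _] := tr.
have [m1 m2 _] := fe.
set L : R := 4 * expR 1.
have hc n : cutoff (chi n.+1%:R) (chi' n.+1%:R) L by apply: cutoff_chi; rewrite ler1n.
pose zt n := cutt (chi n.+1%:R) (chi n.+1%:R) (chi' n.+1%:R) (kink b u v) (kink b ut vt).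
pose zx n := cutx (chi n.+1%:R) (chi' n.+1%:R) (chi n.+1%:R) (kink b u v) (kink b ux vx).
have pz : dominated (kink b u v).
  by apply: dominated_kink hb _ _; [exact: C1x_ptame (C2_x hu)|exact: C1x_ptame (C2_x hv)].
have pzt : dominated (kink b ut vt).
  by apply: dominated_kink hb _ _; [exact: C1x_ptame (C2_tx hu)|exact: C1x_ptame (C2_tx hv)].
have pzx : dominated (kink b ux vx).
  by apply: dominated_kink hb _ _; [exact: C1t_ptame (C2_xt hu)|exact: C1t_ptame (C2_xt hv)].
have [_ [K0 hK0]] := pz; have [_ [K1 hK1]] := pzt; have [_ [K2 hK2]] := pzx.
have pznt n : dominated (zt n).
  have [m m'] := cutoff_measurable (hc n).
  apply: dominatedD; first exact: (dominated_cut m m' (cutoff_bound (hc n)) (cutoff_bound' (hc n)) pz).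
  exact: (dominated_cut m m (cutoff_bound (hc n)) (cutoff_bound (hc n)) pzt).
have pznx n : dominated (zx n).
  have [m m'] := cutoff_measurable (hc n).
  apply: dominatedD; first exact: (dominated_cut m' m (cutoff_bound' (hc n)) (cutoff_bound (hc n)) pz).
  exact: (dominated_cut m m (cutoff_bound (hc n)) (cutoff_bound (hc n)) pzx).
have chi0 n x : n.+1%:R <= `|x| -> chi n.+1%:R x = 0 /\ chi' n.+1%:R x = 0 :> R.
  move=> nx; have n0 : (0 : R) < n.+1%:R by [].
  split; first exact: chi_eq0.
  have := chi_eq0 n0 nx; rewrite /chi' /chi /flat => /eqP.
  rewrite mulf_eq0 gt_eqF ?expR_gt0//=; case: ifP => [_|_ _].
    by rewrite mulf_eq0 expr0 oner_eq0 gt_eqF ?expR_gt0.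
  by rewrite mulr0 mul0r.
have E n : (\int[mu2]_(X in upper) (zt n X.1 X.2 * (H X).1 - zx n X.1 X.2 * (H X).2)%:E =
   \int[mu]_x (zx n x 0 * h (x, 0))%:E)%E.
  apply: (@flux_identity_compact _ _ _ w H h n.+1%:R) => //.
  - move=> x t [] /chi0[e1 e2]; rewrite /zt /zx /cutt /cutx e1 e2;
      by rewrite !(mul0r, mulr0, addr0).
  - move=> F M B cF.
    have [uxt' [h1 h2]] := C2_cut (hc n) (hc n) hu.
    have [vxt' [k1 k2]] := C2_cut (hc n) (hc n) hv.
    have := green_flux cF hb h1 h2 k1 k2; rewrite kink_cutt kink_cutx; apply.
    by move=> t t0; rewrite /cutt v0// vt0// !mulr0 addr0.
pose M1 := `|L ^+ 2 * (K0 + K1)|; pose M2 := `|L ^+ 2 * (K0 + K2)|.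
have bt n x t : 0 <= t -> `|zt n x t| <= M1 * decay x t.
  move=> t0; have := cut_le (cutoff_bound (hc n) x) (cutoff_bound' (hc n) t)
    (cutoff_bound (hc n) x) (cutoff_bound (hc n) t) (hK0 x t t0) (hK1 x t t0).
  by move/le_trans; apply; rewrite ler_wpM2r ?ler_norm// ltW// decay_gt0.
have bx n x t : 0 <= t -> `|zx n x t| <= M2 * decay x t.
  move=> t0; have := cut_le (cutoff_bound' (hc n) x) (cutoff_bound (hc n) t)
    (cutoff_bound (hc n) x) (cutoff_bound (hc n) t) (hK0 x t t0) (hK2 x t t0).
  by move/le_trans; apply; rewrite ler_wpM2r ?ler_norm// ltW// decay_gt0.
have L1 : (fun n => \int[mu2]_(X in upper)
    (zt n X.1 X.2 * (H X).1 - zx n X.1 X.2 * (H X).2)%:E)%E @ \oo -->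
  (\int[mu2]_(X in upper) (kink b ut vt X.1 X.2 * (H X).1 -
      kink b ux vx X.1 X.2 * (H X).2)%:E)%E.
  apply: (@dominated_cvg _ _ R mu2 _ measurable_upper _ _
    (fun X => (M1%:E * ((decay X.1 X.2 ^+ 2)%:E + ((H X).1 ^+ 2)%:E) +
               M2%:E * ((decay X.1 X.2 ^+ 2)%:E + ((H X).2 ^+ 2)%:E))%E)).
  - by move=> n; have /measurable_int := finite_energy_pairing (pznt n) (pznx n) fe.
  - move=> [x t] _; apply/cvg_EFin; first by near=> n.
    apply: cvgB; (apply: cvgM; last exact: cvg_cst).
    + exact: chi_pair_cvg'.
    + exact: chi_pair_cvg.
  - by [].
  - have i0 := dominated_integrable (dominated_sq dominated_decay).
    apply: integrableD; first exact: measurable_upper.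
    + apply: integrableZl; first exact: measurable_upper.
      by apply: integrableD => //; [exact: measurable_upper|exact: (finite_energy_sq false fe)].
    + apply: integrableZl; first exact: measurable_upper.
      by apply: integrableD => //; [exact: measurable_upper|exact: (finite_energy_sq true fe)].
  - move=> n [x t] t0; rewrite -!EFinD lee_fin /=.
    rewrite (le_trans (ler_normB _ _))// lerD// normrM.
    + rewrite (le_trans (ler_wpM2r (normr_ge0 _) (bt n x t (ltW t0))))//.
      rewrite -mulrA ler_wpM2l ?normr_ge0// -[X in X * _]gtr0_norm ?decay_gt0//.
      by rewrite -normrM le_sq_sum.
    + rewrite (le_trans (ler_wpM2r (normr_ge0 _) (bx n x t (ltW t0))))//.
      rewrite -mulrA ler_wpM2l ?normr_ge0// -[X in X * _]gtr0_norm ?decay_gt0//.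
      by rewrite -normrM le_sq_sum.
have mz0 z : dominated z -> measurable_fun setT (fun x => z x 0).
  by move=> [m _]; exact: measurable_section_x m.
have L2 : (fun n => \int[mu]_x (zx n x 0 * h (x, 0))%:E)%E @ \oo -->
    (\int[mu]_x (kink b ux vx x 0 * h (x, 0))%:E)%E.
  apply: (@dominated_cvg _ _ R mu setT measurableT _ _
    (fun x => (`|L ^+ 2 * (K + K)|%:E * `|(decay x 0 ^+ 2 * h (x, 0))%:E|)%E)).
  - by move=> n; apply/measurable_EFinP; apply: measurable_funM => //; exact: mz0.
  - move=> x _; apply/cvg_EFin; first by near=> n.
    by apply: cvgM; [exact: chi_pair_cvg|exact: cvg_cst].
  - by [].
  - by apply: integrableZl => //; exact: integrable_abse.
  - move=> n x _; rewrite -EFinM lee_fin [`|zx n x 0 * _|]normrM.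
    rewrite [`|decay x 0 ^+ 2 * _|]normrM mulrA ler_wpM2r//.
    have := cut_le (cutoff_bound' (hc n) x) (cutoff_bound (hc n) 0)
      (cutoff_bound (hc n) x) (cutoff_bound (hc n) 0) (line x) (linex x).
    move/le_trans; apply; rewrite (ger0_norm (sqr_ge0 (decay x 0))).
    by rewrite ler_wpM2r ?ler_norm// sqr_ge0.
rewrite (funext E : (fun n => _) = _) in L1.
exact: (cvg_unique _ L1 L2).
Unshelve. all: by end_near. Qed.

End FluxOfProfile.

(** * A Lipschitz substitute for the absolute value, and a weight *)

Section TraceGrowth.
Context {R : realType}.
Notation mu := (@lebesgue_measure R).
Notation mu2 := (@lebesgue_measure R \x @lebesgue_measure R)%E.
Implicit Types (F v h : R * R -> R) (H : R * R -> R * R) (x t y : R).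

(** A C^1 function that differs from the absolute value by at most 1, so that it
    can be composed with test functions. *)
Definition softabs y : R := Num.sqrt (1 + y ^+ 2) - 1.

Lemma oneDsq_gt0 y : 0 < 1 + y ^+ 2.
Proof. by rewrite ltr_pwDl ?sqr_ge0. Qed.

Lemma softabs_le y : 0 <= softabs y <= `|y|.
Proof.
have s0 := sqrtr_ge0 (1 + y ^+ 2); have e := sqr_sqrtr (ltW (oneDsq_gt0 y)).
have ny := normr_ge0 y; have e2 := real_normK (num_real y).
by rewrite /softabs; apply/andP; split; nra.
Qed.

Lemma norm_le_softabs y : `|y| <= softabs y + 1.
Proof. by rewrite subrK -[leLHS]sqrtr_sqr; apply: ler_wsqrtr; rewrite lerDr. Qed.

Lemma is_derive_softabs y : is_derive y 1 softabs (y / Num.sqrt (1 + y ^+ 2)).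
Proof.
have h1 : is_derive y 1 (fun z => 1 + z ^+ 2) (2 * y).
  by have := is_derive_sqD y 1; under eq_fun do rewrite addrC.
have h2 := @is_derive1_comp _ (@Num.sqrt R) (fun z => 1 + z ^+ 2) y _ _
  (is_derive1_sqrt (oneDsq_gt0 y)) h1.
apply: is_derive_eq (is_deriveB h2 (is_derive_cst (1 : R) y 1)) _.
by rewrite subr0; field; rewrite gt_eqF// sqrtr_gt0 oneDsq_gt0.
Qed.

Lemma softabs'_le y : `|y / Num.sqrt (1 + y ^+ 2)| <= 1.
Proof.
have s0 : 0 < Num.sqrt (1 + y ^+ 2) by rewrite sqrtr_gt0 oneDsq_gt0.
rewrite normrM normfV (gtr0_norm s0) ler_pdivrMr// mul1r -[leLHS]sqrtr_sqr.
by apply: ler_wsqrtr; rewrite lerDr.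
Qed.

Lemma pd_softabs F M B i X : ctest F M B ->
  is_derive X (dir i) (fun Y => softabs (F Y))
    (F X / Num.sqrt (1 + F X ^+ 2) * pd i F X).
Proof.
move=> cF; apply: is_derive_pd_comp; first exact: is_derive_softabs.
apply/is_derive_pd; case: X => x t; case: i => /=;
  [exact: ctest_dt cF _ _|exact: ctest_dx cF _ _].
Qed.

Lemma ctest_softabs F M B : ctest F M B -> ctest (fun X => softabs (F X)) M B.
Proof.
move=> cF; have cs : continuous softabs.
  by move=> y; exact: is_derive1_continuous (is_derive_softabs y).
have pE i : pd i (fun X => softabs (F X)) =
    fun X => F X / Num.sqrt (1 + F X ^+ 2) * pd i F X.
  by apply/funext => X; have [_] := pd_softabs i X cF.
split.
- by move=> x t; rewrite pE; have /is_derive_pdx := pd_softabs false (x, t) cF.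
- by move=> x t; rewrite pE; have /is_derive_pdt := pd_softabs true (x, t) cF.
- by move=> X; apply: continuous_comp_at; [exact: (ctest_continuous cF)|exact: cs].
- move=> i X; rewrite pE; have cFX : {for X, continuous F} by exact: (ctest_continuous cF).
  apply: cvgM; last exact: (@ctest_continuous_pd _ _ _ _ cF i X).
  apply: cvgM => //; apply: cvgV; first by rewrite gt_eqF// sqrtr_gt0 oneDsq_gt0.
  apply: (continuous_comp_at (f := fun Y => 1 + F Y ^+ 2)); last exact: sqrt_continuous.
  by apply: cvgD; [exact: cvg_cst|apply: (cvgM cFX cFX)].
- move=> x t h; rewrite (ctest_support cF h) /softabs expr0n addr0 sqrtr1 subrr//.
- move=> X; have /andP[h0 h1] := softabs_le (F X).
  by rewrite ger0_norm// (le_trans h1)// (ctest_bound cF).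
- move=> i X; rewrite pE normrM (le_trans _ (ctest_bound_pd cF i X))//.
  by rewrite ler_piMl// softabs'_le.
Qed.

Lemma dominated_compact (z : R -> R -> R) (B N : R) :
  measurable_fun setT (fun X : R * R => z X.1 X.2) -> (forall x t, `|z x t| <= B) ->
  (forall x t, N <= `|x| \/ N <= `|t| -> z x t = 0) -> dominated z.
Proof.
move=> mz zB z0; split => //; exists (B / decay N N) => x t _.
have [xN|xN] := leP N `|x|.
  rewrite z0 ?normr0; last by left.
  by rewrite mulr_ge0 ?divr_ge0 ?(le_trans _ (zB 0 0)) ?normr_ge0// ltW// decay_gt0.
have [tN|tN] := leP N `|t|.
  rewrite z0 ?normr0; last by right.
  by rewrite mulr_ge0 ?divr_ge0 ?(le_trans _ (zB 0 0)) ?normr_ge0// ltW// decay_gt0.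
rewrite (le_trans (zB x t))// mulrAC ler_pdivlMr ?decay_gt0//.
rewrite ler_wpM2l ?(le_trans _ (zB 0 0))//.
have N0 : 0 <= N by rewrite (le_trans _ (ltW xN)).
have hx : x ^+ 2 <= N ^+ 2 by rewrite -real_normK ?num_real// ler_sqr ?nnegrE// ltW.
have ht : t ^+ 2 <= N ^+ 2 by rewrite -real_normK ?num_real// ler_sqr ?nnegrE// ltW.
rewrite /decay lef_pV2 ?posrE ?mulr_gt0 ?oneDsq_gt0//.
by apply: ler_pM; rewrite ?lerD2l// addr_ge0 ?sqr_ge0.
Qed.

Definition weight x : R := (1 + x ^+ 2) ^- 2.
(** The derivative psi' is at least the weight outside of a bounded interval,
    while psi and psi' decay like 1/(1 + x^2). *)
Definition psi x : R := - x * weight x.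
Definition psi' x : R := weight x * (3 - 4 / (1 + x ^+ 2)).

Lemma weight_gt0 x : 0 < weight x.
Proof. by rewrite invr_gt0 exprn_gt0// oneDsq_gt0. Qed.

Lemma weightE x : weight x = decay x 0 ^+ 2.
Proof. by rewrite /weight /decay expr0n addr0 mulr1 exprVn. Qed.

Lemma is_derive_psi x : is_derive x 1 psi (psi' x).
Proof.
have p := oneDsq_gt0 x; have pn : (1 + x ^+ 2) ^+ 2 != 0 by rewrite expf_neq0 ?gt_eqF.
have h1 : is_derive x 1 (fun z => 1 + z ^+ 2) (2 * x).
  by have := is_derive_sqD x 1; under eq_fun do rewrite addrC.
have h2 : is_derive x 1 weight (- ((1 + x ^+ 2) ^+ 2) ^- 2 * (2 * (1 + x ^+ 2) * (2 * x))).
  have h3 : is_derive x 1 (fun z => (1 + z ^+ 2) ^+ 2) (2 * (1 + x ^+ 2) * (2 * x)).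
    have h4 := is_deriveM h1 h1; apply: is_derive_eq h4 _.
    by rewrite /GRing.scale /=; ring.
  exact: (@is_deriveV _ (fun z => (1 + z ^+ 2) ^+ 2) _ _ _ pn h3).
apply: is_derive_eq (is_deriveM (is_deriveNid x 1) h2) _.
by rewrite /GRing.scale /= /psi' /weight; field; rewrite gt_eqF.
Qed.

Lemma psi'_lower x : weight x - 2 * \1_`[- 2, 2] x <= psi' x.
Proof.
have p := oneDsq_gt0 x; have o0 := weight_gt0 x.
have o1 : weight x <= 1 by rewrite invf_le1 ?exprn_gt0// exprn_ege1// lerDl sqr_ge0.
have q0 : 0 < (1 + x ^+ 2)^-1 by rewrite invr_gt0.
rewrite /psi' indicE; have [xi|xi] := boolP (_ \in _).
  have q1 : (1 + x ^+ 2)^-1 <= 1 by rewrite invf_le1// lerDl sqr_ge0.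
  by rewrite mulr1; nra.
rewrite mulr0 subr0; have q1 : (1 + x ^+ 2)^-1 <= 2^-1.
  rewrite lef_pV2 ?posrE//; move: xi; rewrite notin_setE/= in_itv/= => /negP.
  by rewrite negb_and -!ltNge => /orP[]; nra.
by rewrite -{1}[weight x]mulr1 ler_wpM2l ?(ltW o0)//; lra.
Qed.

Lemma psi_le x : `|psi x| <= (1 + x ^+ 2)^-1.
Proof.
have p := oneDsq_gt0 x.
rewrite normrM normrN (gtr0_norm (weight_gt0 x)) /weight expr2 invfM mulrA.
rewrite ler_piMl ?invr_ge0 ?(ltW p)// ler_pdivrMr// mul1r.
have := real_normK (num_real x); have := normr_ge0 x; nra.
Qed.

Lemma psi'_le x : `|psi' x| <= 3 * (1 + x ^+ 2)^-1.
Proof.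
have p := oneDsq_gt0 x; have q0 : 0 < (1 + x ^+ 2)^-1 by rewrite invr_gt0.
have q1 : (1 + x ^+ 2)^-1 <= 1 by rewrite invf_le1// lerDl sqr_ge0.
rewrite /psi' normrM (gtr0_norm (weight_gt0 x)) /weight -exprVn expr2.
have : `|3 - 4 / (1 + x ^+ 2)| <= 3 by rewrite ler_norml; apply/andP; split; lra.
set d := `|_|; have := normr_ge0 (3 - 4 / (1 + x ^+ 2)); rewrite -/d.
by nra.
Qed.

Lemma psi'_continuous : continuous psi'.
Proof.
move=> x; have p := oneDsq_gt0 x.
have c1 : {for x, continuous (fun z : R => 1 + z ^+ 2)}.
  by apply: cvgD; [exact: cvg_cst|exact: exprn_continuous].
have cV : {for x, continuous (fun z : R => (1 + z ^+ 2)^-1)}.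
  by apply: cvgV => //; rewrite gt_eqF.
apply: cvgM.
  apply: cvgV; first by rewrite gt_eqF// exprn_gt0.
  exact: (cvgM c1 c1).
by apply: cvgB; [exact: cvg_cst|apply: cvgM; [exact: cvg_cst|exact: cV]].
Qed.

End TraceGrowth.

(** * A field with positive flux *)

Section TraceIntegrable.
Context {R : realType}.
Notation mu := (@lebesgue_measure R).
Notation mu2 := (@lebesgue_measure R \x @lebesgue_measure R)%E.
Implicit Types (F v h : R * R -> R) (H : R * R -> R * R) (x t y : R).

Let L : R := 4 * expR 1.

Lemma chi1_0 : chi 1 0 = 1 :> R.
Proof.
by rewrite /chi mul0r expr0n subr0 /flat ltr01 expr0 mul1r invr1 -expRD subrr expR0.
Qed.

Lemma chi'_eq0 (N x : R) : 0 < N -> N <= `|x| -> chi' N x = 0.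
Proof.
move=> N0 Nx; have := chi_eq0 N0 Nx; rewrite /chi' /chi /flat => /eqP.
rewrite mulf_eq0 gt_eqF ?expR_gt0//=; case: ifP => [_|_ _].
  by rewrite mulf_eq0 expr0 oner_eq0 gt_eqF ?expR_gt0.
by rewrite mulr0 mul0r.
Qed.

Lemma supported1_le (r : R -> R) (B t : R) : 0 <= B -> (forall s, `|r s| <= B) ->
  (forall s, 1 <= `|s| -> r s = 0) -> `|r t| <= 2 * B * (1 + t ^+ 2)^-1.
Proof.
move=> B0 rB r0; have p := oneDsq_gt0 t.
have [t1|t1] := leP 1 `|t|.
  by rewrite r0// normr0 mulr_ge0 ?mulr_ge0// invr_ge0 ltW.
rewrite (le_trans (rB t))// mulrAC ler_peMl// ler_pdivlMr// mul1r.
have := real_normK (num_real t); have := normr_ge0 t; nra.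
Qed.

(** The flux through the line of the field that bounds the growth of a trace; it
    exceeds the weight up to a bounded interval. *)
Definition weight_flux (N x : R) : R := chi' N x * psi x + chi N x * psi' x.

Lemma weight_flux_lower (N x : R) : 1 <= N ->
  chi N x * weight x - 2 * expR 1 * \1_`[- 2, 2] x <= weight_flux N x.
Proof.
move=> N1; have /andP[c0 c1] := chi_le N x.
have h : 0 <= chi' N x * psi x.
  rewrite /chi' /psi; have f0 := flat_ge0 2 (1 - (x / N) ^+ 2).
  have -> : expR 1 * flat 2 (1 - (x / N) ^+ 2) * (- 2 * x / N ^+ 2) * (- x * weight x) =
    (expR 1 * flat 2 (1 - (x / N) ^+ 2)) * (2 * (x ^+ 2 * N ^- 2 * weight x)).
    by field; rewrite gt_eqF// (lt_le_trans _ N1).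
  have := weight_gt0 x => /ltW o0.
  apply: mulr_ge0; first exact: mulr_ge0 (expR_ge0 _) f0.
  by apply: mulr_ge0 => //; apply: mulr_ge0 => //; apply: divr_ge0; exact: sqr_ge0.
have h2 := ler_wpM2l c0 (psi'_lower x).
have i0 : 0 <= \1_`[- 2, 2] x :> R by rewrite indicE.
by rewrite /weight_flux; nra.
Qed.

Lemma cutoff_psi (N : R) : 1 <= N ->
  cutoff (fun x => chi N x * psi x) (weight_flux N) (2 * L) /\
  (forall x, `|chi N x * psi x| <= 2 * L * (1 + x ^+ 2)^-1) /\
  (forall x, `|weight_flux N x| <= 2 * L * (1 + x ^+ 2)^-1).
Proof.
move=> N1; have N0 : 0 < N by rewrite (lt_le_trans _ N1).
have e0 := expR_gt0 (1 : R); have hc := cutoff_chi N1.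
have h1 x : `|chi N x * psi x| <= 2 * L * (1 + x ^+ 2)^-1.
  have p := oneDsq_gt0 x; have q0 : 0 <= (1 + x ^+ 2)^-1 by rewrite invr_ge0 ltW.
  have L0 : 0 <= L by rewrite mulr_ge0// ltW.
  have b1 : `|chi N x| * `|psi x| <= L * (1 + x ^+ 2)^-1.
    by apply: ler_pM => //; [exact: cutoff_bound hc x|exact: psi_le].
  rewrite normrM (le_trans b1)// -mulrA ler_peMl ?mulr_ge0//.
  by rewrite ler1n.
have h2 x : `|weight_flux N x| <= 2 * L * (1 + x ^+ 2)^-1.
  have p := oneDsq_gt0 x; have q0 : 0 < (1 + x ^+ 2)^-1 by rewrite invr_gt0.
  have a1 : `|chi' N x| <= L by exact: cutoff_bound' hc x.
  have a2 := psi_le x; have /andP[c0 c1] := chi_le N x; have a4 := psi'_le x.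
  rewrite (le_trans (ler_normD _ _))// (normrM (chi' N x)) (normrM (chi N x)).
  rewrite (ger0_norm c0).
  have b1 : `|chi' N x| * `|psi x| <= L * (1 + x ^+ 2)^-1 by apply: ler_pM.
  have b2 : chi N x * `|psi' x| <= expR 1 * (3 * (1 + x ^+ 2)^-1) by apply: ler_pM.
  by rewrite /L in b1 *; nra.
have q1 x : 2 * L * (1 + x ^+ 2)^-1 <= 2 * L.
  rewrite ler_piMr ?mulr_ge0 ?expR_ge0// invf_le1 ?oneDsq_gt0//.
  by rewrite lerDl sqr_ge0.
split; last by split.
split.
- move=> x; apply: is_derive_eq (is_deriveM (is_derive_chi N x) (is_derive_psi x)) _.
  by rewrite /GRing.scale /= /weight_flux; ring.
- move=> x; apply: cvgD; apply: cvgM.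
  + exact: chi'_continuous.
  + exact: is_derive1_continuous (is_derive_psi x).
  + exact: is_derive1_continuous (is_derive_chi N x).
  + exact: psi'_continuous.
- by move=> x; exact: le_trans (h1 x) (q1 x).
- by move=> x; exact: le_trans (h2 x) (q1 x).
Qed.

Lemma C1x_separated p (p' : R -> R) (r : R -> R) (B N : R) : cutoff p p' B ->
  measurable_fun setT r -> (forall t, `|r t| <= B) ->
  (forall x, N <= `|x| -> p x = 0 /\ p' x = 0) -> (forall t, N <= `|t| -> r t = 0) ->
  C1x (fun x t => p x * r t) (fun x t => p' x * r t).
Proof.
move=> hp mr rB p0 r0; have [mp mp'] := cutoff_measurable hp.
have pt (q : R -> R) : measurable_fun setT q -> (forall x, `|q x| <= B) ->
    (forall x, N <= `|x| -> q x = 0) -> dominated (fun x t => q x * r t).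
  move=> mq qB q0; apply: (@dominated_compact _ _ (B * B) N).
  - apply: measurable_funM; first exact: (plane_measurable_comp mq measurable_fst).
    exact: (plane_measurable_comp mr measurable_snd).
  - by move=> x t; rewrite normrM ler_pM.
  - by move=> x t [/q0 ->|/r0 ->]; rewrite ?mul0r ?mulr0.
split.
- move=> x t _; have := is_deriveZ (r t) (cutoff_derive hp x).
  by rewrite /GRing.scale /= mulrC; under eq_fun do rewrite mulrC.
- by move=> x t _; apply: cvgM; [exact: cutoff_continuous hp x|exact: cvg_cst].
- by apply: pt => //; [exact: cutoff_bound hp|move=> x /p0[]].
- by apply: pt => //; [exact: cutoff_bound' hp|move=> x /p0[]].
Qed.

Lemma C1t_separated (p r : R -> R) (r' : R -> R) (B N : R) : cutoff r r' B ->
  measurable_fun setT p -> (forall t, `|p t| <= B) ->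
  (forall t, N <= `|t| -> r t = 0 /\ r' t = 0) -> (forall x, N <= `|x| -> p x = 0) ->
  C1t (fun x t => p x * r t) (fun x t => p x * r' t).
Proof.
move=> hr mp pB r0 p0; have [mr mr'] := cutoff_measurable hr.
have pt (q : R -> R) : measurable_fun setT q -> (forall x, `|q x| <= B) ->
    (forall x, N <= `|x| -> q x = 0) -> dominated (fun x t => p x * q t).
  move=> mq qB q0; apply: (@dominated_compact _ _ (B * B) N).
  - apply: measurable_funM; first exact: (plane_measurable_comp mp measurable_fst).
    exact: (plane_measurable_comp mq measurable_snd).
  - by move=> x t; rewrite normrM ler_pM.
  - by move=> x t [/p0 ->|/q0 ->]; rewrite ?mul0r ?mulr0.
split.
- by move=> x t _; exact: (is_deriveZ (p x) (cutoff_derive hr t)).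
- by move=> x t _; apply: cvgM; [exact: cvg_cst|exact: cutoff_continuous hr t].
- by apply: pt => //; [exact: cutoff_bound hr|move=> x /r0[]].
- by apply: pt => //; [exact: cutoff_bound' hr|move=> x /r0[]].
Qed.

Lemma kinkcoef0 : kinkcoef (fun=> 0 : R) 0 0.
Proof. by split. Qed.

Lemma C1x0 : C1x (fun _ _ : R => 0) (fun _ _ => 0).
Proof.
have p0 : dominated (fun _ _ : R => 0).
  by split => //; exists 0 => x t _; rewrite normr0 mul0r.
split => // x t _; first exact: is_derive_cst.
exact: cvg_cst.
Qed.

Lemma C1t0 : C1t (fun _ _ : R => 0) (fun _ _ => 0).
Proof.
have p0 : dominated (fun _ _ : R => 0).
  by split => //; exists 0 => x t _; rewrite normr0 mul0r.
split => // x t _; first exact: is_derive_cst.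
exact: cvg_cst.
Qed.

(** Green's identity for the field that derives from chi psi(x) chi(t), whose flux
    through the line is the weight_flux. *)
Lemma green_growth F M B (N : R) : 1 <= N -> ctest F M B ->
  (\int[mu2]_(X in upper) (chi N X.1 * psi X.1 * chi' 1 X.2 * pd false F X -
     weight_flux N X.1 * chi 1 X.2 * pd true F X)%:E =
   \int[mu]_x (weight_flux N x * F (x, 0))%:E)%E.
Proof.
move=> N1 cF; have [hp _] := cutoff_psi N1.
have N0 : 0 < N by rewrite (lt_le_trans _ N1).
have e0 := expR_gt0 (1 : R).
have hr : cutoff (@chi R 1) (chi' 1) (2 * L).
  have [? ? h1 h2] := cutoff_chi (lexx (1 : R)); split => // x.
    by rewrite (le_trans (h1 x))// /L; lra.
  by rewrite (le_trans (h2 x))// /L; lra.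
have [mp mp'] := cutoff_measurable hp; have [mr mr'] := cutoff_measurable hr.
have p0 x : N <= `|x| -> chi N x * psi x = 0 /\ weight_flux N x = 0.
  by move=> xN; rewrite /weight_flux chi'_eq0// chi_eq0// !mul0r addr0.
have r0 t : N <= `|t| -> chi 1 t = 0 /\ chi' 1 t = 0.
  by move=> tN; rewrite chi_eq0 ?chi'_eq0// (le_trans N1).
have h1 := C1x_separated hp mr' (cutoff_bound' hr) p0 (fun t e => (r0 t e).2).
have h2 := C1t_separated hr mp' (cutoff_bound' hp) r0 (fun t e => (p0 t e).2).
have := green_flux cF kinkcoef0 h1 h2 C1x0 C1t0 (fun t _ => erefl).
under eq_integral do rewrite /kink !mul0r !addr0.
by under [RHS]eq_integral do rewrite /kink !mul0r !addr0 chi1_0 mulr1.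
Qed.

End TraceIntegrable.

(** * Growth of traces of functions of finite energy *)

Section TraceWeighted.
Context {R : realType}.
Notation mu := (@lebesgue_measure R).
Notation mu2 := (@lebesgue_measure R \x @lebesgue_measure R)%E.
Implicit Types (F v h : R * R -> R) (H : R * R -> R * R) (x t y : R).

Let L : R := 4 * expR 1.

Lemma softabs_lip y z : softabs y <= softabs z + `|y - z|.
Proof.
have s0 := sqrtr_ge0 (1 + y ^+ 2); have e := sqr_sqrtr (ltW (oneDsq_gt0 y)).
have s1 := sqrtr_ge0 (1 + z ^+ 2); have e1 := sqr_sqrtr (ltW (oneDsq_gt0 z)).
have n0 := normr_ge0 (y - z); have e2 := real_normK (num_real (y - z)).
have zz : `|z| <= Num.sqrt (1 + z ^+ 2).
  by rewrite -[leLHS]sqrtr_sqr; apply: ler_wsqrtr; rewrite lerDr.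
have hz : (y - z) * z <= `|y - z| * Num.sqrt (1 + z ^+ 2).
  by rewrite (le_trans (ler_norm _))// normrM ler_wpM2l.
rewrite /softabs addrAC lerD2r.
rewrite -(ler_pXn2r (n := 2)) ?nnegrE ?addr_ge0// e sqrrD e1 e2; nra.
Qed.

(** The pointwise inequality behind the growth bound: the weight c o exceeds the
    flux w by 2 e i at most, and y is compared with its approximant z. *)
Lemma weighted_softabs_le (c e o i w y z : R) : 0 <= c -> c <= e -> 0 <= o ->
  0 <= i -> c * o - 2 * e * i <= w ->
  c * o * `|y| <= e * o + 2 * e * (i * `|y|) + w * softabs z + `|w| * `|z - y|.
Proof.
move=> c0 ce o0 i0 wl; have hs := norm_le_softabs y; have /andP[s0 s1] := softabs_le y.
have q1 : w * (softabs y - softabs z) <= `|w| * `|z - y|.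
  rewrite (le_trans (ler_norm _))// normrM ler_wpM2l// ler_norml.
  have l1 := softabs_lip y z; have l2 := softabs_lip z y; rewrite distrC in l1.
  by apply/andP; split; clear -l1 l2; lra.
have co : 0 <= c * o by exact: mulr_ge0.
have q2 := ler_wpM2l co hs; have q3 := ler_wpM2r s0 wl.
have q4 : c * o <= e * o by exact: ler_wpM2r.
have ei : 0 <= 2 * e * i by rewrite !mulr_ge0// (le_trans c0).
have q5 := ler_wpM2l ei s1.
by clear -q1 q2 q3 q4 q5; lra.
Qed.

Lemma chi_cutoff1 : cutoff (@chi R 1) (chi' 1) L.
Proof. exact: cutoff_chi. Qed.

Definition growth_t (N x t : R) : R := chi N x * psi x * chi' 1 t.
Definition growth_x (N x t : R) : R := weight_flux N x * chi 1 t.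

(** The bounds do not depend on N. *)
Lemma growth_fields (N : R) : 1 <= N ->
  [/\ dominated (growth_t N), dominated (growth_x N),
   (forall x t, N <= `|x| \/ N <= `|t| -> growth_t N x t = 0 /\ growth_x N x t = 0) &
   (forall x t, `|growth_t N x t| <= 4 * L ^+ 2 * decay x t /\
      `|growth_x N x t| <= 4 * L ^+ 2 * decay x t)].
Proof.
move=> N1; have N0 : 0 < N by rewrite (lt_le_trans _ N1).
have [hp [b1 b2]] := cutoff_psi N1; have hr := chi_cutoff1.
have [mp mp'] := cutoff_measurable hp; have [mr mr'] := cutoff_measurable hr.
have L0 : 0 <= L by rewrite mulr_ge0// expR_ge0.
have q0 x : 0 <= (1 + x ^+ 2)^-1 by rewrite invr_ge0 ltW// oneDsq_gt0.
have r1 t : `|chi 1 t| <= 2 * L * (1 + t ^+ 2)^-1.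
  by apply: supported1_le => //; [exact: cutoff_bound hr|move=> s; exact: chi_eq0].
have r2 t : `|chi' 1 t| <= 2 * L * (1 + t ^+ 2)^-1.
  by apply: supported1_le => //; [exact: cutoff_bound' hr|move=> s; exact: chi'_eq0].
have E x t : 4 * L ^+ 2 * decay x t =
    2 * L * (1 + x ^+ 2)^-1 * (2 * L * (1 + t ^+ 2)^-1) by rewrite decayE; ring.
have b x t : `|growth_t N x t| <= 4 * L ^+ 2 * decay x t /\
      `|growth_x N x t| <= 4 * L ^+ 2 * decay x t.
  split; rewrite E.
    by rewrite /growth_t (normrM _ (chi' 1 t)); apply: ler_pM.
  by rewrite /growth_x (normrM (weight_flux N x)); apply: ler_pM.
split => //.
- split; last by exists (4 * L ^+ 2) => x t _; have [] := b x t.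
  apply: measurable_funM; first exact: (plane_measurable_comp mp measurable_fst).
  exact: (plane_measurable_comp mr' measurable_snd).
- split; last by exists (4 * L ^+ 2) => x t _; have [] := b x t.
  apply: measurable_funM; first exact: (plane_measurable_comp mp' measurable_fst).
  exact: (plane_measurable_comp mr measurable_snd).
- move=> x t [xN|tN].
    by rewrite /growth_t /growth_x /weight_flux (chi_eq0 N0 xN) (chi'_eq0 N0 xN) !mul0r addr0 mul0r.
  have t1 : 1 <= `|t| by exact: le_trans tN.
  by rewrite /growth_t /growth_x (chi_eq0 ltr01 t1) (chi'_eq0 ltr01 t1) !mulr0.
Qed.

(** The tensor square of an indicator function, to localize a trace. *)
Lemma dominated_box : dominated (fun x t : R => \1_`[- 2, 2] x * \1_`[- 2, 2] t).
Proof.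
have mI : measurable_fun setT (\1_`[- 2, 2] : R -> R) by exact: measurable_indic.
have i1 x : `|\1_`[- 2, 2] x : R| <= 1.
  by rewrite indicE; case: (_ \in _); rewrite ?normr1// normr0.
have i0 x : 3 <= `|x| -> \1_`[- 2, 2] x = 0 :> R.
  move=> x3; rewrite indicE memNset//= in_itv/= -ler_norml; apply/negP; rewrite -ltNge.
  by rewrite (lt_le_trans _ x3)// ltr_nat.
apply: (@dominated_compact _ _ 1 3).
- apply: measurable_funM; first exact: (plane_measurable_comp mI measurable_fst).
  exact: (plane_measurable_comp mI measurable_snd).
- by move=> x t; rewrite normrM -[leRHS]mulr1 ler_pM.
- by move=> x t [/i0 ->|/i0 ->]; rewrite ?mul0r ?mulr0.
Qed.

(** The energy of the approximant F enters only through that of H, plus errors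
    that vanish in the limit. *)
Lemma ctest_growth_le F M B H (N : R) : 1 <= N -> ctest F M B -> finite_energy H ->
  (\int[mu]_x (weight_flux N x * softabs (F (x, 0)))%:E <=
   \int[mu2]_(X in upper) (`|growth_t N X.1 X.2 * (pd false F X - (H X).1)|)%:E +
   \int[mu2]_(X in upper) (`|growth_x N X.1 X.2 * (pd true F X - (H X).2)|)%:E +
   \int[mu2]_(X in upper) (4 * L ^+ 2 * (2 * decay X.1 X.2 ^+ 2 + enorm (H X) ^+ 2))%:E)%E.
Proof.
move=> N1 cF fe; have [pt px _ bd] := growth_fields N1.
rewrite -(green_growth N1 (ctest_softabs cF)).
have [m1 m2 _] := fe; have cS := ctest_softabs cF.
have mpF i : measurable_fun setT (pd i F).
  exact: plane_continuous_measurable (@ctest_continuous_pd _ _ _ _ cF i).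
have mz (z : R -> R -> R) : dominated z -> measurable_fun upper (fun X => z X.1 X.2).
  by move=> [mz _]; exact: measurable_funTS mz.
have mA : measurable_fun upper (fun X => (`|growth_t N X.1 X.2 * (pd false F X - (H X).1)|)%:E).
  apply/measurable_EFinP; apply: measurableT_comp => //; apply: measurable_funM; first exact: mz.
  by apply: measurable_funB => //; exact: (measurable_funTS (mpF false)).
have mB : measurable_fun upper (fun X => (`|growth_x N X.1 X.2 * (pd true F X - (H X).2)|)%:E).
  apply/measurable_EFinP; apply: measurableT_comp => //; apply: measurable_funM; first exact: mz.
  by apply: measurable_funB => //; exact: (measurable_funTS (mpF true)).
have mC : measurable_fun upper
    (fun X => (4 * L ^+ 2 * (2 * decay X.1 X.2 ^+ 2 + enorm (H X) ^+ 2))%:E).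
  apply/measurable_EFinP; apply: measurable_funM => //; apply: measurable_funD.
    by apply: measurable_funM => //; apply: measurable_funX; exact: (measurable_funTS measurable_decay).
  under eq_fun do rewrite enorm_sq.
  by apply: measurable_funD; exact: measurable_funX.
have C0 X : 0 <= 4 * L ^+ 2 * (2 * decay X.1 X.2 ^+ 2 + enorm (H X) ^+ 2).
  apply: mulr_ge0; first by apply: mulr_ge0 => //; exact: sqr_ge0.
  by apply: addr_ge0; [apply: mulr_ge0 => //|]; exact: sqr_ge0.
have mU := @measurable_upper R.
rewrite -!ge0_integralD//; last 3 first.
- by move=> X _; rewrite adde_ge0// lee_fin.
- exact: emeasurable_funD.
- by move=> X _; rewrite lee_fin C0.
have Si : mu2.-integrable upper (fun X => (growth_t N X.1 X.2 *
    pd false (fun X => softabs (F X)) X -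
    growth_x N X.1 X.2 * pd true (fun X => softabs (F X)) X)%:E).
  by apply: integrable_EFinB; [exact: measurable_upper|
    exact: (ctest_integrableM_pd cS false pt)|exact: (ctest_integrableM_pd cS true px)].
apply: (@le_trans _ _ (\int[mu2]_(X in upper) `|(growth_t N X.1 X.2 * pd false (fun X => softabs (F X)) X -
     growth_x N X.1 X.2 * pd true (fun X => softabs (F X)) X)%:E|)%E).
  apply: le_integral => //.
  - exact: integrable_abse Si.
  - by move=> X _; rewrite lee_fin ler_norm.
apply: ge0_le_integral => //.
- apply: measurableT_comp => //; apply/measurable_EFinP; apply: measurable_funB;
    apply: measurable_funM; try exact: mz; apply: measurable_funTS;
    apply: plane_continuous_measurable; exact: (@ctest_continuous_pd _ _ _ _ cS).
- by apply: emeasurable_funD => //; exact: emeasurable_funD.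
move=> X _; rewrite -!EFinD lee_fin (le_trans (ler_normB _ _))//.
have ps i : `|pd i (fun X => softabs (F X)) X| <= `|pd i F X|.
  have [_] := pd_softabs i X cF; rewrite /pd => ->; rewrite -/(pd i F X).
  by rewrite normrM ler_piMl// softabs'_le.
have [bt bx] := bd X.1 X.2; have d0 := decay_gt0 X.1 X.2.
have st (z d c e : R) : `|z| <= 4 * L ^+ 2 * decay X.1 X.2 -> `|d| <= `|c| ->
    `|z * d| <= `|z * (c - e)| + 4 * L ^+ 2 * (decay X.1 X.2 ^+ 2 + e ^+ 2).
  move=> hz hd; rewrite !normrM; apply: (@le_trans _ _ (`|z| * (`|c - e| + `|e|))).
    rewrite ler_wpM2l// (le_trans hd)//.
    by rewrite -{1}(subrK e c) ler_normD.
  rewrite mulrDr lerD2l; apply: (le_trans (ler_wpM2r (normr_ge0 e) hz)).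
  rewrite -[leLHS]mulrA; apply: ler_wpM2l.
    by apply: mulr_ge0 => //; exact: sqr_ge0.
  by rewrite -{1}(gtr0_norm d0) -normrM le_sq_sum.
have h1 := st _ _ _ ((H X).1) bt (ps false); have h2 := st _ _ _ ((H X).2) bx (ps true).
apply: (le_trans (lerD h1 h2)); rewrite enorm_sq le_eqVlt; apply/orP; left; apply/eqP.
by ring.
Qed.

(** The absolute value is replaced by softabs of an approximant, whose weighted
    integral is a flux and thus controlled by the energy. *)
Lemma trace_growth_le v H h : Wdot (fun=> 0) v H -> trace (fun=> 0) v H h ->
  exists K : R, forall N : R, 1 <= N ->
    (\int[mu]_x (chi N x * weight x * `|h (x, 0)|)%:E <= K%:E)%E.
Proof.
move=> wd tr; have [wg _] := wd; have fe := Wdot_finite_energy wd.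
have mh : measurable_fun setT (fun x => h (x, 0)) by have [+ _] := tr.
have [F [cF cFp cFb]] := trace_approx wg tr.
have [m1 m2 fi] := fe; have mU := @measurable_upper R.
have mFp n i : measurable_fun setT (pd i (F n)).
  have [M [B [_ c]]] := cF n.
  exact: plane_continuous_measurable (@ctest_continuous_pd _ _ _ _ c i).
pose I0 := (\int[mu]_x (`|\1_`[- 2%R, 2%R] x * h (x, 0%R)|)%:E)%E.
have hbox : mu.-integrable setT (fun x => (\1_`[- 2, 2] x * h (x, 0))%:E).
  have b0 x : 3 <= `|x| -> \1_`[- 2, 2] x * \1_`[- 2, 2] (0 : R) = 0 :> R.
    move=> x3; rewrite indicE memNset ?mul0r//= in_itv/= -ler_norml; apply/negP.
    by rewrite -ltNge (lt_le_trans _ x3)// ltr_nat.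
  have [_] := dominated_trace_line (@ltr0Sn R 2) dominated_box b0 cF mh (cFb _ (mulr_gt0 (@ltr0Sn R 1) (@ltr0Sn R 2))).
  apply: eq_integrable => // x _ /=; congr EFin; congr (_ * _).
  by rewrite [X in _ * X]indicE mem_set ?mulr1//= in_itv/= oppr_le0 !ler0n.
pose I1 := (\int[mu]_x (weight x)%:E)%E.
have omi : mu.-integrable setT (fun x => (weight x)%:E).
  have := dominated_integrable_line (dominated_sq (@dominated_decay R)).
  by apply: eq_integrable => // x _; rewrite weightE.
pose I2 := (\int[mu2]_(X in upper) (4 * L ^+ 2 *
   (2 * decay X.1 X.2 ^+ 2 + enorm (H X) ^+ 2))%:E)%E.
have I2i : mu2.-integrable upper (fun X => (4 * L ^+ 2 *
   (2 * decay X.1 X.2 ^+ 2 + enorm (H X) ^+ 2))%:E).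
  have := dominated_integrable (dominated_sq (@dominated_decay R)) => di.
  rewrite (_ : (fun _ => _) = fun X => ((4 * L ^+ 2)%:E *
    (2%:E * (decay X.1 X.2 ^+ 2)%:E + (enorm (H X) ^+ 2)%:E))%E)//.
  apply: integrableZl; first exact: measurable_upper.
  apply: integrableD; [exact: measurable_upper| |exact: fi].
  by apply: integrableZl; [exact: measurable_upper|exact: di].
have e0 := expR_ge0 (1 : R).
exists (expR 1 * fine I1 + 2 * expR 1 * fine I0 + (1 + 1 + fine I2) + 1) => N N1.
have N0 : 0 < N by rewrite (lt_le_trans _ N1).
have [pt px z0 _] := growth_fields N1.
have N2 : 0 < 2 * N by rewrite mulr_gt0.
have c1 := @dominated_trace_cvg _ _ F H false N N0 pt (fun x t e => (z0 x t e).1)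
  (fun n => mFp n false) m1 (cFp _ false N2).
have c2 := @dominated_trace_cvg _ _ F H true N N0 px (fun x t e => (z0 x t e).2)
  (fun n => mFp n true) m2 (cFp _ true N2).
have [c3 ih] := dominated_trace_line N0 px (fun x e => (z0 x 0 (or_introl e)).2) cF mh (cFb _ N2).
have [n [h1 h2 h3]] : exists n : nat, [/\
    (\int[mu2]_(X in upper) (`|growth_t N X.1 X.2 * (pd false (F n) X - (H X).1)|)%:E <= 1%:E)%E,
    (\int[mu2]_(X in upper) (`|growth_x N X.1 X.2 * (pd true (F n) X - (H X).2)|)%:E <= 1%:E)%E &
    (\int[mu]_x (`|growth_x N x 0%R * (F n (x, 0%R) - h (x, 0%R))|)%:E <= 1%:E)%E].
  have [n0 _ H0] := cvg_e0_le c1 ltr01; have [n1 _ H1] := cvg_e0_le c2 ltr01.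
  have [n2 _ H2] := cvg_e0_le c3 ltr01; exists (n0 + n1 + n2)%N; split.
  - by apply: H0 => /=; rewrite -addnA leq_addr.
  - by apply: H1 => /=; rewrite addnAC leq_addl.
  - by apply: H2 => /=; rewrite leq_addl.
have [M [B [M0 cn]]] := cF n.
have g := ctest_growth_le N1 cn fe.
have E0 x : growth_x N x 0 = weight_flux N x by rewrite /growth_x chi1_0 mulr1.
have is1 : mu.-integrable setT (fun x => (weight_flux N x * softabs (F n (x, 0)))%:E).
  have := dominated_line_integrable (ctest_softabs cn) px.
  by apply: eq_integrable => // x _; rewrite E0.
have is2 : mu.-integrable setT (fun x => (`|growth_x N x 0 * (F n (x, 0) - h (x, 0))|)%:E).
  have := integrable_abse (integrable_EFinB measurableT (dominated_line_integrable cn px) ih).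
  by apply: eq_integrable => // x _ /=; rewrite -mulrBr.
have is0 := integrable_abse hbox.
have I1f : I1 = (fine I1)%:E by rewrite fineK//; exact: integrable_fin_num omi.
have I0f : I0 = (fine I0)%:E by rewrite fineK//; exact: integrable_fin_num is0.
have I2f : I2 = (fine I2)%:E by rewrite fineK//; exact: integrable_fin_num I2i.
have j1 := integrableZl measurableT (expR 1) omi.
have j2 := integrableZl measurableT (2 * expR 1) is0.
have j12 := integrableD measurableT j1 j2.
have j123 := integrableD measurableT j12 is1.
have mw : measurable_fun setT (fun x => growth_x N x 0).
  by have [m _] := px; exact: measurable_section_x m.
have [mc _] := cutoff_measurable (cutoff_chi N1).
have mom : measurable_fun setT (@weight R).
  by have /measurable_int/measurable_EFinP := omi.
apply: (@le_trans _ _ (\int[mu]_x ((expR 1)%:E * (weight x)%:E +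
    (2 * expR 1)%:E * (`|\1_`[- 2%R, 2%R] x * h (x, 0%R)|)%:E +
    (weight_flux N x * softabs (F n (x, 0%R)))%:E +
    (`|growth_x N x 0%R * (F n (x, 0%R) - h (x, 0%R))|)%:E)))%E.
  apply: ge0_le_integral => //.
  - move=> x _; rewrite lee_fin; apply: mulr_ge0 => //.
    by apply: mulr_ge0; [have /andP[] := chi_le N x|exact: ltW (weight_gt0 x)].
  - apply/measurable_EFinP; apply: measurable_funM; first exact: measurable_funM.
    exact: measurableT_comp.
  - by have /measurable_int := integrableD measurableT j123 is2.
  - move=> x _; rewrite -!EFinM -!EFinD lee_fin E0.
    have /andP[k0 k1] := chi_le N x.
    have i0 : 0 <= \1_`[- 2, 2] x :> R by rewrite indicE.
    rewrite !normrM (ger0_norm i0); apply: weighted_softabs_le => //.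
      exact/ltW/weight_gt0.
    exact: weight_flux_lower.
rewrite (integralD measurableT j123 is2) (integralD measurableT j12 is1).
rewrite (integralD measurableT j1 j2) (integralZl measurableT omi) (integralZl measurableT is0).
rewrite -/I1 -/I0 I1f I0f -!EFinM -!EFinD -/I2 in g *.
rewrite !EFinD; apply: leeD => //; apply: leeD => //.
by apply: (le_trans g); rewrite I2f; apply: leeD => //; exact: leeD.
Qed.

(** Fatou's lemma removes the cutoff from the weighted bound. *)
Lemma trace_integrable v H h : Wdot (fun=> 0) v H -> trace (fun=> 0) v H h ->
  mu.-integrable setT (fun x => (decay x 0 ^+ 2 * h (x, 0))%:E).
Proof.
move=> wd tr; have [K hK] := trace_growth_le wd tr.
have mh : measurable_fun setT (fun x => h (x, 0)) by have [+ _] := tr.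
have mom : measurable_fun setT (@weight R).
  have omi := dominated_integrable_line (dominated_sq (@dominated_decay R)).
  have /measurable_int/measurable_EFinP := omi.
  by apply: eq_measurable_fun => x _; rewrite weightE.
apply/integrableP; split.
  apply/measurable_EFinP; apply: measurable_funM => //.
  by apply: eq_measurable_fun mom => x _; rewrite weightE.
pose f n x := ((chi n.+1%:R x * weight x * `|h (x, 0)|)%:E).
have mf n : measurable_fun setT (f n).
  have [mc _] := cutoff_measurable (@cutoff_chi R n.+1%:R (ler1n _ _)).
  apply/measurable_EFinP; apply: measurable_funM; first exact: measurable_funM.
  exact: measurableT_comp.
have f0 n x : setT x -> (0 <= f n x)%E.
  move=> _; rewrite lee_fin; apply: mulr_ge0 => //.
  by apply: mulr_ge0; [have /andP[] := chi_le n.+1%:R x|exact: ltW (weight_gt0 x)].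
have fl x : limn_einf (f ^~ x) = (`|(decay x 0 ^+ 2 * h (x, 0))%:E|)%E.
  have c : (f ^~ x) @ \oo --> (`|(decay x 0 ^+ 2 * h (x, 0))%:E|)%E.
    apply/cvg_EFin; first by near=> n.
    rewrite normrM -weightE (gtr0_norm (weight_gt0 x)) -[weight x]mul1r.
    by apply: cvgM; [apply: cvgM; [exact: chi_cvg|exact: cvg_cst]|exact: cvg_cst].
  by rewrite (cvg_limn_einf_sup c).1.
under eq_integral do rewrite -fl.
apply: le_lt_trans (fatou mu measurableT mf f0) _.
apply: (@le_lt_trans _ _ K%:E); last exact: ltry.
rewrite limn_einf_lim; apply: lime_le; first exact: is_cvg_einfs.
near=> n; apply: (@le_trans _ _ (\int[mu]_x f n x)%E); last by apply: hK; rewrite ler1n.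
by apply: ereal_inf_lbound; exists n => /=.
Unshelve. all: by end_near. Qed.

End TraceWeighted.

(** * The coefficients, the solutions and their conjugates *)

Section Potentials.
Context {R : realType}.
Notation mu := (@lebesgue_measure R).
Notation mu2 := (@lebesgue_measure R \x @lebesgue_measure R)%E.
Implicit Types (H : R -> R -> R * R) (x t : R).

Definition re H x t := (H x t).1.
Definition im H x t := (H x t).2.

Lemma decays_ptame H : plane_measurable H -> decays H -> dominated (re H) /\ dominated (im H).
Proof.
move=> [m1 m2] [K hK].
have le x t : 0 <= t -> K * decay x t ^+ 2 <= `|K| * decay x t.
  move=> t0; have d0 := decay_gt0 x t; have d1 := decay_le1 x t.
  rewrite (le_trans (ler_wpM2r (sqr_ge0 _) (ler_norm K)))// ler_wpM2l//.
  by rewrite expr2 ler_piMl// ltW.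
split; split => //; exists `|K| => x t t0; have [h1 h2] := hK x t t0.
  exact: le_trans h1 (le x t t0).
exact: le_trans h2 (le x t t0).
Qed.

Lemma reflects_im0 H t : reflects H -> im H 0 t = 0.
Proof. by move=> /(_ 0 t) [_]; rewrite oppr0 /im; lra. Qed.

Section Profile.
Variables H0 H1 H2 : R -> R -> R * R.
Hypothesis hP : profile H0 H1 H2.

Lemma holo_C1 U U' : (exists U'', holo U' U'') -> holo U U' ->
  dominated (re U) -> dominated (im U) -> dominated (re U') -> dominated (im U') ->
  [/\ C1x (re U) (fun x t => -1 * im U' x t), C1x (im U) (re U'),
      C1t (re U) (re U') & C1t (im U) (im U')].
Proof.
move=> [U'' h'] h p1 p2 q1 q2; have pz := dominatedZ (-1) q2.
have der x t (t0 : 0 <= t) := h x t t0; have der' x t (t0 : 0 <= t) := h' x t t0.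
split; split; try assumption; move=> x t t0.
- by have [d1 _ _ _] := der x t t0; rewrite mulN1r; exact: d1.
- have [_ d2 _ _] := der' x t t0; apply: cvgM; first exact: cvg_cst.
  exact: is_derive1_continuous d2.
- by have [_ d2 _ _] := der x t t0; exact: d2.
- by have [d1 _ _ _] := der' x t t0; exact: is_derive1_continuous d1.
- by have [_ _ d3 _] := der x t t0; exact: d3.
- by have [_ _ d3 _] := der' x t t0; exact: is_derive1_continuous d3.
- by have [_ _ _ d4] := der x t t0; exact: d4.
- by have [_ _ _ d4] := der' x t t0; exact: is_derive1_continuous d4.
Qed.

Lemma profile_C2 : C2 (re H0) (fun x t => -1 * im H1 x t) (re H1)
    (fun x t => -1 * im H2 x t) /\
  C2 (im H0) (re H1) (im H1) (re H2).
Proof.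
have [h01 h12 [H3 h23] d0 d1 d2 _ _ m0 m1 m2] := hP.
have [p0 q0] := decays_ptame m0 d0; have [p1 q1] := decays_ptame m1 d1.
have [p2 q2] := decays_ptame m2 d2.
have [a1 a2 a3 a4] := holo_C1 (ex_intro _ _ h12) h01 p0 q0 p1 q1.
have [b1 b2 b3 b4] := holo_C1 (ex_intro _ _ h23) h12 p1 q1 p2 q2.
by split; split; try assumption; exact: C1tZ.
Qed.

Variables (kap a q : R).

(** The coefficient is 3 on the right of the axis and 1 on the left. *)
Definition stretch x : R := 3 / (2 - Num.sg x).

Lemma stretchE x : stretch x = if x == 0 then 3 / 2 else if 0 < x then 3 else 1.
Proof.
rewrite /stretch; have [x0|x0|->] := ltgtP x 0.
- by rewrite ltr0_sg//; field.
- by rewrite gtr0_sg//; field.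
- by rewrite sgr0 subr0.
Qed.

Lemma stretch_itv x : 1 <= stretch x <= 3.
Proof.
rewrite stretchE; case: ifP => _; first by apply/andP; split; lra.
by case: ifP => _; apply/andP; split; lra.
Qed.

(** The two coefficients are the solution of the requirement that A applied to the
    gradient of a C + potcoef S be the rotated gradient of q C + fluxcoef S. *)
Definition potcoef x := q / stretch x - 2 * kap * a.
Definition fluxcoef x := 2 * kap * q - (1 + 4 * kap ^+ 2) * a * stretch x.

Lemma measurable_sgr : measurable_fun setT (@Num.sg R).
Proof.
rewrite (_ : Num.sg = fun x : R => \1_`]0, +oo[ x - \1_`]-oo, 0[ x).
  by apply: measurable_funB; exact: measurable_indic.
apply/funext => x; rewrite !indicE !mem_setE !in_itv/= andbT.
by case: sgrP => // _; rewrite ?subr0 ?sub0r.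
Qed.

Lemma measurable_stretch : measurable_fun setT stretch.
Proof.
apply: measurable_funM => //; apply: (measurableT_comp measurable_invr).
by apply: measurable_funB => //; exact: measurable_sgr.
Qed.

Lemma kinkcoef_potcoef : kinkcoef potcoef (q - 2 * kap * a) (q / 3 - 2 * kap * a).
Proof.
split.
- apply: measurable_funB => //; apply: measurable_funM => //.
  exact: (measurableT_comp measurable_invr measurable_stretch).
- by move=> x x0; rewrite /potcoef stretchE lt_eqF// ltNge ltW// divr1.
- by move=> x x0; rewrite /potcoef stretchE gt_eqF// x0.
Qed.

Lemma kinkcoef_fluxcoef : kinkcoef fluxcoef (2 * kap * q - (1 + 4 * kap ^+ 2) * a)
  (2 * kap * q - 3 * (1 + 4 * kap ^+ 2) * a).
Proof.
split.
- apply: measurable_funB => //; apply: measurable_funM => //.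
  exact: measurable_stretch.
- by move=> x x0; rewrite /fluxcoef stretchE lt_eqF// ltNge ltW//= mulr1.
- by move=> x x0; rewrite /fluxcoef stretchE gt_eqF// x0; ring.
Qed.

Definition pot : R * R -> R := fun X =>
  kink potcoef (fun x t => a * re H0 x t) (im H0) X.1 X.2.
Definition potgrad : R * R -> R * R := fun X =>
  (kink potcoef (fun x t => a * (-1 * im H1 x t)) (re H1) X.1 X.2,
   kink potcoef (fun x t => a * re H1 x t) (im H1) X.1 X.2).
Definition flux_t : R -> R -> R :=
  kink fluxcoef (fun x t => q * re H1 x t) (im H1).
Definition flux_x : R -> R -> R :=
  kink fluxcoef (fun x t => q * (-1 * im H1 x t)) (re H1).

Definition coefmx x : 'M[R]_2 :=
  \matrix_(i, j) (stretch x * (if i == j then 1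
    else if i == 0 then 2 * kap else - (2 * kap))).

Lemma bform_coefmx x (v w : R * R) : bform (coefmx x) v w =
  stretch x * (v.1 * (w.1 + 2 * kap * w.2) + v.2 * (w.2 - 2 * kap * w.1)).
Proof.
rewrite /bform !mxE !big_ord_recl !big_ord0 !mxE !big_ord_recl !big_ord0 !mxE /=.
ring.
Qed.

Lemma coefmx_potgrad (X : R * R) (v : R * R) : bform (coefmx X.1) v (potgrad X) =
  flux_t X.1 X.2 * v.1 - flux_x X.1 X.2 * v.2.
Proof.
have s0 : stretch X.1 != 0 by have /andP[h _] := stretch_itv X.1; rewrite gt_eqF// (lt_le_trans _ h).
rewrite bform_coefmx /potgrad /flux_t /flux_x /kink /= /potcoef /fluxcoef.
by field.
Qed.

(** The antisymmetric part of the matrix does not contribute to the quadratic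
    form. *)
Lemma coefmx_elliptic : elliptic upper (fun X => coefmx X.1).
Proof.
split.
- move=> i j; under eq_fun do rewrite mxE; apply: measurable_funM => //.
  apply: measurable_funTS.
  exact: (plane_measurable_comp measurable_stretch measurable_fst).
- exists (3 * (1 + 2 * `|kap|)); apply: aeW => X _ i j.
  have /andP[s1 s3] := stretch_itv X.1.
  rewrite mxE normrM ler_pM//; first by rewrite ger0_norm// (le_trans _ s1).
  have k0 := normr_ge0 kap.
  case: ifP => _; first by rewrite normr1; lra.
  by case: ifP => _; rewrite ?normrN normrM ger0_norm//; lra.
- exists 1 => //; apply: aeW => X _ xi; rewrite bform_coefmx enorm_sq mul1r.
  have /andP[s1 _] := stretch_itv X.1; have := sqr_ge0 xi.1; have := sqr_ge0 xi.2.
  rewrite (_ : _ + _ = xi.1 ^+ 2 + xi.2 ^+ 2); last by ring.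
  by move=> h1 h2; rewrite ler_peMl// addr_ge0.
Qed.

Lemma dominated_flux : [/\ dominated (fun x t => pot (x, t)),
  dominated (fun x t => (potgrad (x, t)).1), dominated (fun x t => (potgrad (x, t)).2),
  dominated flux_t & dominated flux_x].
Proof.
have [h01 h12 [H3 h23] d0 d1 d2 _ _ m0 m1 m2] := hP.
have [p0 q0] := decays_ptame m0 d0; have [p1 q1] := decays_ptame m1 d1.
by split; [apply: dominated_kink kinkcoef_potcoef _ _|
  apply: dominated_kink kinkcoef_potcoef _ _|apply: dominated_kink kinkcoef_potcoef _ _|
  apply: dominated_kink kinkcoef_fluxcoef _ _|apply: dominated_kink kinkcoef_fluxcoef _ _];
  do ?apply: dominatedZ.
Qed.

Lemma dominated_loc_int2 (z : R -> R -> R) : dominated z -> loc_int2 upper (fun X => z X.1 X.2).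
Proof.
move=> hz K cK KU; apply: (@integrableS _ _ R mu2 upper) => //.
- exact: measurable_upper.
- rewrite -[K]setCK; apply: measurableC; apply: plane_open_measurable.
  by apply: closed_openC; apply: compact_closed => //; exact: norm_hausdorff.
- exact: dominated_integrable.
Qed.

Lemma test2_upper_line F : test2 upper F -> forall x, F (x, 0) = 0.
Proof.
by move=> [_ [K [_ KU F0]]] x; apply: F0 => /KU; rewrite upperE ltxx.
Qed.

Lemma pot_weak_grad : weak_grad upper pot potgrad.
Proof.
have [t0 t1 t2 _ _] := dominated_flux.
have [cr ci] := profile_C2; have r0 t : im H0 0 t = 0.
  by apply: reflects_im0; exact: profile_reflects0 hP.
split; [exact: dominated_loc_int2 t0|exact: dominated_loc_int2 t1|exact: dominated_loc_int2 t2|].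
move=> F tF; have [M [B [_ cF]]] := test2_ctest tF; split.
- exact: (green_x cF kinkcoef_potcoef (C1xZ a (C2_x cr)) (C2_x ci) (fun t _ => r0 t)).
- have := green_t cF kinkcoef_potcoef (C1tZ a (C2_t cr)) (C2_t ci).
  under [X in (_ = X - _)%E -> _]eq_integral do
    rewrite (test2_upper_line tF) mulr0 oppr0.
  by rewrite integral0 sub0e.
Qed.

Lemma pot_Wdot : Wdot (fun=> 0) pot potgrad.
Proof.
have [_ t1 t2 _ _] := dominated_flux; split; first exact: pot_weak_grad.
apply: (@integrable_lty _ _ R mu2); first exact: measurable_upper.
rewrite (_ : (fun _ => _) = fun X => (((potgrad X).1 ^+ 2)%:E +
    ((potgrad X).2 ^+ 2)%:E)%E); last by apply/funext => X; rewrite enorm_sq.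
apply: integrableD; first exact: measurable_upper.
- exact: dominated_integrable (dominated_sq t1).
- exact: dominated_integrable (dominated_sq t2).
Qed.

Lemma pot_Wtilde : Wtilde (fun=> 0) pot potgrad.
Proof.
have [wg fe] := pot_Wdot; have [t0 _ _ _ _] := dominated_flux; split => //.
have [m _] := t0; have i0 := dominated_integrable (dominated_sq t0).
apply: (@integrable_lty _ _ R mu2); first exact: measurable_upper.
apply: (@le_integrable _ _ R mu2 upper measurable_upper _ _ _ _ i0).
- apply/measurable_EFinP; apply: measurable_funTS; apply: measurable_funM.
    by apply: measurable_funX; move: m; congr measurable_fun; apply/funext => -[].
  apply: (measurableT_comp measurable_invr); apply: measurable_funD => //.
  by apply: measurable_funX; exact: measurable_enorm.
- move=> [x t] _; rewrite lee_fin normrM ler_piMr//.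
  have e0 := sqr_ge0 (enorm (x, t)).
  rewrite ger0_norm ?invr_ge0 ?addr_ge0// invf_le1 ?lerDl//.
  by rewrite ltr_pwDl.
Qed.

Lemma flux_line_le : exists K, forall x,
  `|kink fluxcoef (fun x t => q * re H0 x t) (im H0) x 0| <= K * decay x 0 ^+ 2 /\
  `|flux_x x 0| <= K * decay x 0 ^+ 2.
Proof.
have [K0 h0] := profile_decays0 hP; have [K1 h1] := profile_decays1 hP.
have hb := kinkcoef_bound kinkcoef_fluxcoef; set B := (_ + _ + _) in hb.
have D0 x : 0 <= decay x 0 ^+ 2 by exact: sqr_ge0.
have st (y z b D K : R) : 0 <= D -> `|y| <= K * D -> `|z| <= K * D -> `|b| <= B ->
    `|q * y + b * z| <= (`|q| + B) * (K * D).
  move=> D0' hy hz hb'; rewrite (le_trans (ler_normD _ _))// mulrDl !normrM.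
  by apply: lerD; apply: ler_pM.
exists (Num.max ((`|q| + B) * K0) ((`|q| + B) * K1)) => x; split.
  have [hr hi] := h0 x 0 (lexx _).
  by rewrite (le_trans (st _ _ _ _ _ (D0 x) hr hi (hb x)))// mulrA ler_wpM2r// le_max lexx.
have [hr hi] := h1 x 0 (lexx _).
rewrite (le_trans (st _ _ _ _ _ (D0 x) _ hr (hb x)))//; first by rewrite mulN1r normrN.
by rewrite mulrA ler_wpM2r// le_max lexx orbT.
Qed.

(** The rotated gradient of the conjugate flux function is A applied to the
    gradient of the potential; hence the energy is a boundary integral. *)
Lemma pot_energy (w h : R * R -> R) (W : R * R -> R * R) :
  Wdot (fun=> 0) w W -> trace (fun=> 0) w W h ->
  mu.-integrable setT (fun x => (decay x 0 ^+ 2 * h (x, 0))%:E) ->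
  energy (fun=> 0) (fun X => coefmx X.1) potgrad W =
    (\int[mu]_x (flux_x x 0 * h (x, 0%R))%:E)%E.
Proof.
move=> wd tr hi; have [wg _] := wd; have fe := Wdot_finite_energy wd.
have [cr ci] := profile_C2; have [K hK] := flux_line_le.
have r0 t : im H0 0 t = 0 by apply: reflects_im0; exact: profile_reflects0 hP.
have r1 t : im H1 0 t = 0 by apply: reflects_im0; exact: profile_reflects1 hP.
rewrite /energy; under eq_integral do rewrite coefmx_potgrad.
exact: (flux_identity kinkcoef_fluxcoef (C2Z q cr) ci (fun t _ => r0 t)
  (fun t _ => r1 t) (fun x => (hK x).1) (fun x => (hK x).2) wg fe tr hi).
Qed.

End Profile.
End Potentials.

(** * Mollification of the Dirichlet solution *)

Section TraceOfPotential.
Context {R : realType}.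
Notation mu := (@lebesgue_measure R).
Notation mu2 := (@lebesgue_measure R \x @lebesgue_measure R)%E.
Implicit Types (d x t : R).

(** Both x / tau d x and tau d t are smooth for d > 0; as d tends to 0 they
    tend to the sign of x and to the modulus of t. *)
Definition tau d t : R := Num.sqrt (t ^+ 2 + d ^+ 2).
Definition smooth_sg d x : R := x / tau d x.
Definition smooth_sg' d x : R := d ^+ 2 * ((tau d x)^-1 * (x ^+ 2 + d ^+ 2)^-1).

Lemma tau_gt0 d t : 0 < d -> 0 < tau d t.
Proof. by move=> d0; rewrite sqrtr_gt0 sqD_gt0. Qed.

Lemma tau_sq d t : tau d t ^+ 2 = t ^+ 2 + d ^+ 2.
Proof. by rewrite sqr_sqrtr// addr_ge0 ?sqr_ge0. Qed.

Lemma norm_le_tau d t : `|t| <= tau d t.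
Proof. by rewrite -[leLHS]sqrtr_sqr ler_wsqrtr// lerDl sqr_ge0. Qed.

Lemma is_derive_tau d t : 0 < d -> is_derive t 1 (tau d) (t / tau d t).
Proof.
move=> d0; have t0 := tau_gt0 t d0.
have h := @is_derive1_comp _ (@Num.sqrt R) (fun z => z ^+ 2 + d ^+ 2) t _ _
  (is_derive1_sqrt (sqD_gt0 t d0)) (is_derive_sqD t (d ^+ 2)).
by apply: is_derive_eq h _; rewrite -/(tau d t); field; rewrite gt_eqF.
Qed.

Lemma is_derive_smooth_sg d x : 0 < d -> is_derive x 1 (smooth_sg d) (smooth_sg' d x).
Proof.
move=> d0; have t0 := tau_gt0 x d0; have tn : tau d x != 0 by rewrite gt_eqF.
have h := is_deriveM (is_derive_id x 1) (is_deriveV tn (is_derive_tau x d0)).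
apply: is_derive_eq h _; rewrite /GRing.scale /= /smooth_sg' -(tau_sq d x).
have -> : d ^+ 2 = tau d x ^+ 2 - x ^+ 2 by rewrite tau_sq addrC addKr.
by field.
Qed.

Lemma smooth_sg_le d x : `|smooth_sg d x| <= 1.
Proof.
have := norm_le_tau d x; rewrite /smooth_sg normrM normfV (ger0_norm (sqrtr_ge0 _)).
have [->|x0] := eqVneq x 0; first by rewrite normr0 mul0r.
by move=> h; rewrite ler_pdivrMr ?mul1r// (lt_le_trans _ h)// normr_gt0.
Qed.

Lemma smooth_sg'_le d x : 0 < d -> `|smooth_sg' d x| * `|x| <= 1.
Proof.
move=> d0; have t0 := tau_gt0 x d0; have p := sqD_gt0 x d0.
have h : 0 <= smooth_sg' d x.
  by rewrite mulr_ge0 ?sqr_ge0// mulr_ge0// invr_ge0 ltW.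
rewrite (ger0_norm h) /smooth_sg'.
have -> : d ^+ 2 * ((tau d x)^-1 / (x ^+ 2 + d ^+ 2)) * `|x| =
  (d ^+ 2 / (x ^+ 2 + d ^+ 2)) * (`|x| / tau d x) by ring.
rewrite -[leRHS]mulr1; apply: ler_pM.
- by rewrite divr_ge0 ?sqr_ge0// ltW.
- by rewrite divr_ge0// ltW.
- by rewrite ler_pdivrMr// mul1r lerDr sqr_ge0.
- by rewrite ler_pdivrMr// mul1r norm_le_tau.
Qed.

Let de n : R := n.+1%:R^-1.

Lemma de_gt0 n : 0 < de n. Proof. by rewrite invr_gt0. Qed.

Lemma cvg_de2 : de n ^+ 2 @[n --> \oo] --> (0 : R).
Proof.
rewrite -[X in _ --> X](_ : 0 * 0 = 0); last by rewrite mulr0.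
apply: (@cvgM _ _ _ _ de de); exact: cvg_inv_natS.
Qed.

Lemma cvg_sqD t : t ^+ 2 + de n ^+ 2 @[n --> \oo] --> t ^+ 2.
Proof.
rewrite -[X in _ --> X]addr0; apply: cvgD; [exact: cvg_cst|exact: cvg_de2].
Qed.

Lemma tau_cvg t : tau (de n) t @[n --> \oo] --> `|t|.
Proof.
rewrite -sqrtr_sqr; apply: continuous_cvg; [exact: sqrt_continuous|exact: cvg_sqD].
Qed.

Lemma smooth_sg_cvg x : smooth_sg (de n) x @[n --> \oo] --> Num.sg x.
Proof.
have [->|x0] := eqVneq x 0.
  rewrite sgr0; rewrite (_ : (fun n => _) = fun=> 0); first exact: cvg_cst.
  by apply/funext => n; rewrite /smooth_sg mul0r.
rewrite -[X in _ --> X](_ : x / `|x| = _).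
  by apply: cvgM; [exact: cvg_cst|apply: cvgV; [rewrite normr_eq0|exact: tau_cvg]].
by apply: (mulIf (x := `|x|)); rewrite ?normr_eq0// divfK ?normr_eq0// -numEsg.
Qed.

Lemma smooth_sg'_cvg x : x != 0 -> smooth_sg' (de n) x @[n --> \oo] --> (0 : R).
Proof.
move=> x0; rewrite -[X in _ --> X](mul0r (`|x|^-1 * (x ^+ 2)^-1)).
apply: cvgM; first exact: cvg_de2.
apply: cvgM; first by apply: cvgV; [rewrite normr_eq0|exact: tau_cvg].
by apply: cvgV; [rewrite expf_neq0|exact: cvg_sqD].
Qed.

Variables H0 H1 H2 : R -> R -> R * R.
Hypothesis hP : profile H0 H1 H2.
Variable kap : R.

(** The Dirichlet solution with the sign of x and the distance t to the boundary
    smoothed; it is even in t and thus extends to the plane. *)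
Definition Phi d x t := re H0 x (tau d t) - kap * smooth_sg d x * im H0 x (tau d t).
Definition Phix d x t := - im H1 x (tau d t) - kap *
  (smooth_sg' d x * im H0 x (tau d t) + smooth_sg d x * re H1 x (tau d t)).
Definition Phit d x t := (t / tau d t) * (re H1 x (tau d t) -
  kap * smooth_sg d x * im H1 x (tau d t)).

Definition approx n : R * R -> R := fun X =>
  chi n.+1%:R X.1 * chi n.+1%:R X.2 * Phi (de n) X.1 X.2.

Lemma approx_pd n x t :
  pd false (approx n) (x, t) = chi' n.+1%:R x * chi n.+1%:R t * Phi (de n) x t +
    chi n.+1%:R x * chi n.+1%:R t * Phix (de n) x t /\
  pd true (approx n) (x, t) = chi n.+1%:R x * chi' n.+1%:R t * Phi (de n) x t +
    chi n.+1%:R x * chi n.+1%:R t * Phit (de n) x t.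
Proof.
have d0 := de_gt0 n; have t0 := ltW (tau_gt0 t d0).
have [h1 h2 h3 h4] := profile_holo01 hP x t0; split.
- have p1 : is_derive x 1 (fun y => Phi (de n) y t) (Phix (de n) x t).
    have q : is_derive x 1 (fun y => kap * smooth_sg (de n) y) (kap * smooth_sg' (de n) x).
      exact: (is_deriveZ kap (is_derive_smooth_sg x d0)).
    apply: is_derive_eq (is_deriveB h1 (is_deriveM q h2)) _.
    by rewrite /GRing.scale /= /Phix /im /re; ring.
  have p2 : is_derive x 1 (fun y => chi n.+1%:R y * chi n.+1%:R t)
      (chi' n.+1%:R x * chi n.+1%:R t).
    have q := is_deriveM (is_derive_chi n.+1%:R x) (is_derive_cst (chi n.+1%:R t) x 1).
    by apply: is_derive_eq q _; rewrite scaler0 add0r /GRing.scale /= mulrC.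
  have p3 : is_derive (x, t) (dir false) (approx n) (chi' n.+1%:R x * chi n.+1%:R t * Phi (de n) x t +
    chi n.+1%:R x * chi n.+1%:R t * Phix (de n) x t).
    apply/is_derive_pdx; apply: is_derive_eq (is_deriveM p2 p1) _.
    by rewrite /GRing.scale /=; ring.
  by have [_] := p3.
- have dt := is_derive_tau t d0.
  have g1 : is_derive t 1 (fun s => re H0 x (tau (de n) s))
      ((H1 x (tau (de n) t)).1 * (t / tau (de n) t)).
    exact: (@is_derive1_comp _ (fun s => (H0 x s).1) (tau (de n)) t _ _ h3 dt).
  have g2 : is_derive t 1 (fun s => im H0 x (tau (de n) s))
      ((H1 x (tau (de n) t)).2 * (t / tau (de n) t)).
    exact: (@is_derive1_comp _ (fun s => (H0 x s).2) (tau (de n)) t _ _ h4 dt).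
  have p1 : is_derive t 1 (Phi (de n) x) (Phit (de n) x t).
    apply: is_derive_eq (is_deriveB g1 (is_deriveZ (kap * smooth_sg (de n) x) g2)) _.
    by rewrite /GRing.scale /= /Phit /im /re; ring.
  have p2 : is_derive t 1 (fun s => chi n.+1%:R x * chi n.+1%:R s)
      (chi n.+1%:R x * chi' n.+1%:R t).
    exact: (is_deriveZ (chi n.+1%:R x) (is_derive_chi n.+1%:R t)).
  have p3 : is_derive (x, t) (dir true) (approx n) (chi n.+1%:R x * chi' n.+1%:R t * Phi (de n) x t +
    chi n.+1%:R x * chi n.+1%:R t * Phit (de n) x t).
    apply/is_derive_pdt; apply: is_derive_eq (is_deriveM p2 p1) _.
    by rewrite /GRing.scale /=; ring.
  by have [_] := p3.
Qed.

Lemma profile_bound : exists2 K, 0 <= K & forall x t, 0 <= t ->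
  [/\ `|re H0 x t| <= K, `|im H0 x t| <= K, `|re H1 x t| <= K, `|im H1 x t| <= K &
      `|im H0 x t| <= K * `|x|].
Proof.
have [K0 h0] := profile_decays0 hP; have [K1 h1] := profile_decays1 hP.
pose K := `|K0| + `|K1|.
have st (y L x t : R) : `|L| <= K -> `|y| <= L * decay x t ^+ 2 -> `|y| <= K.
  move=> LK hy; have d0 := decay_gt0 x t; have d1 := decay_le1 x t.
  rewrite (le_trans hy)// (le_trans _ LK)// (le_trans (ler_wpM2r (sqr_ge0 _) (ler_norm L)))//.
  by rewrite ler_piMr// expr2 mulr_ile1// ltW.
have l0 : `|K0| <= K by rewrite lerDl.
have l1 : `|K1| <= K by rewrite lerDr.
have b1 (y s : R) : 0 <= s -> `|re H1 y s| <= K by move=> s0; apply: st l1 (h1 y s s0).1.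
exists K; first by rewrite addr_ge0.
move=> x t t0; split.
- by apply: st l0 (h0 x t t0).1.
- by apply: st l0 (h0 x t t0).2.
- exact: b1.
- by apply: st l1 (h1 x t t0).2.
- have r0 : im H0 0 t = 0 by apply: reflects_im0; exact: profile_reflects0 hP.
  have der (y : R) : is_derive y 1 (fun z => im H0 z t) (re H1 y t).
    by have [_ d2 _ _] := profile_holo01 hP y t0.
  have con (a b : R) : {within `[a, b], continuous (fun z => im H0 z t)}.
    apply: continuous_subspaceT => y; exact: is_derive1_continuous (der y).
  have [x0|x0] := leP 0 x.
    have [c _] := MVT_segment x0 (fun y _ => der y) (con _ _).
    by rewrite r0 !subr0 => ->; rewrite normrM ler_wpM2r// b1.
  have [c _] := MVT_segment (ltW x0) (fun y _ => der y) (con _ _).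
  rewrite r0 !sub0r => /eqP; rewrite eqr_oppLR => /eqP ->.
  by rewrite normrN normrM normrN ler_wpM2r// b1.
Qed.

(** The mollified functions and their derivatives are bounded uniformly, since
    im H0 vanishes on the axis, where the mollified sign has a large slope. *)
Lemma approx_bound : exists B, forall n x t,
  [/\ `|approx n (x, t)| <= B, `|pd false (approx n) (x, t)| <= B &
      `|pd true (approx n) (x, t)| <= B].
Proof.
have [K K0 hK] := profile_bound; have e0 := expR_ge0 (1 : R).
have k0 := normr_ge0 kap.
set L : R := 4 * expR 1; have L0 : 0 <= L by rewrite mulr_ge0.
pose B1 := K + `|kap| * (K + K); have B10 : 0 <= B1 by rewrite addr_ge0 ?mulr_ge0 ?addr_ge0.
exists (L * L * B1 + L * L * B1) => n x t.
have d0 := de_gt0 n; have tt := ltW (tau_gt0 t d0).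
have hc := @cutoff_chi R n.+1%:R (ler1n _ _).
have cb y : `|chi n.+1%:R y| <= L by exact: cutoff_bound hc y.
have cb' y : `|chi' n.+1%:R y| <= L by exact: cutoff_bound' hc y.
have [b1 b2 b3 b4 b5] := hK x (tau (de n) t) tt.
have s1 := smooth_sg_le (de n) x; have s2 := smooth_sg'_le x d0.
have sm (y : R) : `|y| <= K -> `|smooth_sg (de n) x * y| <= K.
  by move=> yK; rewrite normrM (le_trans _ yK)// ler_piMl.
have bPhi : `|Phi (de n) x t| <= B1.
  rewrite /Phi -mulrA (le_trans (ler_normB _ _))// lerD// normrM ler_wpM2l//.
  by rewrite (le_trans (sm _ b2))// lerDl.
have bPhix : `|Phix (de n) x t| <= B1.
  rewrite /Phix (le_trans (ler_normB _ _))// normrN lerD// normrM ler_wpM2l//.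
  rewrite (le_trans (ler_normD _ _))// lerD ?sm// normrM.
  apply: (le_trans (ler_wpM2l (normr_ge0 _) b5)).
  by rewrite mulrCA ler_piMr.
have bPhit : `|Phit (de n) x t| <= B1.
  rewrite /Phit normrM; apply: (@le_trans _ _ (1 * B1)); last by rewrite mul1r.
  apply: ler_pM => //; first exact: smooth_sg_le.
  rewrite -mulrA (le_trans (ler_normB _ _))// lerD// normrM ler_wpM2l//.
  by rewrite (le_trans (sm _ b4))// lerDl.
have LL : 0 <= L * L * B1 by rewrite !mulr_ge0.
have st (u v w : R) : `|u| <= L -> `|v| <= L -> `|w| <= B1 -> `|u * v * w| <= L * L * B1.
  by move=> hu hv hw; rewrite !normrM; apply: ler_pM => //; exact: ler_pM.
have [-> ->] := approx_pd n x t; split.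
- by rewrite (le_trans (st _ _ _ (cb _) (cb _) bPhi))// lerDl.
- by rewrite (le_trans (ler_normD _ _))// lerD// st.
- by rewrite (le_trans (ler_normD _ _))// lerD// st.
Qed.

Lemma holo_cvg_t U U' x t (s : nat -> R) : holo U U' -> 0 <= t -> s n @[n --> \oo] --> t ->
  re U x (s n) @[n --> \oo] --> re U x t /\ im U x (s n) @[n --> \oo] --> im U x t.
Proof.
move=> h t0 st; have [_ _ h3 h4] := h x t t0; split; (apply: continuous_cvg; last exact: st).
- exact: is_derive1_continuous h3.
- exact: is_derive1_continuous h4.
Qed.

Lemma potcoefE x : potcoef kap 1 (3 * kap) x = - (kap * Num.sg x).
Proof.
rewrite /potcoef stretchE; have [x0|x0|->] := ltgtP x 0.
- by rewrite ltr0_sg//; field.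
- by rewrite gtr0_sg//; field.
- by rewrite sgr0; field.
Qed.

Lemma approx_cvg x t : 0 <= t ->
  approx n (x, t) @[n --> \oo] --> pot H0 kap 1 (3 * kap) (x, t).
Proof.
move=> t0; have ct : tau (de n) t @[n --> \oo] --> t.
  by rewrite -[X in _ --> X](ger0_norm t0); exact: tau_cvg.
have [c1 c2] := holo_cvg_t x (profile_holo01 hP) t0 ct.
rewrite /pot /kink /= potcoefE mul1r mulNr.
rewrite -[X in _ --> X]mul1r -[X in X * (_ + _)]mulr1.
apply: cvgM; first by apply: cvgM; exact: chi_cvg.
by apply: cvgB => //; apply: cvgM => //; apply: cvgM; [exact: cvg_cst|exact: smooth_sg_cvg].
Qed.

Lemma approx_pd_cvg x t : 0 < t ->
  pd false (approx n) (x, t) @[n --> \oo] -->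
    (potgrad H1 kap 1 (3 * kap) (x, t)).1 /\
  pd true (approx n) (x, t) @[n --> \oo] -->
    (potgrad H1 kap 1 (3 * kap) (x, t)).2.
Proof.
move=> t0; have ct : tau (de n) t @[n --> \oo] --> t.
  by rewrite -[X in _ --> X](gtr0_norm t0); exact: tau_cvg.
have [c1 c2] := holo_cvg_t x (profile_holo01 hP) (ltW t0) ct.
have [c3 c4] := holo_cvg_t x (profile_holo12 hP) (ltW t0) ct.
have ks : (fun n => kap * smooth_sg (de n) x) @ \oo --> kap * Num.sg x.
  by apply: cvgM; [exact: cvg_cst|exact: smooth_sg_cvg].
have cP : Phi (de n) x t @[n --> \oo] --> re H0 x t - kap * Num.sg x * im H0 x t.
  by apply: cvgB => //; exact: cvgM.
have z1 : (fun n => smooth_sg' (de n) x * im H0 x (tau (de n) t)) @ \oo --> 0.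
  have [x0|x0] := eqVneq x 0.
    have E n : smooth_sg' (de n) x * im H0 x (tau (de n) t) = 0.
      rewrite x0 (_ : im H0 0 _ = 0) ?mulr0//.
      by apply: reflects_im0; exact: profile_reflects0 hP.
    by under eq_fun do rewrite E; exact: cvg_cst.
  rewrite -[X in _ --> X](mul0r (im H0 x t)); apply: cvgM => //; exact: smooth_sg'_cvg.
have cPx : Phix (de n) x t @[n --> \oo] -->
    (potgrad H1 kap 1 (3 * kap) (x, t)).1.
  rewrite /potgrad /kink /= potcoefE mul1r mulN1r.
  rewrite -[X in _ --> X](_ : - im H1 x t - kap * (0 + Num.sg x * re H1 x t) = _); last by ring.
  apply: cvgB; first exact: cvgN.
  by apply: cvgM; [exact: cvg_cst|apply: cvgD => //; apply: cvgM => //; exact: smooth_sg_cvg].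
have cPt : Phit (de n) x t @[n --> \oo] -->
    (potgrad H1 kap 1 (3 * kap) (x, t)).2.
  rewrite /potgrad /kink /= potcoefE mul1r mulNr.
  rewrite -[X in _ --> X]mul1r -[X in X * (_ - _)](@divff _ t) ?gt_eqF//.
  apply: cvgM.
    by apply: cvgM; [exact: cvg_cst|apply: cvgV => //; rewrite gt_eqF].
  by apply: cvgB => //; exact: cvgM.
split.
- rewrite (_ : (fun n => _) = fun n => chi' n.+1%:R x * chi n.+1%:R t * Phi (de n) x t +
    chi n.+1%:R x * chi n.+1%:R t * Phix (de n) x t); last first.
    by apply/funext => n; have [] := approx_pd n x t.
  rewrite -[X in _ --> X](_ : 0 * 1 * (re H0 x t - kap * Num.sg x * im H0 x t) + 1 * 1 * (potgrad H1 kap 1 (3 * kap) (x, t)).1 = _); last by ring.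
  by apply: cvgD; (apply: cvgM; last by []); apply: cvgM;
    (exact: chi_cvg || exact: chi'_cvg).
- rewrite (_ : (fun n => _) = fun n => chi n.+1%:R x * chi' n.+1%:R t * Phi (de n) x t +
    chi n.+1%:R x * chi n.+1%:R t * Phit (de n) x t); last first.
    by apply/funext => n; have [] := approx_pd n x t.
  rewrite -[X in _ --> X](_ : 1 * 0 * (re H0 x t - kap * Num.sg x * im H0 x t) + 1 * 1 * (potgrad H1 kap 1 (3 * kap) (x, t)).2 = _); last by ring.
  by apply: cvgD; (apply: cvgM; last by []); apply: cvgM;
    (exact: chi_cvg || exact: chi'_cvg).
Qed.

End TraceOfPotential.

(** * The trace of the Dirichlet solution *)

Section TraceOfPotentialEnd.
Context {R : realType}.
Notation mu := (@lebesgue_measure R).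
Notation mu2 := (@lebesgue_measure R \x @lebesgue_measure R)%E.
Implicit Types (x t r : R).

Lemma decay_box x t r : `|x| <= r -> `|t| <= r -> decay r r <= decay x t.
Proof.
move=> xr tr; have sq (y : R) : `|y| <= r -> y ^+ 2 <= r ^+ 2.
  move=> yr; rewrite -real_normK ?num_real// ler_sqr ?nnegrE//.
  exact: le_trans (normr_ge0 _) yr.
rewrite /decay lef_pV2 ?posrE ?mulr_gt0 ?oneDsq_gt0//.
by apply: ler_pM; rewrite ?lerD2l ?sq// addr_ge0 ?sqr_ge0.
Qed.

Lemma eball_box x t r : 0 < r -> eball (0, 0) r (x, t) -> `|x| <= r /\ `|t| <= r.
Proof.
move=> r0; rewrite eballE//= !subr0 => h; have sq (y : R) : y ^+ 2 <= r ^+ 2 -> `|y| <= r.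
  by move=> /ler_wsqrtr; rewrite !sqrtr_sqr (gtr0_norm r0).
by split; apply: sq; rewrite (le_trans _ (ltW h))// ?lerDl ?lerDr sqr_ge0.
Qed.

Lemma dominated_bounded (z : R -> R -> R) : dominated z ->
  exists2 K, 0 <= K & forall x t, 0 <= t -> `|z x t| <= K.
Proof.
move=> [_ [K hK]]; exists `|K| => // x t t0; have d0 := decay_gt0 x t.
rewrite (le_trans (hK x t t0))// (le_trans (ler_wpM2r (ltW d0) (ler_norm K)))//.
by rewrite ler_piMr// decay_le1.
Qed.

Section Trace.
Variables H0 H1 H2 : R -> R -> R * R.
Hypothesis hP : profile H0 H1 H2.
Variable kap : R.

(** Everything is bounded uniformly on balls, so that pointwise convergence
    suffices. *)
Lemma pot_trace : (forall n, test2 setT (approx H0 kap n)) ->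
  trace (fun=> 0) (pot H0 kap 1 (3 * kap)) (potgrad H1 kap 1 (3 * kap))
    (pot H0 kap 1 (3 * kap)).
Proof.
move=> tF; set P := pot _ _ _ _; set G := potgrad _ _ _ _.
have [t0 t1 t2 _ _] := dominated_flux hP kap 1 (3 * kap).
have mP : measurable_fun setT P.
  by have [m _] := t0; move: m; congr measurable_fun; apply/funext => -[].
have mG1 : measurable_fun setT (fun X => (G X).1).
  by have [m _] := t1; move: m; congr measurable_fun; apply/funext => -[].
have mG2 : measurable_fun setT (fun X => (G X).2).
  by have [m _] := t2; move: m; congr measurable_fun; apply/funext => -[].
split; first exact: measurable_section_x mP.
exists (approx H0 kap); split => // r r0.
have [B hB] := approx_bound hP kap; have [K0 K00 hK0] := dominated_bounded t0.
have [K1 K10 hK1] := dominated_bounded t1; have [K2 K20 hK2] := dominated_bounded t2.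
pose M := B + K0 + K1 + K2.
have B0 : 0 <= B by have [h _ _] := hB 0%N 0 0; exact: le_trans (normr_ge0 _) h.
have Mle (y z K : R) : `|y| <= B -> `|z| <= K -> B + K <= M -> (y - z) ^+ 2 <= M ^+ 2.
  move=> hy hz hM; rewrite -real_normK ?num_real// ler_sqr ?nnegrE//; last first.
    by rewrite /M !addr_ge0.
  by rewrite (le_trans (ler_normB _ _))// (le_trans _ hM)// lerD.
have M0 : B + K0 <= M by rewrite /M; lra.
have M1 : B + K1 <= M by rewrite /M; lra.
have M2 : B + K2 <= M by rewrite /M; lra.
have c n : exists M B, 0 < M /\ ctest (approx H0 kap n) M B by exact: test2_ctest (tF n).
have mF n : measurable_fun setT (approx H0 kap n).
  have [N [B' [_ cn]]] := c n; exact: plane_continuous_measurable (ctest_continuous cn).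
have mpF n i : measurable_fun setT (pd i (approx H0 kap n)).
  have [N [B' [_ cn]]] := c n.
  exact: plane_continuous_measurable (@ctest_continuous_pd _ _ _ _ cn i).
have dr0 := decay_gt0 r r.
split.
- have mD : measurable (upper `&` eball (0, 0)%R r).
    by apply: measurableI; [exact: measurable_upper|exact: measurable_eball].
  pose f n X := ((approx H0 kap n X - P X) ^+ 2 +
    ((pd false (approx H0 kap n) X - (G X).1) ^+ 2 +
     (pd true (approx H0 kap n) X - (G X).2) ^+ 2)).
  have mf n : measurable_fun setT (f n).
    have m1 : measurable_fun setT (fun X => approx H0 kap n X - P X).
      exact: measurable_funB (mF n) mP.
    have m2 : measurable_fun setT (fun X => pd false (approx H0 kap n) X - (G X).1).
      exact: measurable_funB (mpF n false) mG1.
    have m3 : measurable_fun setT (fun X => pd true (approx H0 kap n) X - (G X).2).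
      exact: measurable_funB (mpF n true) mG2.
    apply: measurable_funD; first exact: measurable_funX.
    by apply: measurable_funD; exact: measurable_funX.
  have z : (\int[mu2]_(X in upper `&` eball (0, 0)%R r) (cst 0%E) X = 0)%E.
    by rewrite integral_cst// mul0e.
  suff : (fun n => \int[mu2]_(X in upper `&` eball (0, 0)%R r) (f n X)%:E)%E @ \oo -->
      (\int[mu2]_(X in upper `&` eball (0, 0)%R r) (cst 0%E) X)%E.
    rewrite z; apply: cvg_e0_squeeze => n; apply/andP; split.
      by apply: integral_ge0 => X _; rewrite lee_fin addr_ge0 ?sqr_ge0.
    rewrite le_eqVlt; apply/orP; left; apply/eqP; apply: eq_integral => X _.
    by rewrite enorm_sq.
  apply: (@dominated_cvg _ _ R mu2 _ mD _ _
    (fun X => ((M ^+ 2 * 3 / decay r r)%:E * (decay X.1 X.2)%:E)%E)).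
  + by move=> n; apply/measurable_EFinP; exact: measurable_funTS (mf n).
  + move=> [x t] [t_gt0 _]; have t_gt0' : 0 < t by [].
    apply/cvg_EFin; first by near=> n.
    have c1 := @approx_cvg _ _ _ _ hP kap x _ (ltW t_gt0').
    have [c2 c3] := @approx_pd_cvg _ _ _ _ hP kap x _ t_gt0'.
    have sq0 (u : nat -> R) (l : R) : u n @[n --> \oo] --> l ->
        (u n - l) ^+ 2 @[n --> \oo] --> (0 : R).
      move=> ul; rewrite -[X in _ --> X](_ : (l - l) * (l - l) = 0); last by rewrite subrr mul0r.
      by apply: (@cvgM _ _ _ _ (fun n => u n - l) (fun n => u n - l));
        apply: cvgB => //; exact: cvg_cst.
    rewrite /comp /= -[X in _ --> X](_ : 0 + (0 + 0) = 0); last by rewrite !addr0.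
    by apply: cvgD; [exact: sq0|apply: cvgD; exact: sq0].
  + by [].
  + apply: integrableZl; first exact: mD.
    by apply: (@integrableS _ _ R mu2 setT) => //; exact: integrable_decay.
  + move=> n [x t] [t_gt0 Br]; have t_ge0 : 0 <= t by exact: (ltW (t_gt0 : 0 < t)).
    have [b1 b2 b3] := hB n x t; have [xr tr] := eball_box r0 Br.
    rewrite -EFinM lee_fin /= ger0_norm ?addr_ge0 ?sqr_ge0//.
    apply: (@le_trans _ _ (M ^+ 2 * 3)).
      rewrite (_ : M ^+ 2 * 3 = M ^+ 2 + (M ^+ 2 + M ^+ 2)); last by ring.
      rewrite /f /=; apply: lerD; last apply: lerD.
      - exact: (Mle _ _ _ b1 (hK0 x t t_ge0) M0).
      - exact: (Mle _ _ _ b2 (hK1 x t t_ge0) M1).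
      - exact: (Mle _ _ _ b3 (hK2 x t t_ge0) M2).
    rewrite -[leRHS]mulrA ler_peMr//; first by rewrite mulr_ge0 ?sqr_ge0.
    by rewrite ler_pdivlMl// mulr1 decay_box.
- have z : (\int[mu]_x (cst 0%E) x = 0)%E by rewrite integral_cst// mul0e.
  suff : (fun n => \int[mu]_x ((approx H0 kap n (x, 0%R) - P (x, 0%R)) ^+ 2 *
      \1_(eball (0, 0)%R r) (x, 0%R))%:E)%E @ \oo --> (\int[mu]_x (cst 0%E) x)%E.
    rewrite z; apply: cvg_e0_squeeze => n; apply/andP; split.
      rewrite bd_intE; apply: integral_ge0 => x _; rewrite lee_fin.
      by rewrite mulr_ge0 ?sqr_ge0// indicE.
    by rewrite bd_intE.
  have mI : measurable_fun setT (fun x => \1_(eball (0, 0)%R r) (x, 0) : R).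
    apply: (@measurable_section_x _ (\1_(eball (0, 0)%R r))).
    by apply: measurable_indic; exact: measurable_eball.
  apply: (@dominated_cvg _ _ R mu setT measurableT _ _
    (fun x => ((M ^+ 2 / decay r r)%:E * (decay x 0)%:E)%E)).
  + move=> n; apply/measurable_EFinP; apply: measurable_funM => //.
    by apply: measurable_funX; apply: measurable_funB; exact: measurable_section_x.
  + move=> x _; apply/cvg_EFin; first by near=> n.
    rewrite /comp /= -[X in _ --> X](mul0r (\1_(eball (0, 0)%R r) (x, 0))).
    apply: cvgM; last exact: cvg_cst.
    have c1 := @approx_cvg _ _ _ _ hP kap x _ (lexx 0).
    rewrite -[X in _ --> X](_ : (P (x, 0) - P (x, 0)) * (P (x, 0) - P (x, 0)) = 0);
      last by rewrite subrr mul0r.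
    by apply: (@cvgM _ _ _ _ (fun n => approx H0 kap n (x, 0) - P (x, 0))
      (fun n => approx H0 kap n (x, 0) - P (x, 0))); apply: cvgB => //; exact: cvg_cst.
  + by [].
  + by apply: integrableZl => //; exact: dominated_integrable_line (@dominated_decay R).
  + move=> n x _; rewrite -EFinM lee_fin indicE; have d0 := decay_gt0 x 0.
    have [|] := boolP ((x, 0) \in eball (0, 0) r); last first.
      rewrite mulr0 normr0 => _; apply: mulr_ge0; last exact: ltW.
      by apply: divr_ge0; [exact: sqr_ge0|exact: ltW].
    rewrite inE => Br; have [xr tr] := eball_box r0 Br.
    rewrite mulr1 ger0_norm ?sqr_ge0//; apply: (@le_trans _ _ (M ^+ 2)).
      by apply: Mle M0; [have [] := hB n x 0|exact: (hK0 x 0 (lexx _))].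
    rewrite -[leRHS]mulrA ler_peMr ?sqr_ge0//.
    by rewrite ler_pdivlMl// mulr1 decay_box.
Unshelve. all: by end_near. Qed.

End Trace.

Section Smooth.
Variables (al e kap : R).
Hypothesis e0 : 0 < e.

Lemma tame_cpow (a : R) (f g : R * R -> R) : tame f -> tame g -> (forall X, 0 < g X) ->
  tame (fun X => (cpow a (f X) (g X)).1) /\ tame (fun X => (cpow a (f X) (g X)).2).
Proof.
move=> tf tg g0.
have tabs : tame (fun X => cabs a (f X) (g X)).
  apply: tame_expR; apply: (tameM (tame_cst (a / 2))); apply: tame_ln.
    by apply: tameD; exact: tameX.
  by move=> X; rewrite sqD_gt0.
have targ : tame (fun X => a * carg (f X) (g X)).
  apply: (tameM (tame_cst a)); apply: tame_atan; apply: tameM => //.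
  by apply: tameV => // X; rewrite gt_eqF.
by split; apply: tameM => //; [exact: tame_cos|exact: tame_sin].
Qed.

Lemma tame_chi (N : R) (f : R * R -> R) : tame f -> tame (fun X => chi N (f X)).
Proof.
move=> tf; apply: (tameM (tame_cst (expR 1))); apply: (@tame_flat _ 0).
apply: tameD; first exact: tame_cst.
by apply: tameN; apply: tameX; apply: tameM => //; exact: tame_cst.
Qed.

Lemma tame_tau (d : R) (f : R * R -> R) : 0 < d -> tame f -> tame (fun X => tau d (f X)).
Proof.
move=> d0 tf; rewrite (_ : (fun _ => _) = fun X => expR (2^-1 * ln (f X ^+ 2 + d ^+ 2))).
  apply: tame_expR; apply: (tameM (tame_cst 2^-1)); apply: tame_ln.
    by apply: tameD; [exact: tameX|exact: tame_cst].
  by move=> X; rewrite sqD_gt0.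
by apply/funext => X; rewrite /tau -(cabs1 _ d0) /cabs mul1r.
Qed.

(** The shift by e keeps the argument of the power off the origin. *)
Lemma approx_test2 n : test2 setT (approx (prof0 al e) kap n).
Proof.
have d0 : (0 : R) < n.+1%:R^-1 by rewrite invr_gt0.
have c1 := @tame_coord R false; have c2 := @tame_coord R true.
split.
- apply: tame_smooth2; apply: tameM.
    by apply: tameM; exact: tame_chi.
  have tt := tame_tau d0 c2.
  have ts (s : R) : 0 < s -> tame (fun X : R * R => tau n.+1%:R^-1 X.2 + s) /\
      forall X : R * R, 0 < tau n.+1%:R^-1 X.2 + s.
    by move=> s0; split; [apply: tameD => //; exact: tame_cst|
      move=> X; rewrite addr_gt0// tau_gt0].
  have [te te0] := ts e e0; have [t1 t10] := ts 1 ltr01.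
  have [p1 p2] := tame_cpow (al - 0) c1 te te0.
  have [q1 q2] := tame_cpow (- 9 - 0) c1 t1 t10.
  have tre : tame (fun X => re (prof0 al e) X.1 (tau n.+1%:R^-1 X.2)).
    by apply: tameD; [exact: tameM|apply: tameN; exact: tameM].
  have tim : tame (fun X => im (prof0 al e) X.1 (tau n.+1%:R^-1 X.2)).
    by apply: tameD; exact: tameM.
  apply: tameD => //; apply: tameN; apply: tameM => //.
  apply: (tameM (tame_cst kap)); apply: tameM => //.
  apply: tameV; first exact: tame_tau.
  by move=> X; rewrite gt_eqF// tau_gt0.
- have N0 : (0 : R) < n.+1%:R by [].
  exists (`[- n.+1%:R, n.+1%:R]%classic `*` `[- n.+1%:R, n.+1%:R]%classic); split => //.
    by apply: compact_setX; exact: segment_compact.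
  move=> [x t] /=; rewrite !in_itv/= -!ler_norml => h; rewrite /approx /=.
  have [xN|xN] := leP `|x| n.+1%:R; last by rewrite (chi_eq0 N0 (ltW xN)) !mul0r.
  have [tN|tN] := leP `|t| n.+1%:R; last by rewrite (chi_eq0 N0 (ltW tN)) mulr0 mul0r.
  by exfalso; apply: h.
Qed.

End Smooth.
End TraceOfPotentialEnd.

(** * The boundary data *)

Section BoundaryData.
Context {R : realType}.
Notation mu := (@lebesgue_measure R).
Notation mu2 := (@lebesgue_measure R \x @lebesgue_measure R)%E.
Implicit Types (f g df : R * R -> R) (x t q K : R) (psi : R -> R).

Lemma bd_normE q (w : R * R -> \bar R) :
  bd_norm (fun=> 0) q w = ((\int[mu]_x (`|w (x, 0%R)| `^ q)) `^ q^-1)%E.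
Proof. by rewrite /bd_norm bd_intE. Qed.

Lemma bd_norm_EFin q f : bd_norm (fun=> 0) q (EFin \o f) =
  ((\int[mu]_x (`|f (x, 0%R)| `^ q)%:E) `^ q^-1)%E.
Proof. by rewrite bd_normE. Qed.

Lemma measurable_norm_powR q f : measurable_fun setT (fun x => f (x, 0)) ->
  measurable_fun setT (fun x => (`|f (x, 0)| `^ q)%:E).
Proof.
move=> mf; apply/measurable_EFinP; apply: (measurableT_comp (measurable_powR q)).
exact: measurableT_comp.
Qed.

Lemma bd_norm_le q f (D : R) : 1 <= q ->
  (\int[mu]_x (`|f (x, 0%R)| `^ q)%:E <= D%:E)%E ->
  (bd_norm (fun=> 0%R) q (EFin \o f) <= (D `^ q^-1)%:E)%E.
Proof.
move=> q1 h; rewrite bd_norm_EFin -poweR_EFin; apply: gt0_ler_poweR => //.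
- by rewrite invr_ge0 (le_trans _ q1).
- by rewrite in_itv/= leey andbT; apply: integral_ge0 => x _; rewrite lee_fin powR_ge0.
- rewrite in_itv/= leey andbT; apply: le_trans h.
  by apply: integral_ge0 => x _; rewrite lee_fin powR_ge0.
Qed.

Lemma bd_Lp_decay f q K : 1 <= q -> measurable_fun setT (fun x => f (x, 0)) ->
  (forall x, `|f (x, 0)| <= K * (1 + x ^+ 2)^-1) -> bd_Lp (fun=> 0) q f.
Proof.
move=> q1 mf fK; split; first exact: mf.
have q0 : 0 <= q by rewrite (le_trans _ q1).
have K0 : 0 <= K.
  by have := fK 0; rewrite expr0n addr0 invr1 mulr1; exact: le_trans.
suff h : (\int[mu]_x (`|f (x, 0%R)| `^ q)%:E <= (K `^ q * pi)%:E)%E.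
  exact: le_lt_trans (bd_norm_le q1 h) (ltry _).
apply: (@le_trans _ _ (\int[mu]_x ((K `^ q)%:E * ((1 + x ^+ 2)^-1)%:E)))%E.
  apply: ge0_le_integral => //.
  - exact: measurable_norm_powR.
  - by apply: emeasurable_funM => //; apply/measurable_EFinP; exact: measurable_oneDsqrV.
  - move=> x _; rewrite -EFinM lee_fin; have u0 := oneDsq_gt0 x.
    have u1 : 0 < (1 + x ^+ 2)^-1 <= 1.
      by rewrite invr_gt0 u0 invf_le1// lerDl sqr_ge0.
    apply: (@le_trans _ _ (((1 + x ^+ 2)^-1 * K) `^ q)).
      apply: ge0_ler_powR => //; rewrite ?nnegrE//; last by rewrite mulrC.
      by rewrite mulr_ge0// invr_ge0 ltW.
    by rewrite [leRHS]mulrC ge1r_powRZ.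
rewrite ge0_integralZl//; last 3 first.
- by apply/measurable_EFinP; exact: measurable_oneDsqrV.
- by move=> x _; rewrite lee_fin invr_ge0 ltW// oneDsq_gt0.
- by rewrite lee_fin powR_ge0.
by rewrite integral_oneDsqrV.
Qed.

Lemma decay_line x : decay x 0 = (1 + x ^+ 2)^-1 :> R.
Proof. by rewrite decayE expr0n addr0 invr1 mulr1. Qed.

Lemma line_integrableM (z g : R -> R) (K B : R) :
  measurable_fun setT z -> measurable_fun setT g ->
  (forall x, `|z x| <= K * (1 + x ^+ 2)^-1) -> (forall x, `|g x| <= B) ->
  mu.-integrable setT (EFin \o (fun x => z x * g x)).
Proof.
move=> mz mg zK gB.
apply: (@le_integrable _ _ R mu setT measurableT _
  (fun x => (`|K| * `|B|)%:E * ((1 + x ^+ 2)^-1)%:E)%E).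
- by apply/measurable_EFinP; exact: measurable_funM.
- move=> x _; have u : 0 <= (1 + x ^+ 2)^-1 by rewrite invr_ge0 ltW// oneDsq_gt0.
  rewrite -EFinM lee_fin [leRHS]ger0_norm; last by rewrite !mulr_ge0.
  rewrite normrM mulrAC ler_pM//.
    by rewrite (le_trans (zK x))// ler_wpM2r// ler_norm.
  by rewrite (le_trans (gB x))// ler_norm.
- by apply: integrableZl => //; exact: integrable_oneDsqrV.
Qed.

Lemma decay_locally_integrable (z : R -> R) K : measurable_fun setT z ->
  (forall x, `|z x| <= K * (1 + x ^+ 2)^-1) -> locally_integrable setT z.
Proof.
move=> mz zK; split => //; first exact: openT.
move=> A _ cA; have i1 : mu.-integrable setT (EFin \o z).
  have one (x : R) : `|cst (1 : R) x| <= 1 by rewrite normr1.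
  have := line_integrableM mz (measurable_cst _) zK one.
  by apply: eq_integrable => // x _ /=; rewrite mulr1.
have mA : measurable A by exact: compact_measurable.
have /integrableP[_] := @integrableS _ _ R mu setT A (EFin \o z) measurableT mA (@subsetT _ _) i1.
by [].
Qed.

(** The properties of a test function on the line that integration by parts
    uses. *)
Lemma test1_bounds psi : test1 psi -> exists M B,
  [/\ (forall x, is_derive x 1 psi (derive1 psi x)), continuous (derive1 psi),
      (forall x, M <= `|x| -> psi x = 0), (forall x, `|psi x| <= B) &
      (forall x, `|derive1 psi x| <= B)].
Proof.
move=> [dpsi [K [cK psi0]]].
have der (x : R) : is_derive x 1 psi (derive1 psi x).
  by rewrite derive1E; apply: derivableP; exact: (dpsi 0%N x).
have cpsi : continuous psi by move=> x; exact: is_derive1_continuous (der x).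
have cpsi' : continuous (derive1 psi).
  by move=> x; apply: differentiable_continuous; apply/derivable1_diffP; exact: (dpsi 1%N x).
have psi'0 x : ~ K x -> derive1 psi x = 0.
  move=> nKx; have oK : open (~` K).
    by apply: closed_openC; apply: compact_closed => //; exact: norm_hausdorff.
  have h : is_derive x 1 psi 0.
    apply: (@near_eq_is_derive _ _ _ (fun=> 0)).
    have : nbhs x (~` K) by exact: open_nbhs_nbhs.
    by apply: filterS => Y nKY; rewrite psi0.
  exact: is_derive_unique (der x) h.
have [B1 hB1] := continuous_compact_support_bounded cpsi cK psi0.
have [B2 hB2] := continuous_compact_support_bounded cpsi' cK psi'0.
have [M [Mr hM]] := compact_bounded cK.
exists (`|M| + 2), (`|B1| + `|B2|); split => //.
- move=> x Mx; apply: psi0 => Kx.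
  have := hM (`|M| + 1); rewrite (le_lt_trans (ler_norm M)) ?ltrDl//.
  by move=> /(_ isT) /(_ _ Kx) /=; lra.
- by move=> x; rewrite (le_trans (hB1 x))// (le_trans (ler_norm _))// lerDl.
- by move=> x; rewrite (le_trans (hB2 x))// (le_trans (ler_norm _))// lerDr.
Qed.

Section Data.
Variables H0 H1 H2 : R -> R -> R * R.
Hypothesis hP : profile H0 H1 H2.
Variable kap : R.

(** The tangential derivative of the Dirichlet data, which is also the data of
    the Neumann problem. *)
Definition data x : R := - im H1 x 0 - kap * Num.sg x * re H1 x 0.

Lemma dataN x : data (- x) = - data x.
Proof.
have [r1 r2] := profile_reflects1 hP x 0.
by rewrite /data /re /im r1 r2 sgrN; ring.
Qed.

Lemma measurable_data : measurable_fun setT data.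
Proof.
have [m1 m2] := profile_measurable1 hP.
apply: measurable_funB.
  by apply: measurableT_comp => //; exact: (@measurable_section_x _ (fun X => (H1 X.1 X.2).2)).
apply: measurable_funM; last exact: (@measurable_section_x _ (fun X => (H1 X.1 X.2).1)).
by apply: measurable_funM => //; exact: measurable_sgr.
Qed.

Let f := pot H0 kap 1 (3 * kap).

Lemma pot_lineE x : f (x, 0) = re H0 x 0 - kap * Num.sg x * im H0 x 0.
Proof. by rewrite /f /pot /kink /= potcoefE mul1r mulNr. Qed.

Lemma measurable_pot_line : measurable_fun setT (fun x => f (x, 0)).
Proof.
have [t0 _ _ _ _] := dominated_flux hP kap 1 (3 * kap); have [m _] := t0.
exact: measurable_section_x m.
Qed.

Lemma data_decay : exists K, forall x,
  `|f (x, 0)| <= K * decay x 0 ^+ 2 /\ `|data x| <= K * decay x 0 ^+ 2.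
Proof.
have [K0 h0] := profile_decays0 hP; have [K1 h1] := profile_decays1 hP.
have st (y z s D K : R) : 0 <= D -> `|y| <= K * D -> `|z| <= K * D -> `|s| <= 1 ->
    `|y - kap * s * z| <= (1 + `|kap|) * (K * D).
  move=> D0 hy hz hs; rewrite (le_trans (ler_normB _ _))// mulrDl mul1r lerD// !normrM.
  by rewrite -mulrA ler_wpM2l// -[leRHS]mul1r ler_pM.
have sg1 x : `|Num.sg x| <= 1 by rewrite normr_sg; case: (x != 0).
exists (Num.max ((1 + `|kap|) * K0) ((1 + `|kap|) * K1)) => x.
have D0 := sqr_ge0 (decay x 0); split.
  have [hr hi] := h0 x 0 (lexx _); rewrite pot_lineE.
  by rewrite (le_trans (st _ _ _ _ _ D0 hr hi (sg1 x)))// mulrA ler_wpM2r// le_max lexx.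
have [hr hi] := h1 x 0 (lexx _); rewrite -normrN in hi; rewrite /data.
rewrite (le_trans (st _ _ _ _ _ D0 hi hr (sg1 x)))//.
by rewrite mulrA ler_wpM2r// le_max lexx orbT.
Qed.

Lemma data_le : exists K, forall x,
  `|f (x, 0)| <= K * (1 + x ^+ 2)^-1 /\ `|data x| <= K * (1 + x ^+ 2)^-1.
Proof.
have [K hK] := data_decay; exists `|K| => x; have [h1 h2] := hK x.
have d0 := decay_gt0 x 0; have d1 := decay_le1 x 0; rewrite -decay_line.
have le : K * decay x 0 ^+ 2 <= `|K| * decay x 0.
  rewrite (le_trans (ler_wpM2r (sqr_ge0 _) (ler_norm K)))// ler_wpM2l//.
  by rewrite expr2 ler_piMl// ltW.
by split; apply: le_trans le.
Qed.

Lemma pot_bd_Lp q : 1 <= q -> bd_Lp (fun=> 0) q f.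
Proof.
move=> q1; have [K hK] := data_le.
by apply: (bd_Lp_decay (K := K)) => //; [exact: measurable_pot_line|move=> x; exact: (hK x).1].
Qed.

Lemma data_bd_Lp q : 1 <= q -> bd_Lp (fun=> 0) q (fun X => data X.1).
Proof.
move=> q1; have [K hK] := data_le.
by apply: (bd_Lp_decay (K := K)) => //; [exact: measurable_data|move=> x; exact: (hK x).2].
Qed.

(** Integration by parts on either side of the origin; the jump of the coefficient
    is harmless because the imaginary part vanishes there. *)
Lemma pot_tan_deriv : tan_deriv (fun=> 0) f (fun X => data X.1).
Proof.
have [K hK] := data_le; have mf := measurable_pot_line; have md := measurable_data.
rewrite /tan_deriv; have -> : (fun x => pull (fun=> 0) (fun X => data X.1) x * Defs.arc (fun=> 0) x) = data.
  by apply/funext => x; rewrite arc0 mulr1.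
split.
- by apply: (decay_locally_integrable (K := K)) => // x; exact: (hK x).1.
- by apply: (decay_locally_integrable (K := K)) => // x; exact: (hK x).2.
move=> psi /test1_bounds[M [B [der cpsi' psi0 psiB psi'B]]].
have cpsi : continuous psi by move=> x; exact: is_derive1_continuous (der x).
have mpsi : measurable_fun setT psi by exact: continuous_measurable_fun.
have mpsi' : measurable_fun setT (derive1 psi) by exact: continuous_measurable_fun.
rewrite -[RHS]sub0e; apply: integral_split => //.
- exact: (line_integrableM mf mpsi' (fun x => (hK x).1) psi'B).
- exact: (line_integrableM md mpsi (fun x => (hK x).2) psiB).
pose W s x := (re H0 x 0 + s * im H0 x 0) * psi x.
pose w s x := (- im H1 x 0 + s * re H1 x 0) * psi x + (re H0 x 0 + s * im H0 x 0) * derive1 psi x.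
have d01 x := profile_holo01 hP x (lexx 0); have d12 x := profile_holo12 hP x (lexx 0).
have dW s (x : R) : is_derive x 1 (W s) (w s x).
  have [h1 h2 _ _] := d01 x.
  have h : is_derive x 1 (fun y => re H0 y 0 + s * im H0 y 0)
      (- im H1 x 0 + s * re H1 x 0) by exact: (is_deriveD h1 (is_deriveZ s h2)).
  apply: is_derive_eq (is_deriveM h (der x)) _.
  by rewrite /GRing.scale /= /w; ring.
have cw s (x : R) : {for x, continuous (w s)}.
  have [h1 h2 _ _] := d01 x; have [h3 h4 _ _] := d12 x.
  have c1 := is_derive1_continuous h1; have c2 := is_derive1_continuous h2.
  have c3 := is_derive1_continuous h3; have c4 := is_derive1_continuous h4.
  apply: cvgD; apply: cvgM.
  - by apply: cvgD; [exact: cvgN|apply: cvgM => //; exact: cvg_cst].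
  - exact: cpsi.
  - by apply: cvgD => //; apply: cvgM => //; exact: cvg_cst.
  - exact: cpsi'.
apply: (@integral_derive_kink _ _ (W kap) (w kap) (W (- kap)) (w (- kap)) M).
- by apply: measurable_funD; exact: measurable_funM.
- by move=> x x0; rewrite /pull /= pot_lineE /data /w ltr0_sg//; ring.
- by move=> x x0; rewrite /pull /= pot_lineE /data /w gtr0_sg//; ring.
- exact: cw.
- exact: cw.
- by move=> x xM; rewrite /W psi0// mulr0.
- by move=> x xM; rewrite /W psi0// mulr0.
- by rewrite /W (reflects_im0 0 (profile_reflects0 hP)) !mulr0.
Qed.

Lemma pot_bd_W1 q : 1 <= q -> bd_W1 (fun=> 0) q f.
Proof.
move=> q1; split; first exact: pot_bd_Lp.
by exists (fun X => data X.1); split; [exact: pot_tan_deriv|exact: data_bd_Lp].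
Qed.

End Data.
End BoundaryData.

(** * The Dirichlet and the Neumann problem *)

Section Solutions.
Context {R : realType}.
Notation mu := (@lebesgue_measure R).
Notation mu2 := (@lebesgue_measure R \x @lebesgue_measure R)%E.
Implicit Types (f g h : R * R -> R) (x t : R).

Lemma Wtilde_Wdot f (G : R * R -> R * R) : Wtilde (fun=> 0) f G -> Wdot (fun=> 0) f G.
Proof. by move=> [? ? ?]; split. Qed.

Lemma truncate_le n (y : R) : `|truncate n y| <= `|y|.
Proof.
rewrite /truncate; move: (n%:R : R) (ler0n R n) => m n0.
have [h1|h1] := leP m y.
  rewrite max_r; last by lra.
  by rewrite !ger0_norm// (le_trans n0).
have [h2|h2] := leP (- m) y; first by [].
by rewrite normrN ger0_norm//; have := ler_norm (- y); rewrite normrN; lra.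
Qed.

Lemma truncate_cvg (y : R) : truncate n y @[n --> \oo] --> y.
Proof.
apply: cvg_near_cst; near=> n.
have yn : `|y| <= n%:R by near: n; exact: nbhs_infty_ger.
rewrite /truncate; move: yn; rewrite ler_norml => /andP[h1 h2].
by rewrite min_r// max_r.
Unshelve. all: by end_near. Qed.

Lemma measurable_truncate n : measurable_fun setT (@truncate R n).
Proof. by apply: measurable_maxr => //; exact: measurable_minr. Qed.

(** A single point is null. *)
Lemma integral_eq_off0 (u v : R -> R) : measurable_fun setT u -> measurable_fun setT v ->
  (forall x, x != 0 -> u x = v x) ->
  (\int[mu]_x (u x)%:E = \int[mu]_x (v x)%:E)%E.
Proof.
move=> mu_ mv uv; rewrite !integral_line_split//; congr (_ + _)%E; apply: eq_integral => x;
  rewrite inE/= in_itv/= ?andbT => x0; rewrite uv//; [by rewrite lt_eqF|by rewrite gt_eqF].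
Qed.

Section Profile.
Variables H0 H1 H2 : R -> R -> R * R.
Hypothesis hP : profile H0 H1 H2.
Variable kap : R.

(** Functions of vanishing trace see no boundary flux. *)
Lemma pot_dirichlet : (forall n, test2 setT (approx H0 kap n)) ->
  let f := pot H0 kap 1 (3 * kap) in
  dirichlet_solution (fun=> 0) (fun X => coefmx kap X.1) f f
    (potgrad H1 kap 1 (3 * kap)).
Proof.
move=> tF f; split.
- exact: (pot_Wtilde hP).
- exact: (pot_trace hP tF).
- move=> v H [wt tr]; rewrite (pot_energy hP _ _ _ (Wtilde_Wdot wt) tr).
    by apply: integral0_eq => x _; rewrite mulr0.
  apply: eq_integrable (integrable0 mu setT) => // x _.
  by rewrite mulr0.
Qed.

(* With q = 1 this is the amplitude for which fluxcoef is odd. *)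
Let a := kap / (1 + 4 * kap ^+ 2).

Lemma fluxcoefE x : x != 0 -> fluxcoef kap a 1 x = - (kap * Num.sg x).
Proof.
have k0 : 1 + 4 * kap ^+ 2 != 0 by rewrite gt_eqF// ltr_pwDl// mulr_ge0// sqr_ge0.
rewrite /fluxcoef stretchE /a; have [x0|x0|//] := ltgtP x 0 => _.
- by rewrite ltr0_sg//; field.
- by rewrite gtr0_sg//; field.
Qed.

(** Here the conormal derivative is the data, and since it is integrable against
    the trace, the truncated pairings converge by dominated convergence. *)
Lemma pot_neumann : neumann_solution (fun=> 0) (fun X => coefmx kap X.1)
  (fun X => data H1 kap X.1) (pot H0 kap a 1) (potgrad H1 kap a 1).
Proof.
split; first exact: (pot_Wdot hP).
move=> v H h wd tr; have hi := trace_integrable wd tr.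
have mh : measurable_fun setT (fun x => h (x, 0)) by have [+ _] := tr.
have md := measurable_data hP kap.
have [K hK] := data_decay hP kap.
rewrite (pot_energy hP _ _ _ wd tr hi).
have mfl : measurable_fun setT (fun x => flux_x H1 kap a 1 x 0).
  have [_ _ _ _ [m _]] := dominated_flux hP kap a 1; exact: measurable_section_x m.
rewrite (@integral_eq_off0 _ (fun x => data H1 kap x * h (x, 0))); last first.
- move=> x x0; congr (_ * _); rewrite /flux_x /kink /data fluxcoefE//; ring.
- exact: measurable_funM.
- exact: measurable_funM.
rewrite /bd_pairing; rewrite (_ : (fun n => _) = fun n =>
    (\int[mu]_x (data H1 kap x * truncate n (h (x, 0)))%:E)%E); last first.
  by apply/funext => n; rewrite bd_intE.
apply: (@dominated_cvg _ _ R mu setT measurableT _ _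
    (fun x => (`|K|%:E * `|(decay x 0 ^+ 2 * h (x, 0))%:E|)%E)).
- move=> n; apply/measurable_EFinP; apply: measurable_funM => //.
  by apply: measurableT_comp mh; exact: measurable_truncate.
- move=> x _; apply/cvg_EFin; first by near=> n.
  by apply: cvgM; [exact: cvg_cst|exact: truncate_cvg].
- by [].
- by apply: integrableZl => //; exact: integrable_abse.
- move=> n x _; rewrite -EFinM lee_fin (normrM (data H1 kap x)) (normrM (decay x 0 ^+ 2)).
  rewrite mulrA; apply: ler_pM => //; last exact: truncate_le.
  have [_ h2] := hK x; rewrite (le_trans h2)// (ger0_norm (sqr_ge0 _)).
  by rewrite ler_wpM2r ?sqr_ge0// ler_norm.
Unshelve. all: by end_near. Qed.

End Profile.
End Solutions.

(** * Uniform bound of the data *)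

Section DataBound.
Context {R : realType}.
Notation mu := (@lebesgue_measure R).
Implicit Types (x e : R).

Lemma norm_le_of_derive (f f' : R -> R) x : f 0 = 0 ->
  (forall y : R, is_derive y 1 f (f' y)) -> (forall y, `|f' y| <= 1) -> `|f x| <= `|x|.
Proof.
move=> f0 df f'1; have con (a b : R) : {within `[a, b], continuous f}.
  by apply: continuous_subspaceT => y; exact: is_derive1_continuous (df y).
have [x0|x0] := leP 0 x.
  have [c _] := MVT_segment x0 (fun y _ => df y) (con _ _).
  by rewrite f0 !subr0 => ->; rewrite normrM ler_piMl.
have [c _] := MVT_segment (ltW x0) (fun y _ => df y) (con _ _).
rewrite f0 !sub0r => /eqP; rewrite eqr_oppLR => /eqP ->.
by rewrite normrN normrM normrN ler_piMl.
Qed.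

Lemma norm_sin_le x : `|sin x| <= `|x|.
Proof.
apply: (norm_le_of_derive x (sin0 R) (fun y => is_derive_sin y)) => y.
exact: cos_max.
Qed.

Lemma norm_atan_le x : `|atan x| <= `|x|.
Proof.
apply: (norm_le_of_derive x (atan0 R) (fun y => is_derive1_atan y)) => y.
rewrite ger0_norm ?invr_ge0 ?addr_ge0 ?sqr_ge0//.
by rewrite invf_le1 ?lerDl ?sqr_ge0// ltr_pwDl ?sqr_ge0.
Qed.

Lemma sin_mono (x y : R) : 0 <= x -> x <= y -> y <= pi / 2 -> sin x <= sin y.
Proof.
have p0 := pi_gt0 R; move=> x0; rewrite le_eqVlt => /orP[/eqP ->//|xy] yp.
by rewrite ltW// ltr_sin ?in_itv/=//; apply/andP; split; lra.
Qed.

Lemma integral_poisson e : 0 < e ->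
  (\int[mu]_x (e / (x ^+ 2 + e ^+ 2))%:E = pi%:E)%E.
Proof.
move=> e0; have p (x : R) : 0 < x ^+ 2 + e ^+ 2 by exact: sqD_gt0.
have c : continuous (fun x : R => e / (x ^+ 2 + e ^+ 2)).
  move=> x; apply: cvgM; first exact: cvg_cst.
  apply: cvgV; first by rewrite gt_eqF.
  exact: is_derive1_continuous (is_derive_sqD x (e ^+ 2)).
have f0 (x : R) : 0 <= e / (x ^+ 2 + e ^+ 2) by rewrite divr_ge0// ltW.
rewrite (@ge0_symfun_integralT _ (fun x => e / (x ^+ 2 + e ^+ 2)))//; last first.
  by move=> x /=; rewrite sqrrN.
have -> : [set x : R | (0 <= x)%R] = `[0%R, +oo[%classic.
  by apply/seteqP; split => x /=; rewrite in_itv/= andbT.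
have der (x : R) : is_derive x 1 (fun y => atan (y / e)) (e / (x ^+ 2 + e ^+ 2)).
  exact: is_derive_carg_x.
rewrite (@ge0_continuous_FTC2y _ _ (fun x => atan (x / e)) 0 (pi / 2))//.
- rewrite mul0r atan0 sube0 -EFinM; congr EFin; by field.
- exact: continuous_subspaceT.
- apply: cvg_comp (@cvgy_atan R); apply: gt0_cvgMly; last exact: cvg_id.
  by rewrite invr_gt0.
- by apply: cvg_at_right_filter; exact: is_derive1_continuous (der 0).
- by move=> x _; rewrite derive1E; have [_ ->] := der x.
Qed.

Variable p : R.
Hypothesis p1 : 1 < p.

Definition alpha : R := 1 - p^-1.

Lemma alpha_itv : 0 < alpha < 1.
Proof.
have p0 : 0 < p by rewrite (lt_trans _ p1).
by rewrite /alpha subr_gt0 invf_lt1// p1/= gtrBl invr_gt0.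
Qed.

Definition kappa : R := cos (alpha * (pi / 2)) / sin (alpha * (pi / 2)).

Lemma sin_alpha_gt0 : 0 < sin (alpha * (pi / 2)).
Proof.
have /andP[a0 a1] := alpha_itv; have p0 := pi_gt0 R.
by apply: sin_gt0_pi; apply/andP; split; nra.
Qed.

Lemma cos_alpha_gt0 : 0 < cos (alpha * (pi / 2)).
Proof.
have /andP[a0 a1] := alpha_itv; have p0 := pi_gt0 R.
by apply: cos_gt0_pihalf; apply/andP; split; nra.
Qed.

Lemma kappa_gt0 : 0 < kappa.
Proof. by rewrite divr_gt0// ?cos_alpha_gt0// sin_alpha_gt0. Qed.

(** kappa is chosen so that the leading part of the data vanishes as e tends
    to 0, away from the origin. *)
Lemma kappa_cancels e x : 0 < e -> 0 < x ->
  `|sin ((alpha - 1) * carg x e) + kappa * cos ((alpha - 1) * carg x e)| <=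
  e / cabs 1 x e / sin (alpha * (pi / 2)).
Proof.
move=> e0 x0; have /andP[a0 a1] := alpha_itv; have p0 := pi_gt0 R.
have s0 := sin_alpha_gt0; set w := pi / 2 - carg x e.
have th : 0 <= carg x e by rewrite /carg -(atan0 R) le_atan// divr_ge0// ltW.
have th2 : carg x e < pi / 2 by exact: atan_ltpi2.
(* The left-hand side is cos(alpha pi/2 - phi) / sin(alpha pi/2) for the angle
   phi = (alpha - 1) carg x e, and (1 - alpha) w is complementary to the angle. *)
have -> : sin ((alpha - 1) * carg x e) + kappa * cos ((alpha - 1) * carg x e) =
    sin ((1 - alpha) * w) / sin (alpha * (pi / 2)).
  have -> : (1 - alpha) * w = pi / 2 - (alpha * (pi / 2) - (alpha - 1) * carg x e).
    by rewrite /w; ring.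
  rewrite sinB sin_pihalf cos_pihalf mul1r mul0r subr0 cosB /kappa.
  by field; rewrite gt_eqF.
have sw : 0 <= sin ((1 - alpha) * w).
  by apply: sin_ge0_pi; apply/andP; rewrite /w; split; nra.
rewrite ger0_norm; last by rewrite divr_ge0// ltW.
rewrite ler_pM2r ?invr_gt0// -(cos_carg _ e0).
have -> : cos (carg x e) = sin w.
  by rewrite /w sinB sin_pihalf cos_pihalf mul1r mul0r subr0.
by apply: sin_mono; rewrite /w; nra.
Qed.

Lemma cmul_cpow_le a b x s t : `|re (fun x t => cmul (cpow a x (t + s)) (cpow b x (t + 1))) x t| <=
    cabs a x (t + s) * cabs b x (t + 1) /\
  `|im (fun x t => cmul (cpow a x (t + s)) (cpow b x (t + 1))) x t| <=
    cabs a x (t + s) * cabs b x (t + 1).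
Proof.
have c0 := mulr_gt0 (cabs_gt0 a x (t + s)) (cabs_gt0 b x (t + 1)).
have h : csq (cmul (cpow a x (t + s)) (cpow b x (t + 1))) <=
    (cabs a x (t + s) * cabs b x (t + 1)) ^+ 2 by rewrite csq_cmul !csq_cpow exprMn.
exact: (csq_le (ltW c0) h).
Qed.

(** On the right half line the data are, up to sign, al T1 - 9 T2, where T1 comes
    from differentiating the power and T2 from the decaying factor. *)
Lemma data_le_pos e x : 0 < e -> e <= 1 -> 0 < x ->
  `|data (prof1 alpha e) kappa x| <=
  e * cabs (alpha - 2) x e / sin (alpha * (pi / 2)) +
  18 * (1 + kappa) * (1 + x ^+ 2)^-1.
Proof.
move=> e0 e1 x0; have /andP[a0 a1] := alpha_itv; have k0 := kappa_gt0.
set u := (1 + x ^+ 2)^-1; set A := e * _ / _.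
have u0 : 0 <= u by rewrite invr_ge0 ltW// oneDsq_gt0.
have uE : cabs 1 x 1 * cabs (- 9) x 1 <= u.
  rewrite -cabsD (_ : 1 + -9 = - 8 :> R); last by ring.
  have := @cabs_decay R x 0 (lexx _); rewrite add0r => /le_trans; apply.
  have d0 := decay_gt0 x 0.
  by rewrite /u -decay_line expr2 ler_piMl ?decay_le1 ?(ltW d0)//.
have rE : cabs alpha x e <= cabs 1 x 1.
  apply: (@le_trans _ _ (cabs alpha x 1)).
    by apply: cabs_mono => //; [exact: ltW|rewrite lerD2l ler_sqr ?nnegrE ?(ltW e0)//].
  by apply: cabs_exp_mono => //; exact: ltW.
have v1 : cabs (- 9) x 1 <= 1.
  by have := @cabs_exp_mono R (- 9) 0 x 1; rewrite cabs0; apply => //; rewrite oppr_le0.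
have xr : x <= cabs 1 x e.
  by rewrite cabs1// -[leLHS](gtr0_norm x0) -sqrtr_sqr ler_wsqrtr// lerDl sqr_ge0.
have r1 := cabs_gt0 (alpha - 1) x e; have v0 := cabs_gt0 (- 9) x 1.
have z0 := cabs_gt0 (- 10) x 1; have rho0 := cabs_gt0 1 x e.
pose T1 := im (term alpha e 1 0) x 0 + kappa * re (term alpha e 1 0) x 0.
pose T2 := im (term alpha e 0 1) x 0 + kappa * re (term alpha e 0 1) x 0.
have dE : data (prof1 alpha e) kappa x = - (alpha * T1 - 9 * T2).
  by rewrite /data gtr0_sg// /T1 /T2 /prof1 /cadd /cscale /re /im /=; ring.
have h2 : `|T2| <= (1 + kappa) * u.
  have [b1 b2] := @cmul_cpow_le (alpha - 0) (- 9 - 1) x e 0.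
  rewrite /T2 (le_trans (ler_normD _ _))// mulrDl mul1r.
  have bu : cabs (alpha - 0) x (0 + e) * cabs (- 9 - 1) x (0 + 1) <= u.
    rewrite !add0r subr0 (le_trans _ uE)//.
    apply: (ler_pM (ltW (cabs_gt0 _ _ _)) (ltW (cabs_gt0 _ _ _)) rE).
    by apply: cabs_exp_mono => //; lra.
  apply: lerD; first exact: le_trans b2 bu.
  by rewrite normrM (gtr0_norm k0) ler_wpM2l ?(ltW k0)//; exact: le_trans b1 bu.
have h1 : `|T1| <= A + 9 * (1 + kappa) * u.
  set ph := (alpha - 1) * carg x e; set ps := (- 9) * carg x 1.
  have E : T1 = cabs (- 9) x 1 * cos ps * (cabs (alpha - 1) x e * (sin ph + kappa * cos ph)) +
      cabs (- 9) x 1 * sin ps * (cabs (alpha - 1) x e * (cos ph - kappa * sin ph)).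
    rewrite /T1 /term /cmul /cpow /re /im /= !add0r !subr0 -/ph -/ps; ring.
  rewrite E (le_trans (ler_normD _ _))//; apply: lerD.
    rewrite !normrM (gtr0_norm v0) (gtr0_norm r1).
    have c1 : cabs (- 9) x 1 * `|cos ps| <= 1.
      exact: (mulr_ile1 (ltW v0) (normr_ge0 _) v1 (cos_max _)).
    apply: (@le_trans _ _ (1 * (cabs (alpha - 1) x e * `|sin ph + kappa * cos ph|))).
      by rewrite ler_wpM2r// mulr_ge0// ltW.
    rewrite mul1r (le_trans (ler_wpM2l (ltW r1) (kappa_cancels e0 x0)))//.
    rewrite /A; have -> : cabs (alpha - 2) x e = cabs (alpha - 1) x e / cabs 1 x e.
      have ea : alpha - 2 = alpha - 1 + - 1 by ring.
      by rewrite ea (cabsD (alpha - 1) (- 1)) (cabsN 1).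
    rewrite le_eqVlt; apply/orP; left; apply/eqP.
    by field; rewrite !gt_eqF ?sin_alpha_gt0.
  rewrite !normrM (gtr0_norm v0) (gtr0_norm r1).
  have s1 : `|sin ps| <= 9 * x.
    rewrite (le_trans (norm_sin_le _))// /ps normrM normrN (ger0_norm (_ : 0 <= 9))//.
    by rewrite ler_wpM2l// /carg divr1 (le_trans (norm_atan_le _))// gtr0_norm.
  have s2 : `|cos ph - kappa * sin ph| <= 1 + kappa.
    rewrite (le_trans (ler_normB _ _))// lerD ?cos_max// normrM (gtr0_norm k0).
    by rewrite ler_piMr ?sin_max// ltW.
  have s3 : cabs (- 9) x 1 * (x * cabs (alpha - 1) x e) <= u.
    apply: le_trans uE; rewrite [leRHS]mulrC ler_wpM2l ?(ltW v0)//.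
    apply: le_trans rE; have -> : cabs alpha x e = cabs (alpha - 1) x e * cabs 1 x e.
      by rewrite -cabsD subrK.
    rewrite mulrC; apply: ler_wpM2l; [exact: ltW|exact: xr].
  apply: (@le_trans _ _ (cabs (- 9) x 1 * (9 * x) * (cabs (alpha - 1) x e * (1 + kappa)))).
    apply: ler_pM; rewrite ?mulr_ge0// ?(ltW v0)// ?(ltW r1)//.
      by rewrite ler_wpM2l// ltW.
    by rewrite ler_wpM2l// ltW.
  have -> : cabs (- 9) x 1 * (9 * x) * (cabs (alpha - 1) x e * (1 + kappa)) =
    9 * (1 + kappa) * (cabs (- 9) x 1 * (x * cabs (alpha - 1) x e)) by ring.
  by rewrite ler_wpM2l// mulr_ge0// addr_ge0// ltW.
have A0 : 0 <= A.
  by rewrite divr_ge0 ?mulr_ge0 ?(ltW e0) ?(ltW (cabs_gt0 _ _ _))// ltW// sin_alpha_gt0.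
rewrite dE normrN (le_trans (ler_normB _ _))// !normrM (gtr0_norm a0).
rewrite (ger0_norm (_ : 0 <= 9))//.
have g1 : alpha * `|T1| <= `|T1| by rewrite ler_piMl// ltW.
have g2 : 0 <= (1 + kappa) * u by rewrite mulr_ge0// addr_ge0// ltW.
by clear -g1 g2 h1 h2; lra.
Qed.

Lemma data_bound e x : 0 < e -> e <= 1 ->
  `|data (prof1 alpha e) kappa x| <=
  e * cabs (alpha - 2) x e / sin (alpha * (pi / 2)) +
  18 * (1 + kappa) * (1 + x ^+ 2)^-1.
Proof.
move=> e0 e1; have hP := prof_is_profile (andP alpha_itv).1 (andP alpha_itv).2 e0 e1.
have [x0|x0|->] := ltgtP x 0.
- have xN : 0 < - x by rewrite oppr_gt0.
  have := data_le_pos e0 e1 xN; rewrite (dataN hP) normrN sqrrN.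
  by rewrite /cabs sqrrN.
- exact: data_le_pos.
- rewrite /data sgr0 mulr0 mul0r subr0 normrN.
  rewrite (reflects_im0 0 (profile_reflects1 hP)) normr0.
  have k0 := kappa_gt0; have s0 := sin_alpha_gt0.
  apply: addr_ge0.
    by rewrite divr_ge0 ?mulr_ge0 ?(ltW e0) ?(ltW (cabs_gt0 _ _ _))// ltW.
  by rewrite !mulr_ge0 ?addr_ge0 ?(ltW k0)// invr_ge0 ltW// oneDsq_gt0.
Qed.

(** The exponent of the singularity of the data is the one for which the p-th
    power of the leading part is at most a Poisson kernel. *)
Lemma poisson_power e x : 0 < e ->
  (e * cabs (alpha - 2) x e) `^ p <= e / (x ^+ 2 + e ^+ 2).
Proof.
move=> e0; have q := sqD_gt0 x e0; have p0 : 0 < p by rewrite (lt_trans _ p1).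
set l := ln (x ^+ 2 + e ^+ 2).
have el : 2 * ln e <= l.
  rewrite /l mulr_natl -lnXn// ler_ln ?posrE ?exprn_gt0//.
  by rewrite lerDr sqr_ge0.
have -> : e * cabs (alpha - 2) x e = expR (ln e + (alpha - 2) / 2 * l).
  by rewrite expRD lnK.
have -> : e / (x ^+ 2 + e ^+ 2) = expR (ln e - l) by rewrite expRB !lnK.
rewrite -expRM ler_expR.
have -> : (ln e + (alpha - 2) / 2 * l) * p = p * ln e - (p + 1) / 2 * l.
  by rewrite /alpha; field; rewrite gt_eqF.
have pp : 0 <= p - 1 by rewrite subr_ge0 ltW.
have ll : 0 <= l - 2 * ln e by rewrite subr_ge0.
by have := mulr_ge0 pp ll; lra.
Qed.

Lemma powRD_le (y z : R) : 0 <= y -> 0 <= z -> (y + z) `^ p <= 2 `^ p * (y `^ p + z `^ p).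
Proof.
move=> y0 z0; have p0 : 0 <= p by rewrite ltW// (lt_trans _ p1).
have mono (c d : R) : 0 <= c -> c <= d -> c `^ p <= d `^ p.
  by move=> c0 cd; apply: ge0_ler_powR => //; rewrite nnegrE// (le_trans c0).
have [yz|zy] := leP y z.
  apply: (@le_trans _ _ ((2 * z) `^ p)); first by apply: mono; [exact: addr_ge0|lra].
  by rewrite powRM// ler_wpM2l ?powR_ge0// lerDr powR_ge0.
apply: (@le_trans _ _ ((2 * y) `^ p)); first by apply: mono; [exact: addr_ge0|lra].
by rewrite powRM// ler_wpM2l ?powR_ge0// lerDl powR_ge0.
Qed.

(** The p-th power of the data is dominated by a Poisson kernel and a fixed
    integrable function. *)
Lemma data_norm_bounded : exists D : R, forall e, 0 < e -> e <= 1 ->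
  (bd_norm (fun=> 0%R) p (EFin \o (fun X : R * R => data (prof1 alpha e) kappa X.1)) <= D%:E)%E.
Proof.
have p0 : 0 <= p by rewrite ltW// (lt_trans _ p1).
have s0 := sin_alpha_gt0; have k0 := kappa_gt0.
pose c1 := 2 `^ p * (sin (alpha * (pi / 2)))^-1 `^ p.
pose c2 := 2 `^ p * (18 * (1 + kappa)) `^ p.
exists ((c1 * pi + c2 * pi) `^ p^-1) => e e0 e1; apply: bd_norm_le; first exact: ltW.
have hP := prof_is_profile (andP alpha_itv).1 (andP alpha_itv).2 e0 e1.
have m1 : measurable_fun setT (fun x : R => (e / (x ^+ 2 + e ^+ 2))%:E).
  apply/measurable_EFinP; apply: measurable_funM => //.
  by apply: (measurableT_comp measurable_invr); apply: measurable_funD.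
have m2 : measurable_fun setT (fun x : R => ((1 + x ^+ 2)^-1)%:E).
  by apply/measurable_EFinP; exact: measurable_oneDsqrV.
have c10 : 0 <= c1 by rewrite mulr_ge0 ?powR_ge0.
have c20 : 0 <= c2 by rewrite mulr_ge0 ?powR_ge0.
apply: (@le_trans _ _ (\int[mu]_x (c1%:E * (e / (x ^+ 2 + e ^+ 2))%:E +
    c2%:E * ((1 + x ^+ 2)^-1)%:E)))%E.
  apply: ge0_le_integral => //.
  - exact: (@measurable_norm_powR _ p (fun X => data (prof1 alpha e) kappa X.1))
      (measurable_data hP kappa).
  - by apply: emeasurable_funD; exact: emeasurable_funM.
  - move=> x _; rewrite -!EFinM -EFinD lee_fin /=.
    have u0 := oneDsq_gt0 x.
    have u1 : 0 < (1 + x ^+ 2)^-1 <= 1.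
      by rewrite invr_gt0 u0 invf_le1// lerDl sqr_ge0.
    have A0 : 0 <= e * cabs (alpha - 2) x e.
      by rewrite mulr_ge0 ?(ltW e0) ?(ltW (cabs_gt0 _ _ _)).
    have sV : 0 <= (sin (alpha * (pi / 2)))^-1 by rewrite invr_ge0 ltW.
    have K0 : 0 <= 18 * (1 + kappa) by rewrite mulr_ge0// addr_ge0// ltW.
    have B0 : 0 <= 18 * (1 + kappa) * (1 + x ^+ 2)^-1.
      by rewrite mulr_ge0// invr_ge0 ltW.
    have AB : 0 <= e * cabs (alpha - 2) x e / sin (alpha * (pi / 2)) by rewrite mulr_ge0.
    apply: (@le_trans _ _ ((e * cabs (alpha - 2) x e / sin (alpha * (pi / 2)) +
        18 * (1 + kappa) * (1 + x ^+ 2)^-1) `^ p)).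
      by apply: ge0_ler_powR => //; rewrite ?nnegrE ?addr_ge0//; exact: data_bound.
    rewrite (le_trans (powRD_le AB B0))// mulrDr lerD//.
      rewrite /c1 -[leRHS]mulrA; apply: ler_wpM2l; first exact: powR_ge0.
      rewrite powRM// [leRHS]mulrC; apply: ler_wpM2r; first exact: powR_ge0.
      exact: poisson_power.
    rewrite /c2 -[leRHS]mulrA; apply: ler_wpM2l; first exact: powR_ge0.
    rewrite [leRHS]mulrC [18 * _ * _]mulrC.
    by apply: ge1r_powRZ => //; exact: ltW.
rewrite ge0_integralD//; last 4 first.
- by move=> x _; rewrite mule_ge0// lee_fin// divr_ge0// ?ltW// sqD_gt0.
- exact: emeasurable_funM.
- by move=> x _; rewrite mule_ge0// lee_fin// invr_ge0 ltW// oneDsq_gt0.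
- exact: emeasurable_funM.
rewrite !ge0_integralZl//; last 2 first.
- by move=> x _; rewrite lee_fin invr_ge0 ltW// oneDsq_gt0.
- by move=> x _; rewrite lee_fin divr_ge0// ?ltW// sqD_gt0.
by rewrite integral_poisson// integral_oneDsqrV.
Qed.

End DataBound.

(** * Blow-up of the maximal function *)

Section MaximalFunction.
Context {R : realType}.
Notation mu := (@lebesgue_measure R).
Notation mu2 := (@lebesgue_measure R \x @lebesgue_measure R)%E.
Implicit Types (w : R * R -> R * R) (a x t e : R).

(** The maximal function need not be measurable for the domination of its
    integral from below. *)
Lemma ge0_integral_mono d (T : measurableType d) (nu : {measure set T -> \bar R})
    (f g : T -> \bar R) : (forall y, (0 <= f y)%E) -> (forall y, (f y <= g y)%E) ->
  (\int[nu]_x f x <= \int[nu]_x g x)%E.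
Proof.
move=> f0 fg; have g0 y : (0 <= g y)%E by exact: le_trans (f0 y) (fg y).
rewrite /integral !patch_setT.
have P (h : T -> \bar R) : (forall y, (0 <= h y)%E) -> h^\+%E = h /\ h^\-%E = cst 0%E.
  move=> h0; split; apply/funext => x.
    by rewrite funeposE; apply/max_idPl; exact: h0.
  by rewrite funenegE; apply/max_idPr; rewrite leeNl oppe0.
have [-> ->] := P f f0; have [-> ->] := P g g0.
apply: leeD2r; apply: ereal_sup_le => _ [h hf <-]; exists h => // x.
exact: le_trans (hf x) (fg x).
Qed.

Lemma dist_bd0 x t : 0 < t -> dist_bd (fun=> 0) (x, t) = t.
Proof.
move=> t0; apply/eqP; rewrite eq_le; apply/andP; split.
  apply: ge_inf; first by exists 0 => _ [Q _ <-]; exact: enorm_ge0.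
  exists (x, 0) => //; rewrite /enorm /= subrr expr0n add0r subr0 sqrtr_sqr.
  exact: gtr0_norm.
apply: lb_le_inf; first by eexists; exists (x, 0).
move=> _ [[y s] s0 <-]; have {s0} -> : s = 0 by exact: s0.
rewrite /enorm /= subr0.
by rewrite -[leLHS](gtr0_norm t0) -sqrtr_sqr ler_wsqrtr// lerDr sqr_ge0.
Qed.

Lemma eball_dist (X Y : R * R) (r : R) : 0 < r -> eball X r Y ->
  `|Y.1 - X.1| <= r /\ `|Y.2 - X.2| <= r.
Proof.
move=> r0; rewrite eballE//= => h; have sq (z : R) : z ^+ 2 <= r ^+ 2 -> `|z| <= r.
  by move=> /ler_wsqrtr; rewrite !sqrtr_sqr (gtr0_norm r0).
by split; apply: sq; rewrite (le_trans _ (ltW h))// ?lerDl ?lerDr sqr_ge0.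
Qed.

Lemma eball_measure (X : R * R) (r : R) : 0 < r ->
  exists2 m : R, 0 < m & mu2 (eball X r) = m%:E.
Proof.
case: X => x t r0; have mB := measurable_eball (x, t) r0.
have box (s : R) : 0 < s -> mu2 (`[x - s, x + s]%classic `*` `[t - s, t + s]%classic) =
    (2 * s * (2 * s))%:E.
  move=> s0; rewrite product_measure1E//= !lebesgue_measure_itv/= !lte_fin.
  have lt (y : R) : y - s < y + s by lra.
  by rewrite !lt -!EFinD -EFinM; congr EFin; ring.
have sub1 : eball (x, t) r `<=` `[x - r, x + r]%classic `*` `[t - r, t + r]%classic.
  by move=> [y s] /(eball_dist r0) /=; rewrite !in_itv/= -!ler_distl.
have sub2 : `[x - r / 2, x + r / 2]%classic `*` `[t - r / 2, t + r / 2]%classic `<=` eball (x, t) r.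
  move=> [y s] /= []; rewrite !in_itv/= => /andP[h1 h2] /andP[h3 h4].
  by rewrite eballE//=; nra.
have mbox (s : R) : measurable (`[x - s, x + s]%classic `*` `[t - s, t + s]%classic).
  by apply: measurableX; exact: measurable_itv.
have up : (mu2 (eball (x, t) r) <= (2 * r * (2 * r))%:E)%E.
  rewrite -box//; apply: (@le_measure _ _ _ mu2 _ _ (mem_set mB)) => //.
  exact: mem_set (mbox r).
have lo : ((2 * (r / 2) * (2 * (r / 2)))%:E <= mu2 (eball (x, t) r))%E.
  rewrite -box ?divr_gt0//; apply: (@le_measure _ _ _ mu2 _ _ _ (mem_set mB)) => //.
  exact: mem_set (mbox (r / 2)).
have fin : mu2 (eball (x, t) r) \is a fin_num.
  by rewrite ge0_fin_numE// (le_lt_trans up)// ltry.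
exists (fine (mu2 (eball (x, t) r))); last by rewrite fineK.
rewrite -lte_fin fineK// (lt_le_trans _ lo)// lte_fin.
by rewrite !mulr_gt0// invr_gt0.
Qed.

(** The point at height x over (x, 0) lies in every cone, whatever the aperture. *)
Lemma Ntilde_lower a w x (c : R) : 0 < a -> 0 < x -> 0 <= c ->
  measurable_fun setT (fun X => (enorm (w X) ^+ 2)%:E) ->
  (forall Y, eball (x, x) (x / 2) Y -> c ^+ 2 <= enorm (w Y) ^+ 2) ->
  (c%:E <= Ntilde a (fun=> 0%R) w (x, 0%R))%E.
Proof.
move=> a0 x0 c0 mw wc; have r0 : 0 < x / 2 by rewrite divr_gt0.
have [m m0 mE] := eball_measure (x, x) r0.
apply: (@le_trans _ _ (average2 (fun=> 0%R) w (x, x))); last first.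
  apply: ereal_sup_ubound; right; exists (x, x) => //; split => //.
  rewrite dist_bd0// /enorm /= subrr expr0n add0r subr0 sqrtr_sqr gtr0_norm//.
  by rewrite mulrDl mul1r lerDl; apply: mulr_ge0; exact: ltW.
rewrite /average2 dist_bd0//= mE /=.
have -> : c%:E = (((c ^+ 2)%:E) `^ 2^-1)%E.
  by rewrite poweR_EFin powR12_sqrt ?sqr_ge0// sqrtr_sqr ger0_norm.
apply: gt0_ler_poweR; rewrite ?invr_ge0 ?in_itv/= ?leey ?andbT ?lee_fin ?sqr_ge0//.
  apply: mule_ge0; first by rewrite lee_fin invr_ge0 ltW.
  by apply: integral_ge0 => X _; rewrite lee_fin sqr_ge0.
have mB := measurable_eball (x, x) r0.
apply: (@le_trans _ _ ((m^-1)%:E * \int[mu2]_(Y in eball (x, x) (x / 2)) (c ^+ 2)%:E)%E).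
  have -> : (\int[mu2]_(Y in eball (x, x) (x / 2)) (c ^+ 2)%:E = (c ^+ 2 * m)%:E)%E.
    have -> : ((c ^+ 2 * m)%:E = (c ^+ 2)%:E * mu2 (eball (x, x) (x / 2)))%E by rewrite mE.
    exact: integral_cst.
  by rewrite -EFinM lee_fin mulrCA mulVf ?mulr1// gt_eqF.
apply: lee_wpmul2l; first by rewrite lee_fin invr_ge0 ltW.
apply: ge0_le_integral => //.
- by move=> Y _; rewrite lee_fin sqr_ge0.
- exact: measurable_funTS mw.
Qed.

(** The reverse triangle inequality, by Cauchy-Schwarz. *)
Lemma csq_combination_ge (U V : R * R) (c d u v : R) : 0 <= c -> 0 <= d -> 0 <= u ->
  0 <= v -> csq U = u ^+ 2 -> csq V = v ^+ 2 ->
  (c * u - d * v) ^+ 2 <= csq (cadd (cscale c U) (cscale (- d) V)).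
Proof.
move=> c0 d0 u0 v0 hU hV.
have dot : U.1 * V.1 + U.2 * V.2 <= u * v.
  have : (U.1 * V.1 + U.2 * V.2) ^+ 2 <= (u * v) ^+ 2.
    rewrite exprMn -hU -hV /csq -subr_ge0.
    rewrite (_ : _ - _ = (U.1 * V.2 - U.2 * V.1) ^+ 2) ?sqr_ge0//; ring.
  move=> /ler_wsqrtr; rewrite !sqrtr_sqr (ger0_norm (mulr_ge0 u0 v0)).
  exact: le_trans (ler_norm _).
have -> : csq (cadd (cscale c U) (cscale (- d) V)) =
    c ^+ 2 * csq U - 2 * (c * d) * (U.1 * V.1 + U.2 * V.2) + d ^+ 2 * csq V.
  by rewrite /csq /cadd /cscale /=; ring.
rewrite hU hV (_ : (c * u - d * v) ^+ 2 = c ^+ 2 * u ^+ 2 - 2 * (c * d) * (u * v) + d ^+ 2 * v ^+ 2); last by ring.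
by rewrite lerD2r lerD2l lerN2 ler_wpM2l// mulr_ge0// mulr_ge0.
Qed.

(** The squared gradient is exactly (a^2 + b^2) times that of the holomorphic
    function, by the Cauchy-Riemann equations. *)
Lemma potgrad_ge (H1 : R -> R -> R * R) (kap a q : R) (X : R * R) :
  a ^+ 2 * csq (H1 X.1 X.2) <= enorm (potgrad H1 kap a q X) ^+ 2.
Proof.
rewrite enorm_sq /potgrad /kink /= /re /im /csq; set b := potcoef _ _ _ _.
have -> : (a * (-1 * (H1 X.1 X.2).2) + b * (H1 X.1 X.2).1) ^+ 2 +
   (a * (H1 X.1 X.2).1 + b * (H1 X.1 X.2).2) ^+ 2 =
   a ^+ 2 * ((H1 X.1 X.2).1 ^+ 2 + (H1 X.1 X.2).2 ^+ 2) +
   b ^+ 2 * ((H1 X.1 X.2).1 ^+ 2 + (H1 X.1 X.2).2 ^+ 2) by ring.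
by rewrite lerDl mulr_ge0 ?sqr_ge0// addr_ge0 ?sqr_ge0.
Qed.

Section Lower.
Variables (al e : R).
Hypotheses (al0 : 0 < al) (al1 : al < 1) (e0 : 0 < e).

(** Near the origin the derivative of the power dominates that of the
    mollifying factor. *)
Lemma prof1_ge x (Y : R * R) : e <= x -> x <= al / 54 -> eball (x, x) (x / 2) Y ->
  (al / 2 * cabs (- 9) 0 2 * cabs (al - 1) 0 (3 * x)) ^+ 2 <=
    csq (prof1 al e Y.1 Y.2).
Proof.
have [h1 h2 h3] := And3 al0 al1 e0.
case: Y => y s ex xd; have x0 : 0 < x by rewrite (lt_le_trans e0).
have x1 : x <= 54^-1 by rewrite (le_trans xd)//; lra.
have r0 : 0 < x / 2 by rewrite divr_gt0.
move=> /(eball_dist r0) /= [+ +]; rewrite !ler_norml => /andP[y1 y2] /andP[s1 s2].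
(* In the ball the distance from t - i x to - e is at most 3 x <= al / 18, so that
   the term in al dominates the other one by a factor of two at least. *)
have se : 0 < s + e by lra.
have r3 : y ^+ 2 + (s + e) ^+ 2 <= 0 ^+ 2 + (3 * x) ^+ 2 by rewrite expr0n add0r; nra.
have rle : cabs (al - 1) 0 (3 * x) <= cabs (al - 1) y (s + e).
  by apply: cabs_antimono => //; lra.
have rho : cabs 1 y (s + e) <= al / 18.
  apply: (@le_trans _ _ (cabs 1 0 (3 * x))); first exact: cabs_mono.
  rewrite cabs1 ?mulr_gt0// expr0n add0r sqrtr_sqr gtr0_norm ?mulr_gt0//; lra.
have vle : cabs (- 9) 0 2 <= cabs (- 9) y (s + 1).
  by apply: cabs_antimono; [rewrite oppr_le0|lra|rewrite expr0n add0r; nra].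
have v10 : cabs (- 10) y (s + 1) <= cabs (- 9) y (s + 1) by apply: cabs_exp_mono; lra.
set r := cabs (al - 1) y (s + e) in rle *; set v := cabs (- 9) y (s + 1) in vle v10 *.
have r_gt0 : 0 < r := cabs_gt0 _ _ _; have v_gt0 : 0 < v := cabs_gt0 _ _ _.
set z := cabs (- 10) y (s + 1) in v10; have z_gt0 : 0 < z := cabs_gt0 _ _ _.
have c2 := cabs_gt0 (- 9 : R) 0 2; have c3 := cabs_gt0 (al - 1) 0 (3 * x).
have al_r : cabs al y (s + e) = r * cabs 1 y (s + e) by rewrite -cabsD subrK.
have hU : csq (term al e 1 0 y s) = (r * v) ^+ 2.
  by rewrite /term csq_cmul !csq_cpow exprMn subr0.
have hV : csq (term al e 0 1 y s) = (cabs al y (s + e) * z) ^+ 2.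
  by rewrite /term csq_cmul !csq_cpow exprMn subr0 (_ : - 9 - 1 = - 10 :> R)//; ring.
have := csq_combination_ge (ltW al0) (_ : 0 <= 9) (_ : 0 <= r * v)
  (_ : 0 <= cabs al y (s + e) * z) hU hV.
move=> /(_ (ler0n R 9) (ltW (mulr_gt0 r_gt0 v_gt0)) (ltW (mulr_gt0 (cabs_gt0 _ _ _) z_gt0))).
apply: le_trans; rewrite al_r.
have rho0 := cabs_gt0 1 y (s + e); set rh := cabs 1 y (s + e) in rho rho0 *.
have g1 : r * rh * z <= al / 18 * (r * v).
  rewrite (_ : al / 18 * (r * v) = r * (al / 18) * v); last by ring.
  by apply: ler_pM; rewrite ?mulr_ge0 ?(ltW rho0) ?(ltW r_gt0) ?(ltW z_gt0)// ler_wpM2l// ltW.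
have g2 : cabs (- 9) 0 2 * cabs (al - 1) 0 (3 * x) <= r * v.
  by rewrite mulrC; exact: (ler_pM (ltW c3) (ltW c2) rle vle).
have g3 := ler_wpM2l (ltW (divr_gt0 al0 (ltr0Sn R 1))) g2.
have g4 : 0 <= al / 2 * cabs (- 9) 0 2 * cabs (al - 1) 0 (3 * x).
  by rewrite !mulr_ge0 ?(ltW c2) ?(ltW c3) ?(ltW al0)// invr_ge0.
have g5 : al / 2 * cabs (- 9) 0 2 * cabs (al - 1) 0 (3 * x) <= al * (r * v) - 9 * (r * rh * z).
  by rewrite -mulrA; lra.
by rewrite ler_sqr ?nnegrE// (le_trans g4).
Qed.

End Lower.

Variables (p a : R).
Hypotheses (p1 : 1 < p) (a0 : 0 < a).

(** For e <= x <= al/54 the p-th power of the maximal function is at least a fixed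
    multiple of 1/x, whose integral over this interval is log(al/54) - log e. *)
Lemma Ntilde_norm_unbounded (amp q D : R) : 0 < amp ->
  exists e, [/\ 0 < e, e <= 1 & (D%:E < bd_norm (fun=> 0%R) p
    (Ntilde a (fun=> 0%R) (potgrad (prof1 (alpha p) e) (kappa p) amp q)))%E].
Proof.
move=> amp0; have /andP[al0 al1] := alpha_itv p1; have p0 : 0 < p by rewrite (lt_trans _ p1).
set al := alpha p in al0 al1 *.
pose k := amp * (al / 2 * cabs (- 9) 0 2).
have k0 : 0 < k by rewrite !mulr_gt0 ?cabs_gt0// invr_gt0.
pose dl := al / 54; have dl0 : 0 < dl by rewrite divr_gt0.
have dl1 : dl <= 1 by rewrite /dl; lra.
(* The integral of k^p / (3 x) from e to dl is k^p M / 3. *)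
pose M := 3 / k `^ p * (`|D| + 1) `^ p.
have kp0 : 0 < k `^ p by exact: powR_gt0.
have M0 : 0 < M by rewrite mulr_gt0 ?divr_gt0// powR_gt0// ltr_wpDl.
pose e := dl * expR (- M); exists e.
have e0 : 0 < e by rewrite mulr_gt0 ?expR_gt0.
have ed : e < dl by rewrite gtr_pMr// -expR0 ltr_expR oppr_lt0.
have e1 : e <= 1 by exact: le_trans (ltW ed) dl1.
split => //; have hP := prof_is_profile al0 al1 e0 e1.
set G := potgrad _ _ _ _; set N := Ntilde _ _ _.
have mG : measurable_fun setT (fun X => (enorm (G X) ^+ 2)%:E).
  have [_ [m1 _] [m2 _] _ _] := dominated_flux hP (kappa p) amp q.
  have mc i : measurable_fun setT (fun X => if i then (G X).2 else (G X).1).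
    by case: i; [move: m2|move: m1]; congr measurable_fun; apply/funext => -[].
  apply/measurable_EFinP; rewrite (_ : (fun _ => _) = fun X => (G X).1 ^+ 2 + (G X).2 ^+ 2).
    by apply: measurable_funD; apply: measurable_funX; [exact: (mc false)|exact: (mc true)].
  by apply/funext => X; rewrite enorm_sq.
have low x : e <= x -> x <= dl -> ((k * cabs (al - 1) 0 (3 * x))%:E <= N (x, 0%R))%E.
  move=> ex xd; have x0 : 0 < x by exact: lt_le_trans ex.
  apply: Ntilde_lower => //; first by rewrite ltW// mulr_gt0// cabs_gt0.
  move=> Y hY; apply: le_trans (potgrad_ge _ _ _ _ _).
  rewrite /k -mulrA exprMn; apply: ler_wpM2l; first exact: sqr_ge0.
  by apply: prof1_ge.
have lowp x : e <= x -> x <= dl -> ((k `^ p / 3 * x^-1)%:E <= `|N (x, 0%R)| `^ p)%E.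
  move=> ex xd; have x0 : 0 < x by exact: lt_le_trans ex.
  have -> : k `^ p / 3 * x^-1 = (k * cabs (al - 1) 0 (3 * x)) `^ p.
    rewrite powRM ?(ltW k0) ?(ltW (cabs_gt0 _ _ _))// -mulrA; congr (_ * _).
    rewrite /cabs -expRM expr0n add0r.
    have -> : (al - 1) / 2 * ln ((3 * x) ^+ 2) * p = - ln (3 * x).
      rewrite lnXn ?mulr_gt0// -mulr_natl /al /alpha; field; by rewrite gt_eqF.
    by rewrite expRN lnK ?posrE ?mulr_gt0// invfM.
  have kc0 : 0 <= k * cabs (al - 1) 0 (3 * x) by rewrite ltW// mulr_gt0// cabs_gt0.
  rewrite -poweR_EFin; apply: gt0_ler_poweR; rewrite ?in_itv/= ?leey ?andbT ?lee_fin ?abse_ge0 ?(ltW p0)//.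
  by rewrite (le_trans (low x ex xd))// lee_abs.
have L : (((`|D| + 1) `^ p)%:E <= \int[mu]_x (`|N (x, 0%R)| `^ p))%E.
  apply: (@le_trans _ _ (\int[mu]_x (((fun x => (k `^ p / 3 * x^-1)%:E) \_ `[e, dl]) x))%E).
    rewrite -integral_mkcond.
    have dln (x : R) : e <= x <= dl -> is_derive x 1 (fun y => k `^ p / 3 * ln y) (k `^ p / 3 * x^-1).
      move=> /andP[ex _]; have x0 : 0 < x by exact: lt_le_trans ex.
      exact: (is_deriveZ (k `^ p / 3) (is_derive1_ln x0)).
    rewrite (integral_derive ed dln); last first.
      move=> x /andP[ex _]; have x0 : 0 < x by exact: lt_le_trans ex.
      by apply: cvgM; [exact: cvg_cst|apply: cvgV => //; rewrite gt_eqF].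
    rewrite lee_fin /e lnM ?posrE ?expR_gt0// expRK -mulrBr.
    rewrite (_ : ln dl - (ln dl + - M) = M); last by ring.
    rewrite /M le_eqVlt; apply/orP; left; apply/eqP; field; by rewrite gt_eqF.
  apply: ge0_integral_mono => x; rewrite patchE.
    case: ifPn => // /set_mem /=; rewrite in_itv/= => /andP[ex _].
    by rewrite lee_fin !mulr_ge0 ?invr_ge0 ?(ltW kp0)// (le_trans (ltW e0)).
  case: ifPn => [/set_mem /=|_]; last exact: poweR_ge0.
  by rewrite in_itv/= => /andP[ex xd]; exact: lowp.
rewrite bd_normE; apply: (@lt_le_trans _ _ ((((`|D| + 1) `^ p)%:E) `^ p^-1)%E).
  rewrite poweR_EFin -powRrM mulfV ?gt_eqF// powRr1 ?addr_ge0// lte_fin.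
  by rewrite (le_lt_trans (ler_norm D))// ltrDl.
apply: gt0_ler_poweR; rewrite ?in_itv/= ?leey ?andbT ?lee_fin ?powR_ge0 ?invr_ge0 ?(ltW p0)//.
by apply: integral_ge0 => x _; exact: poweR_ge0.
Qed.

End MaximalFunction.

(** * The Neumann data belong to the Hardy space *)

Section HardySpace.
Context {R : realType}.
Notation mu := (@lebesgue_measure R).
Implicit Types (x : R) (n j : nat).

(** Telescoping these indicators gives the dyadic annuli. *)
Definition dyadic n : R -> R := \1_`]- (2 ^+ n), 2 ^+ n[.

Lemma dyadicE n x : dyadic n x = if `|x| < 2 ^+ n then 1 else 0.
Proof.
rewrite /dyadic indicE; have [xn|xn] := ltP `|x| (2 ^+ n).
  by rewrite mem_set//= in_itv/= -ltr_norml.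
by rewrite memNset//= in_itv/= -ltr_norml; apply/negP; rewrite -leNgt.
Qed.

Lemma dyadic_le1 n x : `|dyadic n x| <= 1.
Proof. by rewrite dyadicE; case: ifP; rewrite ?normr1 ?normr0. Qed.

Lemma measurable_dyadic n : measurable_fun setT (dyadic n).
Proof. exact: measurable_indic. Qed.

Lemma dyadic_cvg x : dyadic n x @[n --> \oo] --> (1 : R).
Proof.
apply: cvg_near_cst; near=> n; rewrite dyadicE ifT//.
have xn : `|x| <= n%:R by near: n; exact: nbhs_infty_ger.
by rewrite (le_lt_trans xn)// -natrX ltr_nat ltn_expl.
Unshelve. all: by end_near. Qed.

Section Data.
Variables H0 H1 H2 : R -> R -> R * R.
Hypothesis hP : profile H0 H1 H2.
Variable kap : R.
Notation g := (data H1 kap).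

Lemma data_dyadic_integrable n : mu.-integrable setT (EFin \o (fun x => g x * dyadic n x)).
Proof.
have [K hK] := data_le hP kap.
exact: (line_integrableM (measurable_data hP kap) (measurable_dyadic n)
  (fun x => (hK x).2) (dyadic_le1 n)).
Qed.

(** The data are the derivative of an even function. *)
Lemma integral_data_dyadic n : (\int[mu]_x (g x * dyadic n x)%:E = 0)%E.
Proof.
set L : R := 2 ^+ n; have L0 : 0 < L by rewrite exprn_gt0.
pose W s x := re H0 x 0 + s * im H0 x 0.
pose w s x := - im H1 x 0 + s * re H1 x 0.
have dW s (x : R) : is_derive x 1 (W s) (w s x).
  have [h1 h2 _ _] := profile_holo01 hP x (lexx 0).
  exact: (is_deriveD h1 (is_deriveZ s h2)).
have cw s (x : R) : {for x, continuous (w s)}.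
  have [h1 h2 _ _] := profile_holo12 hP x (lexx 0).
  have c1 := is_derive1_continuous h1; have c2 := is_derive1_continuous h2.
  by apply: cvgD; [exact: cvgN|apply: cvgM => //; exact: cvg_cst].
have mw s (A : set R) : measurable A -> measurable_fun A (EFin \o w s).
  move=> mA; apply/measurable_EFinP; apply: measurable_funTS.
  by apply: continuous_measurable_fun => x; exact: cw.
have [r1 r2] := profile_reflects0 hP L 0.
rewrite integral_line_split; last first.
  by apply: measurable_funM; [exact: measurable_data hP kap|exact: measurable_dyadic].
rewrite (@integral_superset _ _ `]- L, 0[%classic)//; last 2 first.
- by move=> x /=; rewrite !in_itv/= => /andP[].
- move=> x /=; rewrite !in_itv/= dyadicE => x0 h; rewrite ifF ?mulr0//.
  by apply/negbTE/negP; rewrite ltr_norml => /andP[xL _]; apply: h; rewrite xL x0.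
rewrite (@integral_superset _ _ `]0, L[%classic `]0, +oo[%classic)//; last 2 first.
- by move=> x /=; rewrite !in_itv/= andbT => /andP[].
- move=> x /=; rewrite !in_itv/= andbT dyadicE => x0 h; rewrite ifF ?mulr0//.
  by apply/negbTE/negP; rewrite ltr_norml => /andP[_ xL]; apply: h; rewrite xL x0.
have -> : (\int[mu]_(x in `](- L)%R, 0%R[) (g x * dyadic n x)%:E =
    \int[mu]_(x in `](- L)%R, 0%R[) (w kap x)%:E)%E.
  apply: eq_integral => x; rewrite inE/= in_itv/= => /andP[h1 h2].
  rewrite dyadicE ifT; last by rewrite ltr_norml h1 (lt_trans h2).
  by rewrite mulr1 /data /w ltr0_sg//; congr EFin; ring.
have -> : (\int[mu]_(x in `]0%R, L[) (g x * dyadic n x)%:E =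
    \int[mu]_(x in `]0%R, L[) (w (- kap) x)%:E)%E.
  apply: eq_integral => x; rewrite inE/= in_itv/= => /andP[h1 h2].
  rewrite dyadicE ifT; last by rewrite ltr_norml h2 (lt_trans _ h1)// oppr_lt0.
  by rewrite mulr1 /data /w gtr0_sg//; congr EFin; ring.
rewrite -(integral_itv_bndoo true false); last exact: mw.
rewrite -[X in (_ + X)%E](integral_itv_bndoo true false); last exact: mw.
rewrite (@integral_derive _ (W kap)) ?oppr_lt0//.
rewrite (@integral_derive _ (W (- kap)))//.
rewrite -EFinD /W /re /im r1 r2; congr EFin.
have := reflects_im0 0 (profile_reflects0 hP); rewrite /im => ->; ring.
Qed.

Definition piece j x : R :=
  if j is i.+1 then g x * dyadic j x - g x * dyadic i x else g x * dyadic 0 x.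

Lemma sum_piece n x : \sum_(0 <= j < n.+1) piece j x = g x * dyadic n x.
Proof.
elim: n => [|n IH]; first by rewrite big_nat1.
by rewrite big_nat_recr//= IH addrC subrK.
Qed.

(** The bound is the one of an atom on the interval of radius 2^j, up to the factor
    K / 2^j. *)
Lemma piece_le : exists2 K, 0 < K & forall j x,
  (`|piece j x| <= K / 2 ^+ j / (2 ^+ j - - 2 ^+ j)) /\
  (x \notin `[- 2 ^+ j, 2 ^+ j] -> piece j x = 0).
Proof.
have [K hK] := data_le hP kap.
have hK' x : `|g x| <= (`|K| + 1) * (1 + x ^+ 2)^-1.
  have u0 : 0 < (1 + x ^+ 2)^-1 by rewrite invr_gt0 oneDsq_gt0.
  have [_ h] := hK x; rewrite (le_trans h)// ler_wpM2r ?(ltW u0)//.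
  by rewrite (le_trans (ler_norm K))// lerDl.
set B := `|K| + 1 in hK'; have B0 : 0 < B by rewrite ltr_wpDl.
exists (8 * B) => [|j x]; first by rewrite mulr_gt0.
have t0 i : (0 : R) < 2 ^+ i by rewrite exprn_gt0.
split; last first.
  rewrite in_itv/= -ler_norml -ltNge => xj.
  have z i : 2 ^+ i <= `|x| -> dyadic i x = 0 by move=> h; rewrite dyadicE ltNge h.
  case: j xj => [|j] xj; first by rewrite /piece z ?mulr0// ltW.
  rewrite /piece !z ?mulr0 ?subr0// ?(ltW xj)//.
  by rewrite (le_trans _ (ltW xj))// exprS ler_peMl// ?(ltW (t0 j))// ler1n.
have -> : 8 * B / 2 ^+ j / (2 ^+ j - - 2 ^+ j) = 4 * B / (2 ^+ j) ^+ 2.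
  have -> : 2 ^+ j - - 2 ^+ j = 2 * 2 ^+ j :> R by ring.
  by field; rewrite gt_eqF.
have R0 : 0 <= 4 * B / (2 ^+ j) ^+ 2 by rewrite divr_ge0 ?sqr_ge0// mulr_ge0// ltW.
case: j R0 => [|j] R0.
  rewrite /piece normrM (le_trans (ler_pM _ _ (hK' x) (dyadic_le1 0 x)))// mulr1.
  rewrite expr0 expr1n divr1 mulrC; apply: ler_pM; rewrite ?invr_ge0 ?(ltW (oneDsq_gt0 _)) ?(ltW B0)//.
  rewrite (@le_trans _ _ 1) ?ler1n// invf_le1 ?oneDsq_gt0// lerDl sqr_ge0//.
rewrite /piece -mulrBr !dyadicE; have [h1|h1] := ltP `|x| (2 ^+ j).
  rewrite ifT ?subrr ?mulr0 ?normr0//.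
  by rewrite (lt_le_trans h1)// exprS ler_peMl// ?(ltW (t0 j))// ler1n.
case: ifP => _; last by rewrite subrr mulr0 normr0.
rewrite subr0 mulr1 (le_trans (hK' x))// (exprS 2 j) exprMn.
have -> : 4 * B / (2 ^+ 2 * (2 ^+ j) ^+ 2) = B * ((2 ^+ j) ^+ 2)^-1.
  by field; rewrite gt_eqF.
rewrite ler_wpM2l ?(ltW B0)// lef_pV2 ?posrE ?oneDsq_gt0 ?exprn_gt0//.
have : (2 ^+ j) ^+ 2 <= x ^+ 2.
  by rewrite -[leRHS]real_normK ?num_real// ler_sqr ?nnegrE// ltW.
by move=> h; rewrite (le_trans h)// lerDr.
Qed.

(** The pieces of the data on dyadic annuli are multiples of atoms, and their
    sizes decay geometrically. *)
Lemma data_H1 : Defs.H1 g.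
Proof.
have mg := measurable_data hP kap; split => //.
have [K K0 hK] := piece_le; pose c j : R := K / 2 ^+ j.
have t0 i : (0 : R) < 2 ^+ i by rewrite exprn_gt0.
have c0 j : 0 < c j by rewrite divr_gt0.
have mp j : measurable_fun setT (piece j).
  have m i : measurable_fun setT (fun x => g x * dyadic i x).
    by apply: measurable_funM => //; exact: measurable_dyadic.
  by case: j => [|j]; [exact: m|apply: measurable_funB; exact: m].
exists c, (fun j x => (c j)^-1 * piece j x); split.
- move=> j; split; first exact: measurable_funM.
  exists (- 2 ^+ j), (2 ^+ j); split.
  + by rewrite gtrN.
  + by move=> x xj; have [_ ->] := hK j x; rewrite ?mulr0.
  + move=> x; have [h _] := hK j x.
    by rewrite normrM normfV (gtr0_norm (c0 j)) ler_pdivrMl.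
  + under eq_integral do rewrite EFinM.
    rewrite integralZl//; last first.
      case: j => [|j]; first exact: data_dyadic_integrable.
      by apply: integrable_EFinB => //; exact: data_dyadic_integrable.
    suff -> : (\int[mu]_x (piece j x)%:E = 0)%E by rewrite mule0.
    case: j => [|j]; first exact: integral_data_dyadic.
    rewrite /piece; under eq_integral do rewrite EFinB.
    rewrite integralB//; [|exact: data_dyadic_integrable|exact: data_dyadic_integrable].
    by rewrite !integral_data_dyadic sube0.
- have -> : (fun j => `|c j|) = geometric K 2^-1.
    by apply/funext => j; rewrite gtr0_norm//= exprVn.
  apply: is_cvg_geometric_series; rewrite gtr0_norm ?invr_gt0// invf_lt1//.
  by rewrite ltr1n.
- rewrite -cvg_shiftS.
  have z : (\int[mu]_x (cst 0%E) x = 0)%E by rewrite integral_cst// mul0e.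
  have -> : (fun n => \int[mu]_x (`|g x - \sum_(0 <= j < n.+1) c j * ((c j)^-1 * piece j x)|)%:E)%E =
      (fun n => \int[mu]_x (`|g x - g x * dyadic n x|)%:E)%E.
    apply/funext => n; apply: eq_integral => x _; congr (`|g x - _|)%:E.
    rewrite -sum_piece; apply: eq_bigr => j _; rewrite mulrA mulfV ?mul1r// gt_eqF//.
  suff : (fun n => \int[mu]_x (`|g x - g x * dyadic n x|)%:E)%E @ \oo -->
      (\int[mu]_x (cst 0%E) x)%E by rewrite z.
  have [K' hK'] := data_le hP kap.
  apply: (@dominated_cvg _ _ R mu setT measurableT _ _
    (fun x => ((`|K'| * 2)%:E * ((1 + x ^+ 2)^-1)%:E)%E)).
  + move=> n; apply/measurable_EFinP; apply: measurableT_comp => //.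
    apply: measurable_funB => //; apply: measurable_funM => //; exact: measurable_dyadic.
  + move=> x _; apply/cvg_EFin; first by near=> n.
    rewrite /comp /= -[X in _ --> X](@normr0 _ R); apply: cvg_norm.
    rewrite -[X in _ --> X](subrr (g x)); apply: cvgB; first exact: cvg_cst.
    rewrite -[X in _ --> X]mulr1; apply: cvgM; first exact: cvg_cst.
    exact: dyadic_cvg.
  + by [].
  + by apply: integrableZl => //; exact: integrable_oneDsqrV.
  + move=> n x _; have u0 : 0 < (1 + x ^+ 2)^-1 by rewrite invr_gt0 oneDsq_gt0.
    rewrite -EFinM lee_fin /= normr_id -{1}[g x]mulr1 -mulrBr normrM.
    have [_ h] := hK' x.
    rewrite mulrAC; apply: ler_pM => //.
      by rewrite (le_trans h)// ler_wpM2r ?(ltW u0)// ler_norm.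
    have := ler_normB (1 : R) (dyadic n x); rewrite normr1 => /le_trans; apply.
    by rewrite (_ : 2 = 1 + 1 :> R)// lerD2l dyadic_le1.
Unshelve. all: by end_near. Qed.

End Data.
End HardySpace.

(** * Failure of both problems *)

Theorem mainTheorem3 (R : realType) (a : R) (ha : 0 < a) (p : R) (hp : 1 < p) :
  exists (phi : R -> R) (A : R -> 'M[R]_2),
    [/\ lipschitz phi,
        elliptic (above phi) (fun X => A X.1),
        ~ neumann_p a phi (fun X => A X.1) p
      & ~ regularity_p a phi (fun X => A X.1) p].
Proof.
have p1 := ltW hp; have [D hD] := data_norm_bounded hp.
have /andP[al0 al1] := alpha_itv hp.
have k0 := kappa_gt0 hp.
exists (fun=> 0), (coefmx (kappa p)); split.
- apply: filterS (nbhs_pinfty_ge (num_real 0)) => M M0 [x y] _ /=.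
  by rewrite subrr normr0 mulr_ge0.
- exact: coefmx_elliptic.
- move=> [C C0 hC].
  have amp0 : 0 < kappa p / (1 + 4 * kappa p ^+ 2).
    by rewrite divr_gt0// ltr_pwDl// mulr_ge0// sqr_ge0.
  have [e [e0 e1]] := Ntilde_norm_unbounded hp ha 1 (C * D) amp0.
  have hP := prof_is_profile al0 al1 e0 e1.
  apply/negP; rewrite -leNgt.
  apply: le_trans (hC (fun X => data (prof1 (alpha p) e) (kappa p) X.1) _ _ _ _
    (pot_neumann hP (kappa p))) _.
  + exact: (data_bd_Lp hP _ p1).
  + rewrite /bd_H1 (_ : (fun _ => _) = data (prof1 (alpha p) e) (kappa p)).
      exact: (data_H1 hP).
    by apply/funext => x; rewrite arc0 mulr1.
  + by rewrite EFinM lee_wpmul2l ?lee_fin ?(ltW C0)//; exact: hD.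
- move=> [C C0 hC].
  have [e [e0 e1]] := Ntilde_norm_unbounded hp ha (3 * kappa p) (C * D) ltr01.
  have hP := prof_is_profile al0 al1 e0 e1.
  apply/negP; rewrite -leNgt.
  have ls : forall q : R, 1 <= q -> bd_Lp (fun=> 0) q (pot (prof0 (alpha p) e) (kappa p) 1 (3 * kappa p)).
    by move=> q q1; exact: (pot_bd_Lp hP _ q1).
  have q2 : 1 <= 2 :> R by lra.
  have q7 : 1 <= 7 / 6 :> R by lra.
  have q17 : 1 <= 17 / 6 :> R by lra.
  apply: le_trans (hC _ (fun X => data (prof1 (alpha p) e) (kappa p) X.1) _ _
    (pot_bd_W1 hP (kappa p) p1) (pot_bd_W1 hP (kappa p) q2) (ls _ q7) (ls _ q17)
    (pot_tan_deriv hP (kappa p))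
    (pot_dirichlet hP (approx_test2 (alpha p) (kappa p) e0))) _.
  by rewrite EFinM lee_wpmul2l ?lee_fin ?(ltW C0)//; exact: hD.
Qed.
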